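(* For every involution $s\in I(\Phi)$ there is $\sigma\in\mathrm{Inv}^\tau_s(\mathfrak g_{\mathbb R},\mathfrak h_{\mathbb R})$ such that the real form $\mathfrak g_\sigma$ of $\mathfrak g$ is quasi-split.
   Context: $\mathfrak g$ is a complex semisimple Lie algebra, $\mathfrak h$ a Cartan subalgebra, $\Phi=\Phi(\mathfrak g,\mathfrak h)$, $\mathfrak h_{\mathbb R}=\{H\in\mathfrak h:\alpha(H)\in\mathbb R\ \forall\alpha\}$; the Killing form gives an inner product on $V=\mathfrak h_{\mathbb R}^*$ in which $\Phi$ is a root system; $I(\Phi)$ is the set of orthogonal involutions of $V$ preserving $\Phi$. Fix a Chevalley system $\{(X_\alpha,H_\alpha)\}$: $X_\alpha\in\mathfrak g^\alpha$, $H_\alpha\in\mathfrak h_{\mathbb R}$, $\alpha(H_\beta)\in\mathbb Z$, $[X_\alpha,X_{-\alpha}]=-H_\alpha$, $[H_\alpha,X_{\pm\alpha}]=\pm2X_{\pm\alpha}$, with $\mathfrak g_{\mathbb R}=\mathfrak h_{\mathbb R}\oplus\bigoplus_\alpha\mathbb RX_\alpha$ a split real form and $\tau$ ($\tau|_{\mathfrak h_{\mathbb R}}=-\mathrm{id}$, $\tau X_\alpha=X_{-\alpha}$) an involutive automorphism of $\mathfrak g_{\mathbb R}$; $\mathfrak g_u=\{X\in\mathfrak g_{\mathbb R}:\tau X=X\}\oplus i\{X\in\mathfrak g_{\mathbb R}:\tau X=-X\}$. Automorphisms of $\mathfrak g_{\mathbb R}$ are extended anti-$\mathbb C$-linearly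 to $\mathfrak g$. $\mathrm{Inv}^\tau(\mathfrak g_{\mathbb R},\mathfrak h_{\mathbb R})$ is the set of involutive automorphisms $\sigma$ of $\mathfrak g_{\mathbb R}$ with $\sigma(\mathfrak h_{\mathbb R})=\mathfrak h_{\mathbb R}$ and $\sigma(\mathfrak g_u)=\mathfrak g_u$; $\rho(\sigma)\in I(\Phi)$ is $\alpha\mapsto\alpha\circ\sigma^{-1}|_{\mathfrak h_{\mathbb R}}$; $\mathrm{Inv}^\tau_s=\{\sigma:\rho(\sigma)=s\}$; $\mathfrak g_\sigma=\{X\in\mathfrak g_{\mathbb R}:\sigma X=X\}\oplus i\{X\in\mathfrak g_{\mathbb R}:\sigma X=-X\}$. A real form $\mathfrak g_0$ of $\mathfrak g$ is quasi-split if there is a Borel subalgebra $\mathfrak b$ of $\mathfrak g$ invariant under the anti-$\mathbb C$-linear involution of $\mathfrak g$ whose fixed point set is $\mathfrak g_0$. *)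

(* Defs.v *)
(* complex numbers are  R[i]  (mathcomp-real-closed) over an
   arbitrary  R : realType  (so R[i] is the field of complex numbers).
   A complex Lie algebra is a finite-dimensional  V : vectType R[i]  with a
   bracket  br.  Real subspaces of V (real forms, h_R, g_R, g_u, g_sigma) are
   predicates  V -> Prop.  Automorphisms of g_R are represented by their
   anti-C-linear extensions to V, as in the paper. *)
From HB Require Import structures.
From mathcomp Require Import all_boot all_order all_algebra.
From mathcomp Require Import complex reals.
From Stdlib Require List.
Set Implicit Arguments. Unset Strict Implicit. Unset Printing Implicit Defensive.
Import Order.TTheory GRing.Theory Num.Theory.
Local Open Scope ring_scope.

Section LieDefs.
Variable R : realType.
Local Notation C := (R[i]).
Variable V : vectType C.
Variable br : V -> V -> V.

(* ---------- Lie algebras ---------- *)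
Definition lie_bracket : Prop :=
  [/\ forall (a : C) (x y z : V), br (a *: x + y) z = a *: br x z + br y z,
      forall (a : C) (x y z : V), br z (a *: x + y) = a *: br z x + br z y,
      forall x : V, br x x = 0
    & forall x y z : V, br x (br y z) + br y (br z x) + br z (br x y) = 0].

(* [A, B] : the complex span of all brackets [a, b], a in A, b in B *)
Definition brs (A B : {vspace V}) : {vspace V} :=
  (\sum_(i < \dim A) \sum_(j < \dim B)
      <[br (tnth (vbasis A) i) (tnth (vbasis B) j)]>)%VS.

Definition subalg (A : {vspace V}) : Prop := (brs A A <= A)%VS.
Definition ideal (A : {vspace V}) : Prop := (brs fullv A <= A)%VS.

Fixpoint derived (A : {vspace V}) (n : nat) : {vspace V} :=
  if n is k.+1 then brs (derived A k) (derived A k) else A.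
Fixpoint lcs (A : {vspace V}) (n : nat) : {vspace V} :=
  if n is k.+1 then brs A (lcs A k) else A.

Definition solvable_sub (A : {vspace V}) : Prop := exists n, derived A n = 0%VS.
Definition nilpotent_sub (A : {vspace V}) : Prop := exists n, lcs A n = 0%VS.

(* semisimple: no nonzero solvable ideal *)
Definition semisimple : Prop :=
  forall A : {vspace V}, ideal A -> solvable_sub A -> A = 0%VS.

(* Cartan subalgebra: nilpotent self-normalizing subalgebra *)
Definition cartan (h : {vspace V}) : Prop :=
  [/\ subalg h, nilpotent_sub h
    & forall x : V, (forall y, y \in h -> br x y \in h) -> x \in h].

(* Borel subalgebra: maximal solvable subalgebra *)
Definition borel (b : {vspace V}) : Prop :=
  [/\ subalg b, solvable_sub b
    & forall b' : {vspace V}, subalg b' -> solvable_sub b' -> (b <= b')%VS -> b' = b].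

(* ---------- roots (functionals are functions V -> C, only their values on h matter) ---------- *)
Variable h : {vspace V}.

Definition rootsp (a : V -> C) (x : V) : Prop :=
  forall H, H \in h -> br H x = a H *: x.

(* a restricted to h is a root: nonzero and g^a <> 0 *)
Definition is_root (a : V -> C) : Prop :=
  (exists2 H, H \in h & a H != 0) /\ (exists2 x, x != 0 & rootsp a x).

Definition negf (a : V -> C) : V -> C := fun v => - a v.

Definition is_realC (z : C) : Prop := exists r : R, z = r%:C%C.

(* h_R = { H in h : alpha(H) real for all roots alpha } *)
Definition in_hR (H : V) : Prop :=
  H \in h /\ forall a, is_root a -> is_realC (a H).

(* Killing form  kappa(x,y) = tr (ad x o ad y), trace computed in a basis *)
Definition killing (x y : V) : C :=
  \sum_(i < \dim (fullv : {vspace V}))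
     coord (vbasis fullv) i (br x (br y (tnth (vbasis fullv) i))).

(* ---------- Chevalley system ---------- *)
Definition chevalley (X Hc : (V -> C) -> V) : Prop :=
  forall a, is_root a ->
  [/\ X a != 0, rootsp a (X a) & in_hR (Hc a)] /\
  [/\ br (X a) (X (negf a)) = - Hc a,
      br (Hc a) (X a) = 2%:R *: X a
    & br (Hc a) (X (negf a)) = - (2%:R *: X (negf a))] /\
  (forall b, is_root b -> exists z : int, b (Hc a) = z%:~R) /\
  (forall b, is_root b -> (forall H, H \in h -> a H = b H) ->
         X a = X b /\ Hc a = Hc b).

(* g_R = h_R (+) (+)_alpha R X_alpha  (real span) *)
Definition in_gR (X : (V -> C) -> V) (x : V) : Prop :=
  exists H, exists s : seq ((V -> C) * R),
    [/\ in_hR H, (forall p, List.In p s -> is_root p.1)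
      & x = H + \sum_(p <- s) (p.2%:C)%C *: X p.1].

(* P is a real form of V: a real Lie subalgebra with V = P (+) iP *)
Definition real_form (P : V -> Prop) : Prop :=
  [/\ P 0, (forall x y, P x -> P y -> P (x + y))
    & (forall (r : R) x, P x -> P ((r%:C)%C *: x))] /\
  [/\ (forall x y, P x -> P y -> P (br x y)),
      (forall v, exists x y, [/\ P x, P y & v = x + 'i%C *: y])
    & (forall x y, P x -> P y -> x + 'i%C *: y = 0 -> x = 0 /\ y = 0)].

Definition antilinear (f : V -> V) : Prop :=
  forall (a : C) (x y : V), f (a *: x + y) = (a^*)%C *: f x + f y.

(* f is (the anti-C-linear extension of) an involutive automorphism of P *)
Definition inv_aut (P : V -> Prop) (f : V -> V) : Prop :=
  [/\ antilinear f, (forall x, P x -> P (f x)),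
      (forall x y, P x -> P y -> f (br x y) = br (f x) (f y))
    & (forall x, P x -> f (f x) = x)].

(* real subspace  {x in P : f x = x} (+) i {x in P : f x = - x} *)
Definition twisted (P : V -> Prop) (f : V -> V) (v : V) : Prop :=
  exists x y, [/\ P x, P y, f x = x, f y = - y & v = x + 'i%C *: y].

Definition maps_onto (f : V -> V) (P : V -> Prop) : Prop :=
  (forall x, P x -> P (f x)) /\ (forall y, P y -> exists2 x, P x & f x = y).

(* ---------- V = h_R^* : real linear functionals on h_R ---------- *)
Definition hRdual (l : V -> C) : Prop :=
  (forall H, in_hR H -> is_realC (l H)) /\
  (forall (r : R) H K, in_hR H -> in_hR K ->
     l ((r%:C)%C *: H + K) = (r%:C)%C * l H + l K).

Definition eqhR (l m : V -> C) : Prop := forall H, in_hR H -> l H = m H.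

(* t is the element of h_R dual to l via the Killing form *)
Definition dualvec (l : V -> C) (t : V) : Prop :=
  in_hR t /\ forall H, in_hR H -> killing t H = l H.

(* I(Phi): orthogonal involutions of h_R^* preserving Phi *)
Definition in_IPhi (s : (V -> C) -> (V -> C)) : Prop :=
  [/\ (forall l, hRdual l -> hRdual (s l))
    & (forall l m, hRdual l -> hRdual m -> eqhR l m -> eqhR (s l) (s m))] /\
  [/\
      (forall (r : R) l m, hRdual l -> hRdual m ->
          eqhR (s (fun v => (r%:C)%C * l v + m v)) (fun v => (r%:C)%C * s l v + s m v)),
      (forall l, hRdual l -> eqhR (s (s l)) l),
      (forall l m tl tm tsl tsm, hRdual l -> hRdual m ->
          dualvec l tl -> dualvec m tm -> dualvec (s l) tsl -> dualvec (s m) tsm ->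
          killing tsl tsm = killing tl tm)
    & (forall a, is_root a -> exists2 b, is_root b & eqhR (s a) b) /\
      (forall b, is_root b -> exists2 a, is_root a & eqhR (s a) b)].

(* rho(sigma) = s :  s(l) = l o sigma^{-1} on h_R, i.e. s(l)(sigma H) = l(H) *)
Definition rho_is (sigma : V -> V) (s : (V -> C) -> (V -> C)) : Prop :=
  forall l, hRdual l -> forall H, in_hR H -> s l (sigma H) = l H.

(* quasi-split real form: some Borel subalgebra is stable under the
   anti-C-linear involution whose fixed point set is the real form *)
Definition quasi_split (P : V -> Prop) : Prop :=
  exists theta : V -> V,
    [/\ antilinear theta, (forall x, theta (theta x) = x),
        (forall x, theta x = x <-> P x)
      & exists2 b : {vspace V}, borel b &
          maps_onto theta (fun x => x \in b)].

End LieDefs.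

(* Main.v *)
(* The real form g_sigma is the fixed point set of sigma itself, so sigma has to be a lift of s
   that stabilizes a Borel subalgebra. Choose x0 in h_R fixed by s and otherwise generic: the
   roots vanishing on x0 are the imaginary ones, those with s a = -a. Refine x0 to a positive
   system; s preserves the positive roots that are not imaginary. By the isomorphism theorem
   (the subalgebra of g x g generated by the pairs of matching Chevalley generators is a graph,
   because a highest weight module of it is), s lifts to an automorphism with prescribed signs
   on the simple roots. Take the sign -1 on the imaginary simple roots. A principal sl2 triple
   (e, h0, f) of the Levi subalgebra centralizing x0 then satisfies sigma e = f. For the other
   simple roots a, s a is the top of the principal string that starts at a simple root a', and
   the sign making sigma X_a a positive multiple of e^N X_a' yields sigma^2 = 1. Finally the
   Cayley transform exp(ad f) exp(-ad e / 2) fixes x0 and carries h0 to e + f, which sigma fixes,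
   so it carries the Borel subalgebra of the positive system to a sigma-stable one. *)
Require Import Defs.
From HB Require Import structures.
From mathcomp Require Import all_boot all_order all_algebra.
From mathcomp Require Import complex reals boolp.
From mathcomp Require Import ring lra zify.
Set Implicit Arguments. Unset Strict Implicit. Unset Printing Implicit Defensive.
Import Order.TTheory GRing.Theory Num.Theory.
Local Open Scope ring_scope.
Local Open Scope complex_scope.

(** As soon as an imaginary root [a] exists, no Borel subalgebra containing the Cartan subalgebra is
    stable, because a lift of [s] exchanges the root spaces of [a] and [- a]. What can be stable is
    a Borel subalgebra cut out by eigenvalues: [T x0] and [e + f] commute, are fixed by sigma and
    have real eigenvalues, so the antilinear sigma preserves their joint eigenspaces, and those with
    lexicographically nonnegative eigenvalues add up to a Borel subalgebra. The difficulty is to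
    have sigma^2 = 1 at the same time. Signs can be prescribed on simple roots only, and [s] does
    not permute these: for [a] simple and not imaginary, [s a] is a simple root [a'] plus imaginary
    simple roots, and the sign of sigma on its root vector is out of direct control. Writing that
    root vector through [e] and [X a'] recovers it. That the string from [a'] ends exactly at [s a]
    is a count of heights: the lengths of the strings from [a] and [a'] add up to twice the
    imaginary height of [s a], and neither exceeds that height. *)

Section LieBasics.
Variables (R : realType) (V : vectType R[i]) (br : V -> V -> V).
Hypothesis Hlie : lie_bracket br.

Lemma brDl x y z : br (x + y) z = br x z + br y z.
Proof. by case: Hlie => H _ _ _; have := H 1 x y z; rewrite !scale1r. Qed.
Lemma brDr x y z : br x (y + z) = br x y + br x z.
Proof. by case: Hlie => _ H _ _; have := H 1 y z x; rewrite !scale1r. Qed.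
Lemma br0l x : br 0 x = 0.
Proof. by apply: (@addrI _ (br 0 x)); rewrite -brDl !addr0. Qed.
Lemma br0r x : br x 0 = 0.
Proof. by apply: (@addrI _ (br x 0)); rewrite -brDr !addr0. Qed.
Lemma brZl a x y : br (a *: x) y = a *: br x y.
Proof. by case: Hlie => H _ _ _; have := H a x 0 y; rewrite !addr0 br0l addr0. Qed.
Lemma brZr a x y : br x (a *: y) = a *: br x y.
Proof. by case: Hlie => _ H _ _; have := H a y 0 x; rewrite !addr0 br0r addr0. Qed.
Lemma brNl x y : br (- x) y = - br x y.
Proof. by rewrite -(scaleN1r x) brZl scaleN1r. Qed.
Lemma brNr x y : br x (- y) = - br x y.
Proof. by rewrite -(scaleN1r y) brZr scaleN1r. Qed.
Lemma brC x y : br x y = - br y x.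
Proof.
case: Hlie => _ _ H _; have := H (x + y).
by rewrite brDl !brDr !H add0r addr0 => /eqP; rewrite addr_eq0 => /eqP.
Qed.
Lemma brxx x : br x x = 0.
Proof. by case: Hlie. Qed.
Lemma br_der x y z : br x (br y z) = br (br x y) z + br y (br x z).
Proof.
case: Hlie => _ _ _ /(_ x y z) H.
rewrite [br (br x y) z]brC [br x z]brC brNr.
by apply/eqP; rewrite -subr_eq0 opprD !opprK [_ + br y _]addrC addrA H.
Qed.
Lemma br_sumr I r (P : pred I) (F : I -> V) x :
  br x (\sum_(i <- r | P i) F i) = \sum_(i <- r | P i) br x (F i).
Proof. by apply: (big_morph (br x) (fun y z => brDr x y z) (br0r x)). Qed.
Lemma br_suml I r (P : pred I) (F : I -> V) x :
  br (\sum_(i <- r | P i) F i) x = \sum_(i <- r | P i) br (F i) x.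
Proof. by apply: (big_morph (br^~ x) (fun y z => brDl y z x) (br0l x)). Qed.

Definition lin_closed (P : V -> Prop) :=
  P 0 /\ forall (a : R[i]) x y, P x -> P y -> P (a *: x + y).

Lemma lcZ P a x : lin_closed P -> P x -> P (a *: x).
Proof. by move=> [P0 PL] Px; rewrite -[_ *: _]addr0; apply: PL. Qed.
Lemma lcD P x y : lin_closed P -> P x -> P y -> P (x + y).
Proof. by move=> [P0 PL] Px Py; rewrite -[x]scale1r; apply: PL. Qed.
Lemma lcN P x : lin_closed P -> P x -> P (- x).
Proof. by move=> LP Px; rewrite -scaleN1r; apply: lcZ. Qed.
Lemma lcZK P a x : lin_closed P -> a != 0 -> P (a *: x) -> P x.
Proof. by move=> LP a0 /(@lcZ _ a^-1 _ LP); rewrite scalerA mulVf // scale1r. Qed.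
Lemma lc_sum P (I : eqType) (r : seq I) (F : I -> V) :
  lin_closed P -> (forall i, i \in r -> P (F i)) -> P (\sum_(i <- r) F i).
Proof.
move=> LP H; rewrite big_seq; elim/big_rec: _ => [|i x ir Px]; first by case: LP.
by apply: lcD => //; apply: H.
Qed.

Lemma vspace_lin_closed (U : {vspace V}) : lin_closed (fun v => v \in U).
Proof. by split=> [|a x y Ux Uy]; [exact: mem0v | rewrite memvD // memvZ]. Qed.

(** A vector of [P] outside [U] can be adjoined, which raises the dimension; [k] bounds how often
    this can still happen. This turns Prop-valued linear conditions into subspaces. *)
Lemma vspace_of_pred (P : V -> Prop) : lin_closed P ->
  exists U : {vspace V}, forall v, v \in U <-> P v.
Proof.
move=> LP; pose N := \dim {:V}.
suff H k (U : {vspace V}) : (\dim U + k >= N)%N -> (forall v, v \in U -> P v) ->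
    exists U : {vspace V}, forall v, v \in U <-> P v.
  apply: (H N 0%VS); first by rewrite dimv0.
  by move=> v; rewrite memv0 => /eqP ->; case: LP.
elim: k U => [|k IH] U dU UP.
  exists U => v; split; first exact: UP.
  move=> _; have /eqP <- : (fullv == U).
    by rewrite eq_sym eqEdim subvf; move: dU; rewrite addn0.
  exact: memvf.
have [H|] := pselect (forall v, P v -> v \in U).
  by exists U => v; split=> [/UP|/H].
move=> /existsNP [v /not_implyP [Pv /negP vU]].
apply: (IH (U + <[v]>)%VS).
  apply: (leq_trans dU); rewrite addnS -addSn leq_add2r ltn_neqAle dimvS ?addvSl // andbT.
  apply/negP => /eqP E; have /eqP UE : (U == U + <[v]>)%VS by rewrite eqEdim addvSl E leqnn.
  by case/negP: vU; rewrite UE (subvP (addvSr _ _)) ?memv_line.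
move=> w /memv_addP [u uU [x /vlineP [a ->] ->]].
by apply: lcD => //; [exact: UP | exact: lcZ].
Qed.

Lemma mem_brs (A B : {vspace V}) a b : a \in A -> b \in B -> br a b \in brs br A B.
Proof.
move=> aA bB; rewrite (coord_vbasis aA) (coord_vbasis bB) br_suml memv_suml // => i _.
rewrite br_sumr memv_suml // => j _; rewrite brZl brZr !memvZ //.
rewrite /brs; apply: (subvP (sumv_sup i isT (sumv_sup j isT (subvv _)))).
by rewrite !(tnth_nth 0) memv_line.
Qed.

Lemma brs_ind (A B : {vspace V}) (P : V -> Prop) : lin_closed P ->
  (forall a b, a \in A -> b \in B -> P (br a b)) -> forall v, v \in brs br A B -> P v.
Proof.
move=> LP H v; have [U UP] := vspace_of_pred LP.
move=> vB; apply/UP; move: vB; apply/subvP; rewrite /brs.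
apply/subv_sumP => i _; apply/subv_sumP => j _; rewrite -memvE; apply/UP.
by apply: H; apply: vbasis_mem; apply: mem_tnth.
Qed.

Lemma brs_sub (A B U : {vspace V}) :
  (forall a b, a \in A -> b \in B -> br a b \in U) -> (brs br A B <= U)%VS.
Proof. by move=> H; apply/subvP; apply: brs_ind => //; exact: vspace_lin_closed. Qed.

Fixpoint adn (n : nat) (x v : V) : V := if n is k.+1 then br x (adn k x v) else v.

Lemma adnS n x v : adn n.+1 x v = br x (adn n x v). Proof. by []. Qed.
Lemma adnSr n x v : adn n.+1 x v = adn n x (br x v).
Proof. by elim: n v => //= n IH v; rewrite -IH. Qed.
Lemma adnD m n x v : adn (m + n) x v = adn m x (adn n x v).
Proof. by elim: m => //= m ->. Qed.
Lemma adn0 n x : adn n x 0 = 0.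
Proof. by elim: n => //= n ->; rewrite br0r. Qed.
Lemma adn_lin n x a u v : adn n x (a *: u + v) = a *: adn n x u + adn n x v.
Proof. by elim: n => //= n ->; rewrite brDr brZr. Qed.
Lemma adnDr n x u v : adn n x (u + v) = adn n x u + adn n x v.
Proof. by have := adn_lin n x 1 u v; rewrite !scale1r. Qed.
Lemma adnZ n x a u : adn n x (a *: u) = a *: adn n x u.
Proof. by have := adn_lin n x a u 0; rewrite adn0 !addr0. Qed.
Lemma adn_sum n x I r (P : pred I) (F : I -> V) :
  adn n x (\sum_(i <- r | P i) F i) = \sum_(i <- r | P i) adn n x (F i).
Proof. by apply: (big_morph (adn n x) (adnDr n x) (adn0 n x)). Qed.
Lemma adn_ge m n x v : (n <= m)%N -> adn n x v = 0 -> adn m x v = 0.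
Proof. by move=> /subnK <- E; rewrite adnD E adn0. Qed.

End LieBasics.

(** * Sums of eigenvectors and generic vectors *)

Section Eigen.
Variables (F : fieldType) (U : lmodType F) (T : U -> U).
Hypothesis TL : forall a x y, T (a *: x + y) = a *: T x + T y.

Let T0 : T 0 = 0.
Proof. by apply: (@addrI _ (T 0)); have := TL 1 0 0; rewrite !scale1r !addr0 => <-. Qed.
Let TZ a x : T (a *: x) = a *: T x.
Proof. by have := TL a x 0; rewrite T0 !addr0. Qed.
Let TD x y : T (x + y) = T x + T y.
Proof. by have := TL 1 x y; rewrite !scale1r. Qed.

(** [T - t p] kills the term at [p] and rescales the others, so by induction it kills the whole sum
    [u]; then T^n u = 0 with [t p != 0] forces u = 0. Indices and eigenvalues may repeat, which
    suits lists of functions without decidable equality. *)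
Lemma eigensum_nilp (I : Type) (L : seq I) (x : I -> U) (t : I -> F) n :
  (forall p, List.In p L -> T (x p) = t p *: x p) -> (forall p, List.In p L -> t p != 0) ->
  iter n T (\sum_(p <- L) x p) = 0 -> \sum_(p <- L) x p = 0.
Proof.
have itL m a y z : iter m T (a *: y + z) = a *: iter m T y + iter m T z.
  by elim: m => //= m ->; rewrite TL.
elim: L x => [|p L IH] x Hx Ht Hn; first by rewrite big_nil.
pose u := \sum_(q <- p :: L) x q.
have E : T u - t p *: u = \sum_(q <- L) (t q - t p) *: x q.
  rewrite /u !big_cons TD scalerDr Hx; last by left.
  rewrite opprD addrACA subrr add0r.
  have HL q : List.In q L -> T (x q) = t q *: x q by move=> ?; apply: Hx; right.
  elim: {IH Hn u Hx Ht} L HL => [|q L IH] HL; first by rewrite !big_nil T0 scaler0 subr0.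
  rewrite !big_cons TD scalerDr HL; last by left.
  by rewrite opprD addrACA -scalerBl IH // => r ?; apply: HL; right.
have Tu : T u = t p *: u.
  apply/eqP; rewrite -subr_eq0 E; apply/eqP; apply: IH.
  - by move=> q qL; rewrite TZ Hx ?scalerA 1?mulrC //; right.
  - by move=> q qL; apply: Ht; right.
  have {1}-> : \sum_(q <- L) (t q - t p) *: x q = (- t p) *: u + T u by rewrite -E scaleNr addrC.
  by rewrite itL -iterSr iterS Hn T0 scaler0 addr0.
have : iter n T u = t p ^+ n *: u.
  by elim: (n) => [|m IHm]; rewrite ?scale1r //= IHm TZ Tu scalerA -exprSr.
rewrite Hn => /esym/eqP; rewrite scaler_eq0 expf_eq0 (negbTE (Ht p _)); last by left.
by rewrite andbF => /eqP.
Qed.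

(** Applying [T - t p] removes the term at [p] and keeps the sum in [P]; distinct eigenvalues leave
    nonzero factors on the other terms, and the term at [p] follows by subtraction. *)
Lemma eigensum_closed (I : eqType) (L : seq I) (x : I -> U) (t : I -> F) (P : U -> Prop) :
  P 0 -> (forall a y z, P y -> P z -> P (a *: y + z)) -> (forall y, P y -> P (T y)) ->
  uniq L -> {in L &, injective t} -> (forall p, p \in L -> T (x p) = t p *: x p) ->
  P (\sum_(p <- L) x p) -> forall p, p \in L -> P (x p).
Proof.
move=> P0 PL PT; elim: L x => [//|p L IH] x /= /andP [pL uL] it Hx Pu.
pose u := \sum_(q <- p :: L) x q.
have E : T u - t p *: u = \sum_(q <- L) (t q - t p) *: x q.
  rewrite /u !big_cons TD scalerDr Hx ?mem_head //.
  rewrite opprD addrACA subrr add0r.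
  have HL q : q \in L -> T (x q) = t q *: x q by move=> ?; apply: Hx; rewrite inE orbC; apply/orP; left.
  elim: {IH Pu u uL it Hx pL} L HL => [|q L IH] HL; first by rewrite !big_nil T0 scaler0 subr0.
  rewrite !big_cons TD scalerDr HL ?mem_head //.
  by rewrite opprD addrACA -scalerBl IH // => r rL; apply: HL; rewrite inE rL orbT.
have PE : P (\sum_(q <- L) (t q - t p) *: x q).
  by rewrite -E addrC -scaleNr; apply: PL => //; apply: PT.
have PLs q : q \in L -> P (x q).
  move=> qL; have tne : t q - t p != 0.
    rewrite subr_eq0; apply/negP => /eqP /it; rewrite !inE qL orbT eqxx /= => /(_ isT isT) qp.
    by move: pL; rewrite -qp qL.
  have := IH (fun q => (t q - t p) *: x q) uL _ _ PE q qL.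
  have i1 : {in L &, injective t}.
    by move=> a b aL bL; apply: it; rewrite inE ?aL ?bL orbT.
  have i2 r : r \in L -> T ((t r - t p) *: x r) = t r *: ((t r - t p) *: x r).
    by move=> rL; rewrite TZ Hx ?inE ?rL ?orbT // !scalerA mulrC.
  move=> /(_ i1 i2) H; have := PL (t q - t p)^-1 _ _ H P0.
  by rewrite scalerA mulVf // scale1r addr0.
move=> q; rewrite inE => /predU1P [->|]; last exact: PLs.
have Ps : P (\sum_(q <- L) x q).
  rewrite big_seq; elim/big_rec: _ => // i y iL Py.
  by rewrite -[x i]scale1r; apply: PL => //; apply: PLs.
by have := PL (-1) _ _ Ps Pu; rewrite big_cons scaleN1r addrCA addNr addr0.
Qed.

End Eigen.

Lemma mem_InP (I : eqType) (s : seq I) x : List.In x s <-> x \in s.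
Proof.
elim: s => //= y s IH; rewrite inE; split=> [[->|/IH ->]|/predU1P [->|/IH]]; rewrite ?eqxx ?orbT //; by [left|right].
Qed.

Section Generic.
Variables (F : numFieldType) (U : lmodType F) (P : U -> Prop).
Hypothesis P0 : P 0.
Hypothesis PL : forall a y z, P y -> P z -> P (a *: y + z).

(** Moving from [u] along [y], a functional nonzero at [y] vanishes for one scalar only, and a
    functional zero at [y] keeps its value at [u]. *)
Lemma generic_vector (I : Type) (fs : seq I) (f : I -> U -> F) :
  (forall i a y z, List.In i fs -> P y -> P z -> f i (a *: y + z) = a * f i y + f i z) ->
  (forall i, List.In i fs -> exists2 y, P y & f i y != 0) ->
  exists2 u, P u & forall i, List.In i fs -> f i u != 0.
Proof.
elim: fs => [|j fs IH] Hl Hn; first by exists 0.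
have [||u Pu Hu] := IH; [by move=> i *; apply: Hl => //; right | by move=> i ?; apply: Hn; right |].
have [y Py jy] := Hn j (or_introl erefl).
pose bad := - f j u / f j y :: [seq - f i u / f i y | i <- fs].
have [a abad] : exists a : F, a \notin bad.
  (* A number larger in norm than every forbidden scalar. *)
  pose a := \sum_(z <- bad) `|z| + 1; exists a; apply/negP => az.
  have : `|a| <= a - 1.
    by rewrite {2}/a addrK (perm_big _ (perm_to_rem az)) /= big_cons lerDl sumr_ge0.
  by rewrite ger0_norm ?addr_ge0 ?sumr_ge0 // lerDl oppr_ge0 ler10.
have Hi i : List.In i (j :: fs) -> - f i u / f i y \in bad.
  case=> [<-|Hi]; first by rewrite mem_head.
  rewrite inE; apply/orP; right.
  elim: (fs) Hi => //= k gs IHg [->|H]; first by rewrite mem_head.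
  by rewrite inE IHg ?orbT.
exists (a *: y + u); first exact: PL.
move=> i Hin; rewrite Hl //; apply/negP => /eqP E.
have [fy0|fyn] := eqVneq (f i y) 0.
  move: E; rewrite fy0 mulr0 add0r => E; case: Hin => [ij|/Hu]; last by rewrite E eqxx.
  by move: jy; rewrite ij fy0 eqxx.
move: abad; rewrite (_ : a = - f i u / f i y) ?Hi //.
by apply: (mulIf fyn); rewrite divfK //; apply/eqP; rewrite -addr_eq0 E.
Qed.

End Generic.

Section Pairing.
Variables (R : realType) (d : nat).
Implicit Types (a b x y : 'rV[R]_d).

(** The first argument is a functional and the second a vector, so the symmetry of this product has
    no invariant meaning. Its positivity merely exhibits a vector at which a given nonzero
    functional does not vanish. *)
Definition pr a x : R := (a *m x^T) 0 0.

Lemma prDl a b x : pr (a + b) x = pr a x + pr b x.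
Proof. by rewrite /pr mulmxDl mxE. Qed.
Lemma prDr a x y : pr a (x + y) = pr a x + pr a y.
Proof. by rewrite /pr linearD mulmxDr mxE. Qed.
Lemma prZl r a x : pr (r *: a) x = r * pr a x.
Proof. by rewrite /pr -scalemxAl mxE. Qed.
Lemma prZr r a x : pr a (r *: x) = r * pr a x.
Proof. by rewrite /pr linearZ -scalemxAr mxE. Qed.
Lemma prNl a x : pr (- a) x = - pr a x.
Proof. by rewrite -scaleN1r prZl mulN1r. Qed.
Lemma prNr a x : pr a (- x) = - pr a x.
Proof. by rewrite -scaleN1r prZr mulN1r. Qed.
Lemma pr0l x : pr 0 x = 0.
Proof. by rewrite /pr mul0mx mxE. Qed.
Lemma pr0r x : pr x 0 = 0.
Proof. by rewrite /pr trmx0 mulmx0 mxE. Qed.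
Lemma pr_suml I r (P : pred I) (F : I -> 'rV[R]_d) x :
  pr (\sum_(i <- r | P i) F i) x = \sum_(i <- r | P i) pr (F i) x.
Proof. by apply: (big_morph (pr^~ x) (fun a b => prDl a b x) (pr0l x)). Qed.
Lemma pr_sumr I r (P : pred I) (F : I -> 'rV[R]_d) x :
  pr x (\sum_(i <- r | P i) F i) = \sum_(i <- r | P i) pr x (F i).
Proof. by apply: (big_morph (pr x) (fun a b => prDr x a b) (pr0r x)). Qed.
Lemma prMnl a n x : pr (a *+ n) x = pr a x *+ n.
Proof. by elim: n => [|n IH]; rewrite ?mulr0n ?pr0l // !mulrS prDl IH. Qed.
Lemma pr_mx a x (S : 'M[R]_d) : pr (a *m S) x = pr a (x *m S^T).
Proof. by rewrite /pr trmx_mul trmxK mulmxA. Qed.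
Lemma mulmx_involK (S : 'M[R]_d) a : S *m S = 1%:M -> a *m S *m S = a.
Proof. by move=> SS; rewrite -mulmxA SS mulmx1. Qed.
Lemma mulmx_trinvolK (S : 'M[R]_d) x : S *m S = 1%:M -> x *m S^T *m S^T = x.
Proof. by move=> SS; rewrite -mulmxA -trmx_mul SS trmx1 mulmx1. Qed.
Lemma pr_gt0 a : a != 0 -> 0 < pr a a.
Proof.
move=> a0; rewrite lt_def; have E : pr a a = \sum_j a 0 j ^+ 2.
  by rewrite /pr mxE; apply: eq_bigr => j _; rewrite mxE.
rewrite E sumr_ge0 ?andbT => [|j _]; last exact: sqr_ge0.
apply/negP => /eqP H; case/negP: a0; apply/eqP/rowP => j; rewrite mxE.
by have /eqP := psumr_eq0P (fun j _ => sqr_ge0 (a 0 j)) H (i := j) isT; rewrite sqrf_eq0 => /eqP.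
Qed.
Lemma pr_eq a b : (forall x, pr a x = pr b x) -> a = b.
Proof.
move=> H; apply/eqP; rewrite -subr_eq0; apply/negP => /negP /pr_gt0.
by rewrite prDl prNl H subrr ltxx.
Qed.

(** A generic vector for the differences of elements of [s]. With it a single operator ad (T x)
    tells all the weights in [s] apart. *)
Lemma separating (s : seq 'rV[R]_d) : exists x, {in s &, injective (pr^~ x)}.
Proof.
pose L := [seq (a, b) | a <- s, b <- s]; pose fs := [seq p <- L | p.1 != p.2].
have [||x _ Hx] := @generic_vector R 'rV[R]_d (fun _ => True) I (fun _ _ _ _ _ => I) _ fs
    (fun p => pr (p.1 - p.2)).
- by move=> p r y z _ _ _; rewrite prDr prZr.
- move=> p /mem_InP; rewrite mem_filter => /andP [pn _].
  by exists (p.1 - p.2) => //; rewrite gt_eqF // pr_gt0 // subr_eq0.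
exists x => a b aP bP Eab; apply/eqP; apply: contraT => ab.
have /Hx : List.In (a, b) fs.
  by apply/mem_InP; rewrite mem_filter /= ab; apply/allpairsP; exists (a, b).
by rewrite /= prDl prNl Eab subrr eqxx.
Qed.

End Pairing.

(** * Root strings *)

(* The split real form in coordinates: 'rV_d is h_R, by means of a basis (T x is the
   element of h_R with coordinates x), and also its dual, paired by pr. *)
Record chevdata (R : realType) (V : vectType R[i]) (br : V -> V -> V) := ChevData {
  cd_d : nat;
  cd_Phi : seq 'rV[R]_cd_d;
  cd_T : 'rV[R]_cd_d -> V;
  cd_X : 'rV[R]_cd_d -> V;
  cd_Co : 'rV[R]_cd_d -> 'rV[R]_cd_d;
  cd_cf : 'rV[R]_cd_d -> V -> R[i];
  cd_tau : V -> V;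
  Phi_uniq : uniq cd_Phi;
  Phi0 : 0 \notin cd_Phi;
  PhiN : forall a, a \in cd_Phi -> - a \in cd_Phi;
  T_lin : forall r x y, cd_T (r *: x + y) = r%:C *: cd_T x + cd_T y;
  brTX : forall x a, a \in cd_Phi -> br (cd_T x) (cd_X a) = (pr a x)%:C *: cd_X a;
  brTT : forall x y, br (cd_T x) (cd_T y) = 0;
  cf_lin : forall a (z : R[i]) u v, cd_cf a (z *: u + v) = z * cd_cf a u + cd_cf a v;
  cf_T : forall a x, cd_cf a (cd_T x) = 0;
  cf_X : forall a b, a \in cd_Phi -> b \in cd_Phi -> cd_cf a (cd_X b) = (a == b)%:R;
  cf_decomp : forall v, exists x y,
    v = cd_T x + 'i *: cd_T y + \sum_(a <- cd_Phi) cd_cf a v *: cd_X a;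
  Phi_nondeg : forall x, (forall a, a \in cd_Phi -> pr a x = 0) -> x = 0;
  brXN : forall a, a \in cd_Phi -> br (cd_X a) (cd_X (- a)) = - cd_T (cd_Co a);
  prCo2 : forall a, a \in cd_Phi -> pr a (cd_Co a) = 2%:R;
  prCoZ : forall a b, a \in cd_Phi -> b \in cd_Phi -> exists z : int, pr b (cd_Co a) = z%:~R;
  cf_real : forall a b c, a \in cd_Phi -> b \in cd_Phi -> c \in cd_Phi ->
    exists r : R, cd_cf c (br (cd_X a) (cd_X b)) = r%:C;
  tau_antilin : antilinear cd_tau;
  tau_br : forall u v, cd_tau (br u v) = br (cd_tau u) (cd_tau v);
  tau_T : forall x, cd_tau (cd_T x) = - cd_T x;
  tau_X : forall a, a \in cd_Phi -> cd_tau (cd_X a) = cd_X (- a)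
}.

Section Sl2.
Variables (R : realType) (V : vectType R[i]) (br : V -> V -> V).
Hypothesis Hlie : lie_bracket br.
Variables (e f k : V).
Hypotheses (ef : br e f = k) (ke : br k e = 2%:R *: e).

Lemma sl2_weight n v (mu : R[i]) : br k v = - mu *: v ->
  br k (adn br n e v) = (n%:R *+ 2 - mu) *: adn br n e v.
Proof.
move=> kv; elim: n => [|n IH] /=; first by rewrite mul0rn add0r.
rewrite (br_der Hlie) ke IH (brZl Hlie) (brZr Hlie) -scalerDl; congr (_ *: _); ring.
Qed.

Lemma sl2_lower n v (mu : R[i]) : br f v = 0 -> br k v = - mu *: v ->
  br f (adn br n.+1 e v) = (n.+1%:R * (mu - n%:R)) *: adn br n e v.
Proof.
move=> fv kv; have fe w : br f (br e w) = - br k w + br e (br f w).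
  by rewrite (br_der Hlie) (brC Hlie f e) ef (brNl Hlie).
elim: n => [|n IH]; rewrite adnS fe.
  by rewrite fv kv (br0r Hlie) addr0 -scaleNr opprK subr0 mul1r.
rewrite (sl2_weight n.+1 kv) IH (brZr Hlie) -scaleNr -adnS -scalerDl; congr (_ *: _); ring.
Qed.

(** Let m + 1 be the first power of [e] that kills [v]. Applying [f] to it gives (m + 1)(mu - m) e^m
    v = 0, hence mu = m. *)
Lemma sl2_lowest v (mu : R[i]) K : v != 0 -> adn br K e v = 0 ->
  br f v = 0 -> br k v = - mu *: v ->
  exists m : nat, [/\ mu = m%:R, forall n, (n <= m)%N -> adn br n e v != 0
    & adn br m.+1 e v = 0].
Proof.
move=> v0 vK fv kv.
have ex : exists n, adn br n e v == 0 by exists K; apply/eqP.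
case: (ex_minnP ex) => -[/eqP /= v00|m /eqP Em Hm]; first by rewrite v00 eqxx in v0.
have nz n : (n <= m)%N -> adn br n e v != 0.
  by move=> nm; apply/negP => /Hm; rewrite ltnNge nm.
exists m; split=> //; have := sl2_lower m fv kv.
rewrite Em (br0r Hlie) => /esym/eqP; rewrite scaler_eq0 (negbTE (nz m (leqnn m))) orbF mulf_eq0.
by rewrite pnatr_eq0 /= subr_eq0 => /eqP.
Qed.

End Sl2.

Section Roots.
Variables (R : realType) (V : vectType R[i]) (br : V -> V -> V).
Hypothesis Hlie : lie_bracket br.
Variable D : chevdata br.
Local Notation E := 'rV[R]_(cd_d D).
Local Notation Phi := (cd_Phi D).
Local Notation T := (@cd_T _ _ _ D).
Local Notation X := (@cd_X _ _ _ D).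
Local Notation Co := (@cd_Co _ _ _ D).
Local Notation cf := (@cd_cf _ _ _ D).

Lemma TD x y : T (x + y) = T x + T y.
Proof. by have := T_lin 1 x y; rewrite !scale1r. Qed.
Lemma T0 : T 0 = 0.
Proof. by apply: (@addrI _ (T 0)); rewrite -TD !addr0. Qed.
Lemma TZ r x : T (r *: x) = r%:C *: T x.
Proof. by have := T_lin r x 0; rewrite T0 !addr0. Qed.
Lemma TN x : T (- x) = - T x.
Proof. by rewrite -scaleN1r TZ rmorphN /= scaleN1r. Qed.
Lemma T_sum I r (P : pred I) (F : I -> E) :
  T (\sum_(i <- r | P i) F i) = \sum_(i <- r | P i) T (F i).
Proof. by apply: (big_morph T TD T0). Qed.
Lemma cfD a u v : cf a (u + v) = cf a u + cf a v.
Proof. by have := cf_lin a 1 u v; rewrite scale1r mul1r. Qed.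
Lemma cf0 a : cf a 0 = 0.
Proof. by apply: (@addrI _ (cf a 0)); rewrite -cfD !addr0. Qed.
Lemma cfZ a z v : cf a (z *: v) = z * cf a v.
Proof. by have := cf_lin a z v 0; rewrite cf0 !addr0. Qed.
Lemma cfN a v : cf a (- v) = - cf a v.
Proof. by rewrite -scaleN1r cfZ mulN1r. Qed.
Lemma cf_sum a I r (P : pred I) (F : I -> V) :
  cf a (\sum_(i <- r | P i) F i) = \sum_(i <- r | P i) cf a (F i).
Proof. by apply: (big_morph (cf a) (cfD a) (cf0 a)). Qed.

Lemma Phi_neq0 a : a \in Phi -> a != 0.
Proof. by move=> aP; apply: contraNneq (Phi0 D) => <-. Qed.
Lemma PhiNE a : (- a \in Phi) = (a \in Phi).
Proof. by apply/idP/idP => /PhiN //; rewrite opprK. Qed.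

Lemma X_neq0 a : a \in Phi -> X a != 0.
Proof.
move=> aP; apply/negP => /eqP E0; have := cf_X aP aP.
by rewrite E0 cf0 eqxx => /esym/eqP; rewrite oner_eq0.
Qed.

Lemma rC_inj (x y : R) : x%:C = y%:C -> x = y.
Proof. by case. Qed.

Lemma rC_eq0 (x : R) : (x%:C == 0) = (x == 0).
Proof. by apply/eqP/eqP => [/rC_inj|->]. Qed.

Lemma T_eq0 x y : T x + 'i *: T y = 0 -> x = 0 /\ y = 0.
Proof.
move=> E0; have H a : a \in Phi -> pr a x = 0 /\ pr a y = 0.
  move=> aP; have : br (T x + 'i *: T y) (X a) = 0 by rewrite E0 (br0l Hlie).
  rewrite (brDl Hlie) (brZl Hlie) !brTX // scalerA -scalerDl => /eqP.
  rewrite scaler_eq0 (negbTE (X_neq0 aP)) orbF eq_complex /= => /andP [].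
  by rewrite !mul0r !mul1r subr0 !addr0 !add0r => /eqP -> /eqP ->.
by split; apply: Phi_nondeg => a /H [].
Qed.

Lemma T_inj : injective T.
Proof.
move=> x y E0; have [] := @T_eq0 (x - y) 0.
  by rewrite T0 scaler0 addr0 TD TN E0 subrr.
by move/eqP; rewrite subr_eq0 => /eqP.
Qed.

Lemma cf_ad a x v : a \in Phi -> cf a (br (T x) v) = (pr a x)%:C * cf a v.
Proof.
move=> aP; have [y [z Ev]] := cf_decomp D v.
have -> : br (T x) v = \sum_(b <- Phi) (cf b v * (pr b x)%:C) *: X b.
  rewrite {1}Ev !(brDr Hlie) (brZr Hlie) !brTT scaler0 !add0r (br_sumr Hlie).
  by apply: eq_big_seq => b bP; rewrite (brZr Hlie) brTX // scalerA.
rewrite cf_sum (bigD1_seq a) ?Phi_uniq //= big1_seq => [|b /andP [ba bP]].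
  by rewrite addr0 cfZ cf_X // eqxx mulr1 mulrC.
by rewrite cfZ cf_X // eq_sym (negbTE ba) mulr0.
Qed.

Lemma cf_eigen a x v t : a \in Phi -> br (T x) v = t *: v -> cf a v != 0 -> t = (pr a x)%:C.
Proof.
by move=> aP /(congr1 (cf a)); rewrite cf_ad // cfZ => H c0; apply: (mulIf c0); rewrite H.
Qed.

Lemma cf_all0 v : (forall a, a \in Phi -> cf a v = 0) -> exists y z, v = T y + 'i *: T z.
Proof.
move=> H; have [y [z Ev]] := cf_decomp D v; exists y, z.
by rewrite {1}Ev big1_seq ?addr0 // => a aP; rewrite H // scale0r.
Qed.

Lemma eigen_eq0 x v t : br (T x) v = t *: v -> t != 0 ->
  (forall a, a \in Phi -> t != (pr a x)%:C) -> v = 0.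
Proof.
move=> Ev t0 H; have [a aP|y [z Ev2]] := @cf_all0 v.
  by apply/eqP; apply: contraNT (H a aP) => c0; rewrite (cf_eigen aP Ev).
move: Ev; rewrite {1}Ev2 (brDr Hlie) (brZr Hlie) !brTT scaler0 addr0 => /esym/eqP.
by rewrite scaler_eq0 (negbTE t0) => /eqP.
Qed.

Definition wt (mu : E) v := forall x, br (T x) v = (pr mu x)%:C *: v.

Lemma wt_X a : a \in Phi -> wt a (X a).
Proof. by move=> aP x; apply: brTX. Qed.
Lemma wt_br a b u v : wt a u -> wt b v -> wt (a + b) (br u v).
Proof.
move=> wu wv x; rewrite (br_der Hlie) wu wv (brZl Hlie) (brZr Hlie) -scalerDl.
by rewrite prDl rmorphD.
Qed.
Lemma wtZ a z v : wt a v -> wt a (z *: v).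
Proof. by move=> wv x; rewrite (brZr Hlie) wv !scalerA mulrC. Qed.
Lemma wt_adn n a b u v : wt a u -> wt b v -> wt (b + a *+ n) (adn br n u v).
Proof.
move=> wu wv; elim: n => [|n IH] /=; first by rewrite addr0.
by rewrite mulrS addrCA; apply: wt_br.
Qed.

Lemma wt_cf0 a mu v : a \in Phi -> wt mu v -> a != mu -> cf a v = 0.
Proof.
move=> aP wv am; apply/eqP; apply: contraNT am => c0; apply/eqP/pr_eq => x.
by apply: rC_inj; rewrite -(cf_eigen aP (wv x) c0).
Qed.

Lemma wt_notin mu v : mu != 0 -> mu \notin Phi -> wt mu v -> v = 0.
Proof.
move=> mu0 muP wv; have [a aP|y [z Ev]] := @cf_all0 v.
  by apply: wt_cf0 wv _ => //; apply: contraNneq muP => <-.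
have := wv mu; rewrite {1}Ev (brDr Hlie) (brZr Hlie) !brTT scaler0 addr0 => /esym/eqP.
by rewrite scaler_eq0 rC_eq0 (gt_eqF (pr_gt0 mu0)) => /eqP.
Qed.

Lemma wt_root a v : a \in Phi -> wt a v -> v = cf a v *: X a.
Proof.
move=> aP wv; apply/eqP; rewrite -subr_eq0; apply/eqP; set u := v - _.
have wu : wt a u.
  by move=> x; rewrite (brDr Hlie) (brNr Hlie) (brZr Hlie) wv brTX // scalerBr !scalerA mulrC.
have [b bP|y [z Eu]] := @cf_all0 u.
  have [->|ba] := eqVneq b a; last exact: wt_cf0 wu ba.
  by rewrite cfD cfN cfZ cf_X // eqxx mulr1 subrr.
have := wu a; rewrite {1}Eu (brDr Hlie) (brZr Hlie) !brTT scaler0 addr0 => /esym/eqP.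
by rewrite scaler_eq0 rC_eq0 (gt_eqF (pr_gt0 (Phi_neq0 aP))) => /eqP.
Qed.

Lemma wt_neq0 mu v : wt mu v -> v != 0 -> mu != 0 -> mu \in Phi.
Proof. by move=> wv v0 mu0; apply: contraNT v0 => /(wt_notin mu0) /(_ wv) ->. Qed.

Lemma brXX0 a b : a \in Phi -> b \in Phi -> a + b != 0 -> a + b \notin Phi -> br (X a) (X b) = 0.
Proof. by move=> aP bP n0 nP; apply: (wt_notin n0 nP); apply: wt_br; apply: wt_X. Qed.

Lemma brXX a b : a \in Phi -> b \in Phi -> a + b \in Phi ->
  exists r : R, br (X a) (X b) = r%:C *: X (a + b).
Proof.
move=> aP bP abP; have [r Er] := cf_real aP bP abP; exists r; rewrite -Er.
by apply: wt_root => //; apply: wt_br; apply: wt_X.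
Qed.

Lemma CoN a : a \in Phi -> Co (- a) = - Co a.
Proof.
move=> aP; apply: T_inj; rewrite TN; apply: oppr_inj.
by rewrite -(brXN (PhiN aP)) opprK (brC Hlie) brXN.
Qed.

(** Each application of [e] raises the eigenvalue of T x by 2. All eigenvalues lie in [-M, M], so K
    > M applications leave the spectrum. Sums of root vectors are covered as well, in particular the
    principal nilpotent [e]. *)
Lemma ad_nilp x e : br (T x) e = 2%:R *: e -> exists K, forall v, adn br K e v = 0.
Proof.
move=> Te; pose M := \sum_(a <- Phi) `|pr a x|.
have M0 : 0 <= M by apply: sumr_ge0.
have MP a : a \in Phi -> `|pr a x| <= M.
  move=> aP; rewrite /M (bigD1_seq a) ?Phi_uniq //= lerDl; exact: sumr_ge0.
pose K := Num.bound M; have KM : M < K%:R by apply: archi_boundP.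
have Hw n v (r : R) : br (T x) v = r%:C *: v ->
    br (T x) (adn br n e v) = (r + 2%:R * n%:R)%:C *: adn br n e v.
  move=> Ev; elim: n => [|n IH] /=; first by rewrite mulr0 addr0.
  rewrite (br_der Hlie) Te IH (brZl Hlie) (brZr Hlie) -scalerDl; congr (_ *: _).
  by rewrite -(rmorph_nat (real_complex R)) -rmorphD /=; congr (_%:C); rewrite -[n.+1]add1n natrD; ring.
have Hz v (r : R) : br (T x) v = r%:C *: v -> `|r| <= M -> adn br K e v = 0.
  move=> Ev; rewrite ler_norml => /andP [r1 r2].
  apply: (eigen_eq0 (Hw K v r Ev)); first by rewrite rC_eq0; apply: lt0r_neq0; lra.
  move=> a aP; apply/negP => /eqP /rC_inj E0; have := MP a aP; rewrite ler_norml => /andP [r3 r4].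
  by move: r4; rewrite -E0; lra.
exists K => v; have [y [z ->]] := cf_decomp D v.
rewrite !(adnDr Hlie) (adnZ Hlie) (adn_sum Hlie).
have HT w : adn br K e (T w) = 0.
  by apply: (Hz _ 0); rewrite ?normr0 // brTT scale0r.
rewrite !HT scaler0 !add0r big1_seq // => a aP; rewrite (adnZ Hlie) (Hz _ (pr a x)) ?scaler0 //.
  exact: brTX.
exact: MP.
Qed.

Lemma sl2_ef a : a \in Phi -> br (X a) (- X (- a)) = T (Co a).
Proof. by move=> aP; rewrite (brNr Hlie) brXN // opprK. Qed.
Lemma sl2_ke a : a \in Phi -> br (T (Co a)) (X a) = 2%:R *: X a.
Proof. by move=> aP; rewrite brTX // prCo2 // rmorph_nat. Qed.

Lemma X_nilp a : a \in Phi -> exists K, forall v, adn br K (X a) v = 0.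
Proof. by move=> aP; apply: (@ad_nilp (Co a)); apply: sl2_ke. Qed.

(** Otherwise [X g] is a lowest weight vector for the sl2 of [a], and lowest weights are
    nonpositive. *)
Lemma root_sub a g : a \in Phi -> g \in Phi -> 0 < pr g (Co a) -> g != a -> g - a \in Phi.
Proof.
move=> aP gP gt ga; apply/negPn/negP => nP.
have [K HK] := X_nilp aP.
have Ek : br (T (Co a)) (X g) = - (- (pr g (Co a))%:C) *: X g by rewrite opprK brTX.
have [|m [Em _ _]] := sl2_lowest Hlie (sl2_ef aP) (sl2_ke aP) (X_neq0 gP) (HK _) _ Ek.
  by rewrite (brNl Hlie) brXX0 ?oppr0 ?PhiN // addrC // subr_eq0.
move: Em; rewrite -rmorphN -(rmorph_nat (real_complex R)) => /rC_inj Em.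
by move: gt; rewrite -oppr_lt0 Em ltrn0.
Qed.

(* v0 spans the top of the a-string through g, and g lies j steps below it. *)
Lemma string_top a g : a \in Phi -> g \in Phi -> 0 <= pr g (Co a) ->
  exists j m v0, [/\ pr g (Co a) = m%:R - (2 * j)%:R, (2 * j <= m)%N,
    forall n, (n <= m)%N -> adn br n (X (- a)) v0 != 0 &
    (exists2 z, z != 0 & adn br j (X (- a)) v0 = z *: X g) /\
    forall n, (n < m)%N -> br (X a) (adn br n.+1 (X (- a)) v0) != 0].
Proof.
move=> aP gP ge0; have [K HK] := X_nilp aP; have naP := PhiN aP.
have ex : exists n, adn br n (X a) (X g) == 0 by exists K; rewrite HK.
case: (ex_minnP ex) => -[/eqP /= /eqP|j /eqP Ej Hj]; first by rewrite (negbTE (X_neq0 gP)).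
have v0n : adn br j (X a) (X g) != 0 by apply/negP => /Hj; rewrite ltnn.
set v0 := adn br j (X a) (X g) in v0n Ej.
have wv0 : wt (g + a *+ j) v0 by apply: wt_adn; apply: wt_X.
have [K' HK'] := X_nilp naP.
(* The top of the string is a lowest weight vector for the opposite triple, with X (- a) raising and
   - X a lowering. *)
have Ek : br (T (Co (- a))) v0 = - (pr g (Co a) + (2 * j)%:R)%:C *: v0.
  rewrite CoN // wv0 prNr prDl prMnl prCo2 // rmorphN /= natrM mulr_natr; congr (- _ *: _).
have f0 : br (- X (- - a)) v0 = 0 by rewrite opprK (brNl Hlie) -adnS Ej oppr0.
have [m [Em nz _]] := sl2_lowest Hlie (sl2_ef naP) (sl2_ke naP) v0n (HK' _) f0 Ek.
have Em' : pr g (Co a) + (2 * j)%:R = m%:R.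
  by apply: rC_inj; rewrite Em rmorph_nat.
have jm : (2 * j <= m)%N by rewrite -(ler_nat R) -Em' lerDr.
exists j, m, v0; split=> //; first by rewrite -Em' addrK.
have wj : wt g (adn br j (X (- a)) v0).
  have := wt_adn j (wt_X naP) wv0; by rewrite mulNrn addrK.
have nj : adn br j (X (- a)) v0 != 0 by apply: nz; lia.
split.
  exists (cf g (adn br j (X (- a)) v0)); last exact: wt_root.
  by apply: contraNneq nj => E0; rewrite (wt_root gP wj) E0 scale0r.
move=> n nm; have := sl2_lower Hlie (sl2_ef naP) (sl2_ke naP) n f0 Ek.
rewrite opprK (brNl Hlie) Em => H; rewrite -oppr_eq0 H scaler_eq0 negb_or nz; last exact: ltnW.
by rewrite andbT mulf_neq0 ?pnatr_eq0 // subr_eq0 eqr_nat; lia.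
Qed.

(** With [g] lying [j] steps below the top of a string of length [m], its reflection lies m - 2j
    steps further down, where the string vector is still nonzero. A negative pairing is treated by
    passing to [- a]. *)
Lemma root_refl a g : a \in Phi -> g \in Phi -> g - pr g (Co a) *: a \in Phi.
Proof.
wlog ge0 : a / 0 <= pr g (Co a) => [H aP gP|].
  have [ge0|lt0] := lerP 0 (pr g (Co a)); first exact: H.
  have := H (- a); rewrite CoN // prNr oppr_ge0 scalerN scaleNr opprK PhiN //.
  by apply=> //; apply: ltW.
move=> aP gP; have [j [m [v0 [Eg jm nz [[z z0 Ez] _]]]]] := string_top aP gP ge0.
have Ep : pr g (Co a) = (m - 2 * j)%:R by rewrite natrB.
apply: (@wt_neq0 _ (adn br (m - 2 * j) (X (- a)) (X g))).
- have -> : g - pr g (Co a) *: a = g + (- a) *+ (m - 2 * j) by rewrite Ep scaler_nat mulNrn.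
  by apply: wt_adn; apply: wt_X => //; apply: PhiN.
- have : adn br (m - 2 * j + j) (X (- a)) v0 != 0 by apply: nz; lia.
  by rewrite adnD Ez (adnZ Hlie) scaler_eq0 negb_or => /andP [].
- apply/negP; rewrite subr_eq0 => /eqP Eg2.
  have : pr g (Co a) = pr g (Co a) * 2%:R by rewrite {1}Eg2 prZl prCo2.
  move=> H; have g0 : pr g (Co a) = 0 by lra.
  by move: (Phi_neq0 gP); rewrite Eg2 g0 scale0r eqxx.
Qed.

(** If the bracket vanished, [X b] would be killed by [X a], so [b] would pair nonnegatively with
    the coroot of [a], and [a + b] to at least 2. Then [a + b] is not at the bottom of its string,
    so going down one step and up again is nonzero; but the step down lands on a multiple of
    [X b]. *)
Lemma brXX_neq0 a b : a \in Phi -> b \in Phi -> a + b \in Phi -> br (X a) (X b) != 0.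
Proof.
move=> aP bP abP; apply/negP => /eqP E0; have naP := PhiN aP.
have gt0 : 2%:R <= pr (a + b) (Co a).
  have [K HK] := X_nilp naP.
  have Ek : br (T (Co (- a))) (X b) = - (pr b (Co a))%:C *: X b by rewrite CoN // brTX // prNr rmorphN.
  have f0 : br (- X (- - a)) (X b) = 0 by rewrite opprK (brNl Hlie) E0 oppr0.
  have [m [Em _ _]] := sl2_lowest Hlie (sl2_ef naP) (sl2_ke naP) (X_neq0 bP) (HK _) f0 Ek.
  move: Em; rewrite -(rmorph_nat (real_complex R)) => /rC_inj Em.
  by rewrite prDl prCo2 // Em lerDl.
have ge0 : 0 <= pr (a + b) (Co a) by apply: le_trans gt0.
have [j [m [v0 [Eg jm nz [[z z0 Ez] up]]]]] := string_top aP abP ge0.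
have jm' : (j < m)%N.
  have : (2 * j < m)%N; last by lia.
  by rewrite -(ltr_nat R); lra.
have wb : wt b (br (X (- a)) (X (a + b))).
  by have := wt_br (wt_X naP) (wt_X abP); rewrite addKr.
have := up j jm'; rewrite adnS Ez (brZr Hlie) (wt_root bP wb) !(brZr Hlie) E0 !scaler0.
by rewrite eqxx.
Qed.

End Roots.

(** * Positive systems *)

Section Form.
Variables (R : realType) (V : vectType R[i]) (br : V -> V -> V).
Hypothesis Hlie : lie_bracket br.
Variable D : chevdata br.
Local Notation E := 'rV[R]_(cd_d D).
Local Notation Phi := (cd_Phi D).
Local Notation T := (@cd_T _ _ _ D).
Local Notation Co := (@cd_Co _ _ _ D).

Lemma perm_map_Phi (f : E -> E) : {in Phi, forall g, f g \in Phi} ->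
  {in Phi &, injective f} -> perm_eq [seq f g | g <- Phi] Phi.
Proof.
move=> fP fi; have uf : uniq [seq f g | g <- Phi] by rewrite map_inj_in_uniq ?Phi_uniq.
have sf : {subset [seq f g | g <- Phi] <= Phi} by move=> _ /mapP [g gP ->]; apply: fP.
apply: uniq_perm => //; first exact: Phi_uniq.
by have [] := uniq_min_size uf sf; rewrite ?size_map.
Qed.

(* The Killing form on h_R; [tv a] is the vector dual to the root a. *)
Definition B (x y : E) : R := \sum_(g <- Phi) pr g x * pr g y.

Lemma BC x y : B x y = B y x.
Proof. by apply: eq_bigr => g _; rewrite mulrC. Qed.
Lemma BDr x y z : B x (y + z) = B x y + B x z.
Proof. by rewrite /B -big_split; apply: eq_bigr => g _; rewrite prDr mulrDr. Qed.
Lemma BZr r x y : B x (r *: y) = r * B x y.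
Proof. by rewrite /B big_distrr; apply: eq_bigr => g _; rewrite prZr mulrCA. Qed.
Lemma BDl x y z : B (y + z) x = B y x + B z x.
Proof. by rewrite BC BDr !(BC x). Qed.
Lemma BZl r x y : B (r *: y) x = r * B y x.
Proof. by rewrite BC BZr (BC x). Qed.
Lemma B0r x : B x 0 = 0.
Proof. by rewrite -(scale0r 0) BZr mul0r. Qed.
Lemma BNr x y : B x (- y) = - B x y.
Proof. by rewrite -scaleN1r BZr mulN1r. Qed.
Lemma B_sumr I r (P : pred I) (F : I -> E) x :
  B x (\sum_(i <- r | P i) F i) = \sum_(i <- r | P i) B x (F i).
Proof. by apply: (big_morph (B x) (BDr x) (B0r x)). Qed.
Lemma B_suml I r (P : pred I) (F : I -> E) x :
  B (\sum_(i <- r | P i) F i) x = \sum_(i <- r | P i) B (F i) x.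
Proof. by rewrite BC B_sumr; apply: eq_bigr => i _; rewrite BC. Qed.

Lemma B_ge0 x : 0 <= B x x.
Proof. by apply: sumr_ge0 => g _; rewrite -expr2 sqr_ge0. Qed.
Lemma B_eq0 x : B x x = 0 -> x = 0.
Proof.
rewrite /B big_seq => H; apply: Phi_nondeg => a aP.
have /eqP := H; rewrite psumr_eq0 => [|i _]; last by rewrite -expr2 sqr_ge0.
by move/allP => /(_ a aP); rewrite aP /= mulf_eq0 orbb => /eqP.
Qed.

(** Half of B (Co a) (Co a), that is 2 / (a, a) for the form dual to [B]. *)
Definition qf (a : E) : R := (\sum_(g <- Phi) pr g (Co a) ^+ 2) / 2%:R.

Lemma qf_gt0 a : a \in Phi -> 0 < qf a.
Proof.
move=> aP; rewrite divr_gt0 ?ltr0n // (bigD1_seq a) ?Phi_uniq //= prCo2 //.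
by rewrite ltr_wpDr ?exprn_gt0 ?ltr0n // sumr_ge0 // => g _; rewrite sqr_ge0.
Qed.

(** Reindex the sum defining [B] by the reflection in [a], which permutes the roots and changes the
    sign of their value at [Co a]. *)
Lemma B_Co a x : a \in Phi -> B x (Co a) = pr a x * qf a.
Proof.
move=> aP; pose r g := g - pr g (Co a) *: a.
have prr g : pr (r g) (Co a) = - pr g (Co a).
  by rewrite /r prDl prNl prZl prCo2 //; ring.
have rr g : r (r g) = g by rewrite {1}/r prr scaleNr opprK /r subrK.
have rP : perm_eq [seq r g | g <- Phi] Phi.
  apply: perm_map_Phi => [g gP|g1 g2 _ _ E0]; first exact: (root_refl Hlie).
  by rewrite -(rr g1) E0 rr.
have E1 : B x (Co a) = - B x (Co a) + pr a x * (\sum_(g <- Phi) pr g (Co a) ^+ 2).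
  rewrite {1}/B -(perm_big _ rP) /= big_map big_distrr /B -sumrN -big_split /=.
  by apply: eq_bigr => g _; rewrite prr /r prDl prNl prZl; ring.
by rewrite /qf mulrA; lra.
Qed.

Definition tv (a : E) : E := (qf a)^-1 *: Co a.

Lemma B_tv a x : a \in Phi -> B x (tv a) = pr a x.
Proof. by move=> aP; rewrite BZr B_Co // mulrCA mulVf ?mulr1 // gt_eqF ?qf_gt0. Qed.

Lemma Co_tv a : a \in Phi -> Co a = qf a *: tv a.
Proof. by move=> aP; rewrite scalerA divff ?scale1r // gt_eqF ?qf_gt0. Qed.

Lemma B_inj y z : (forall x, B x y = B x z) -> y = z.
Proof.
move=> H; apply/eqP; rewrite -subr_eq0; apply/eqP/B_eq0.
by rewrite BDr BNr H subrr.
Qed.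

(** [S] permutes the roots, so its transpose preserves [B]; since [B] determines a coroot up to a
    factor by [B_Co], the two sides are proportional, and the value 2 of a root at its coroot fixes
    the factor. *)
Lemma CoS (S : 'M[R]_(cd_d D)) a : S *m S = 1%:M -> {in Phi, forall g, g *m S \in Phi} ->
  a \in Phi -> Co (a *m S) = Co a *m S^T.
Proof.
move=> SS SP aP; have aSP := SP a aP.
have SK (g : E) := mulmx_involK g SS.
have pP : perm_eq [seq g *m S | g <- Phi] Phi.
  by apply: perm_map_Phi => // g1 g2 _ _ /(congr1 (mulmx^~ S)); rewrite !SK.
have BS x y : B x (y *m S^T) = B (x *m S^T) y.
  rewrite {1}/B -(perm_big _ pP) /= big_map; apply: eq_bigr => g _.
  by rewrite -!pr_mx SK.
have E1 : Co a *m S^T = (qf a / qf (a *m S)) *: Co (a *m S).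
  apply: B_inj => x; rewrite BS B_Co // BZr B_Co // -pr_mx [RHS]mulrCA divfK //.
  by rewrite gt_eqF ?qf_gt0.
have := prCo2 aP; rewrite -{1}(SK a) pr_mx E1 prZr prCo2 // => H.
have q1 : qf a / qf (a *m S) = 1 by lra.
by rewrite q1 scale1r.
Qed.

End Form.

Section Positive.
Variables (R : realType) (V : vectType R[i]) (br : V -> V -> V).
Hypothesis Hlie : lie_bracket br.
Variable D : chevdata br.
Local Notation E := 'rV[R]_(cd_d D).
Local Notation Phi := (cd_Phi D).
Local Notation T := (@cd_T _ _ _ D).
Local Notation X := (@cd_X _ _ _ D).
Local Notation Co := (@cd_Co _ _ _ D).
Local Notation tau := (@cd_tau _ _ _ D).
Variable xs : E.
Hypothesis xs_reg : forall a, a \in Phi -> pr a xs != 0.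
Local Notation B := (@B _ _ _ D).
Local Notation tv := (@tv _ _ _ D).

Definition pos (a : E) := 0 < pr a xs.

Definition Delta := [seq a <- Phi | pos a &&
  ~~ has (fun b => [&& pos b, pos (a - b) & a - b \in Phi]) Phi].

Lemma posN a : a \in Phi -> ~~ pos a -> pos (- a).
Proof. by move=> aP; rewrite /pos prNl oppr_gt0 -leNgt le_eqVlt (negbTE (xs_reg aP)). Qed.
Lemma pos_negF a : pos a -> pos (- a) = false.
Proof. by rewrite /pos prNl oppr_gt0 => /ltW; rewrite leNgt => /negbTE. Qed.

Lemma Delta_Phi a : a \in Delta -> a \in Phi.
Proof. by rewrite mem_filter => /andP []. Qed.
Lemma Delta_pos a : a \in Delta -> pos a.
Proof. by rewrite mem_filter => /andP [/andP []]. Qed.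
Lemma Delta_uniq : uniq Delta.
Proof. by rewrite filter_uniq // Phi_uniq. Qed.
Lemma Delta_indec a b : a \in Delta -> b \in Phi -> pos b -> a - b \in Phi -> pos (a - b) = false.
Proof.
rewrite mem_filter => /andP [/andP [_ /hasPn H] _] bP pb abP.
by have := H b bP; rewrite pb abP andbT /= => /negbTE.
Qed.
Lemma Delta_subN a b : a \in Delta -> b \in Delta -> a - b \notin Phi.
Proof.
move=> aD bD; apply/negP => abP.
have nab := Delta_indec aD (Delta_Phi bD) (Delta_pos bD) abP.
have := posN abP; rewrite nab => /(_ isT); rewrite opprB => pba.
have := Delta_indec bD (Delta_Phi aD) (Delta_pos aD); rewrite pba -opprB PhiNE => /(_ abP).
by [].
Qed.
Lemma Delta_obtuse a b : a \in Delta -> b \in Delta -> a != b -> pr a (Co b) <= 0.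
Proof.
move=> aD bD ab; rewrite leNgt; apply/negP => H.
by have := root_sub Hlie (Delta_Phi bD) (Delta_Phi aD) H ab; apply/negP; apply: Delta_subN.
Qed.

(** A natural number ordering the roots as their real values at [xs] do. It supports the induction
    on roots and bounds the derived length of the Borel subalgebra. *)
Definition rk (g : E) := count (fun k => pr k xs < pr g xs) Phi.

Lemma rk_lt a b : a \in Phi -> pr a xs < pr b xs -> (rk a < rk b)%N.
Proof.
move=> aP ab; rewrite /rk; set p1 := (X in (count X _ < _)%N); set p2 := (X in (_ < count X _)%N).
have E0 : count p2 Phi = (count p1 Phi + count (predD p2 p1) Phi)%N.
  rewrite -count_predUI [X in _ = (_ + X)%N](_ : _ = 0%N) ?addn0.
    by apply: eq_count => x /=; case: (boolP (p1 x)) => //= p1x; rewrite /p2 (lt_trans p1x).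
  by rewrite (eq_count (a2 := pred0)) ?count_pred0 // => x /=; case: (p1 x); rewrite ?andbF.
rewrite E0 -[X in (X < _)%N]addn0 ltn_add2l -has_count; apply/hasP; exists a => //=.
by rewrite /p1 /p2 ltxx ab.
Qed.

Lemma height_ind (P : E -> Prop) :
  (forall g, g \in Phi -> pos g ->
     (forall k, k \in Phi -> pos k -> pr k xs < pr g xs -> P k) -> P g) ->
  forall g, g \in Phi -> pos g -> P g.
Proof.
move=> H; suff Hn n g : (rk g < n)%N -> g \in Phi -> pos g -> P g by move=> g; apply: (Hn (rk g).+1).
elim: n g => // n IH g mg gP pg; apply: H => // k kP pk kg; apply: IH => //.
by apply: leq_trans (rk_lt kP kg) _.
Qed.

Lemma pos_comb g : g \in Phi -> pos g ->
  exists n : E -> nat, g = \sum_(a <- Delta) a *+ n a.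
Proof.
move: g; apply: height_ind => g gP pg IH.
have [gD|] := boolP (g \in Delta).
  exists (fun a => (a == g) : nat); rewrite (bigD1_seq g) ?Delta_uniq //= eqxx big1 ?addr0 //.
  by move=> a /negbTE ->.
rewrite mem_filter gP pg /= andbT negbK => /hasP [b bP /and3P [pb pgb gbP]].
have [|n1 E1] := IH b bP pb.
  by move: pgb; rewrite /pos prDl prNl subr_gt0.
have [|n2 E2] := IH (g - b) gbP pgb.
  by rewrite prDl prNl gtrBl.
exists (fun a => n1 a + n2 a)%N; rewrite -[LHS](subrK b) addrC E2 {1}E1 -big_split.
by apply: eq_bigr => a _; rewrite mulrnDr.
Qed.

Lemma tv_obtuse a b : a \in Delta -> b \in Delta -> a != b -> B (tv a) (tv b) <= 0.
Proof.
move=> aD bD ab; rewrite BC B_tv ?Delta_Phi // prZr.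
by rewrite pmulr_rle0 ?invr_gt0 ?qf_gt0 ?Delta_Phi //; apply: Delta_obtuse; rewrite // eq_sym.
Qed.

(** Write v = p - n, with [p] and [n] nonnegative combinations of disjoint sets of simple vectors.
    Obtuse angles give B p n <= 0, so the hypothesis forces B n n <= 0 and n = 0; evaluating at
    [xs], where simple roots are positive, shows that no coefficient is negative. Linear
    independence of the simple roots and positivity of the principal coroot both rest on it. *)
Lemma obtuse_ge0 (w : E -> R) (v := \sum_(a <- Delta) w a *: tv a) :
  0 <= B v (\sum_(a <- Delta | w a < 0) (- w a) *: tv a) ->
  forall a, a \in Delta -> 0 <= w a.
Proof.
set n := (X in B v X) => H.
have Ev : v = \sum_(a <- Delta | 0 <= w a) w a *: tv a - n.
  rewrite /v (bigID (fun a => 0 <= w a)) /=; congr (_ + _).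
  rewrite /n -sumrN; apply: eq_big => [a|a _]; first by rewrite -ltNge.
  by rewrite scaleNr opprK.
have n0 : n = 0.
  apply: B_eq0; apply/eqP; rewrite eq_le B_ge0 andbT.
  have : B (\sum_(a <- Delta | 0 <= w a) w a *: tv a) n <= 0.
    rewrite B_suml big_seq_cond; apply: sumr_le0 => a /andP [aD wa].
    rewrite BZl mulr_ge0_le0 // B_sumr big_seq_cond; apply: sumr_le0 => b /andP [bD wb].
    rewrite BZr mulr_ge0_le0 //; first by rewrite oppr_ge0 ltW.
    by apply: tv_obtuse => //; apply: contraTneq wb => <-; rewrite -leNgt.
  by move: H; rewrite {1}Ev BDl -(scaleN1r n) BZl mulN1r subr_ge0; apply: le_trans.
move=> a aD; rewrite leNgt; apply/negP => wa.
have := congr1 (B xs) n0; rewrite B0r B_sumr => /eqP.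
rewrite big_seq_cond psumr_eq0 => [|b /andP [bD wb]].
  move/allP => /(_ a aD); rewrite aD wa /= BZr B_tv ?Delta_Phi // mulf_eq0 oppr_eq0.
  by rewrite (lt_eqF wa) (gt_eqF (Delta_pos aD)).
by rewrite BZr B_tv ?Delta_Phi //; apply: mulr_ge0; rewrite ?oppr_ge0; apply: ltW; last exact: Delta_pos.
Qed.

Lemma Delta_free (w : E -> R) : \sum_(a <- Delta) w a *: a = 0 ->
  forall a, a \in Delta -> w a = 0.
Proof.
have main (u : E -> R) : \sum_(a <- Delta) u a *: a = 0 -> forall a, a \in Delta -> 0 <= u a.
  move=> H; apply: obtuse_ge0.
  have -> : \sum_(a <- Delta) u a *: tv a = 0.
    apply: B_inj => x; rewrite B0r B_sumr.
    rewrite (eq_big_seq (fun a => pr (u a *: a) x)).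
      by rewrite -pr_suml H pr0l.
    by move=> a aD; rewrite BZr B_tv ?Delta_Phi // prZl.
  by rewrite BC B0r.
move=> H a aD; apply/eqP; rewrite eq_le main // andbT -oppr_ge0.
by apply: (main (fun a => - w a)) => //; under eq_bigr do rewrite scaleNr; rewrite sumrN H oppr0.
Qed.

(** The matrix whose rows are the simple roots is row free; the columns of a right inverse are the
    fundamental coweights. Off [Delta] the value is 0. *)
Lemma coweights : exists om : E -> E, forall a b, a \in Delta -> b \in Delta ->
  pr a (om b) = (a == b)%:R.
Proof.
pose N := size Delta; pose A : 'M[R]_(N, cd_d D) := \matrix_(i < N) nth 0 Delta i.
have Afree : row_free A.
  apply: inj_row_free => v v0.
  pose w a := \sum_(i < N | nth 0 Delta i == a) v 0 i.
  have iD (i : 'I_N) : nth 0 Delta i \in Delta by apply: mem_nth.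
  have wE (i : 'I_N) : w (nth 0 Delta i) = v 0 i.
    rewrite /w (big_pred1 i) // => j /=; rewrite nth_uniq ?Delta_uniq //.
  have w0 : \sum_(a <- Delta) w a *: a = 0.
    rewrite (big_nth 0) big_mkord -[RHS]v0 mulmx_sum_row; apply: eq_bigr => i _.
    by rewrite wE rowK.
  by apply/rowP => i; rewrite mxE -wE (Delta_free w0).
have /row_freeP [M AM] := Afree.
exists (fun b => if insub (index b Delta) is Some i then \row_j M j i else 0).
move=> a b aD bD; have ia : (index a Delta < N)%N by rewrite index_mem.
have ib : (index b Delta < N)%N by rewrite index_mem.
rewrite (insubT (fun k => (k < N)%N) ib) /=.
have := congr1 (fun Q : 'M_N => Q (Ordinal ia) (Ordinal ib)) AM; rewrite !mxE.
have -> : (Ordinal ia == Ordinal ib) = (a == b).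
  apply/eqP/eqP => [[Eab]|Eab]; last by apply: val_inj; rewrite /= Eab.
  by rewrite -(nth_index 0 aD) Eab nth_index.
move=> <-.
rewrite /pr mxE; apply: eq_bigr => j _; rewrite !mxE /= nth_index //.
Qed.

(** Some simple root pairs positively with [g]: otherwise [g], a nonnegative combination of simple
    roots, would have (g, g) <= 0. *)
Lemma pos_split g : g \in Phi -> pos g -> g \notin Delta ->
  exists2 a, a \in Delta & g - a \in Phi /\ pos (g - a).
Proof.
move=> gP pg gD; have [n En] := pos_comb gP pg.
have [a aD ga] : exists2 a, a \in Delta & 0 < pr g (Co a).
  apply: contrapT => H; have Hle a : a \in Delta -> pr g (tv a) <= 0.
    move=> aD; rewrite prZr pmulr_rle0 ?invr_gt0 ?qf_gt0 ?Delta_Phi //.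
    by rewrite leNgt; apply/negP => ?; apply: H; exists a.
  have : 0 < pr g (tv g) by rewrite prZr prCo2 // mulr_gt0 ?invr_gt0 ?qf_gt0 // ltr0n.
  rewrite {1}En pr_suml ltNge => /negP; apply; rewrite big_seq; apply: sumr_le0 => a aD.
  rewrite prMnl mulrn_wle0 // -(B_tv Hlie _ (Delta_Phi aD)) BC B_tv //; exact: Hle.
exists a => //; have gaP : g - a \in Phi.
  by apply: (root_sub Hlie (Delta_Phi aD) gP ga); apply: contraNneq gD => ->.
split=> //; apply/negPn/negP => /(posN gaP); rewrite opprB => pag.
have := Delta_indec aD gP pg; rewrite pag -opprB PhiNE => /(_ gaP).
by [].
Qed.

Lemma pos_root_ind (P : E -> Prop) : (forall a, a \in Delta -> P a) ->
  (forall a g, a \in Delta -> g \in Phi -> pos g -> a + g \in Phi -> P g -> P (a + g)) ->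
  forall g, g \in Phi -> pos g -> P g.
Proof.
move=> H1 H2; apply: height_ind => g gP pg IH.
have [/H1 //|gD] := boolP (g \in Delta).
have [a aD [gaP pga]] := pos_split gP pg gD.
have -> : g = a + (g - a) by rewrite addrCA subrr addr0.
apply: H2 => //; first by rewrite addrCA subrr addr0.
apply: IH => //; rewrite prDl prNl gtrBl; exact: (Delta_pos aD).
Qed.

(** Apply the antilinear [tau] to the bracket; the structure constant is real and survives. The
    negative half of the algebra thus follows the positive one. *)
Lemma tau_XX a b r : a \in Phi -> b \in Phi -> a + b \in Phi ->
  br (X a) (X b) = r%:C *: X (a + b) -> br (X (- a)) (X (- b)) = r%:C *: X (- (a + b)).
Proof.
move=> aP bP abP /(congr1 tau); rewrite tau_br !tau_X // => ->.
by have := @tau_antilin _ _ _ D r%:C (X (a + b)) 0; rewrite addr0 tau_X // (_ : tau 0 = 0) ?addr0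
  ?(@conjc_real R) // -(T0 D) tau_T T0 oppr0.
Qed.

Lemma generation (P : V -> Prop) : lin_closed P ->
  (forall u v, P u -> P v -> P (br u v)) -> (forall x, P (T x)) ->
  (forall a, a \in Delta -> P (X a)) -> (forall a, a \in Delta -> P (X (- a))) ->
  forall v, P v.
Proof.
move=> LP PB PT PX PXN.
have Hpos g : g \in Phi -> pos g -> P (X g) /\ P (X (- g)).
  move: g; apply: (pos_root_ind (P := fun g => P (X g) /\ P (X (- g)))).
    by move=> a aD; split; auto.
  move=> a g aD gP pg agP [P1 P2].
  have aP := Delta_Phi aD; have [r Er] := brXX Hlie aP gP agP.
  have r0 : r%:C != 0.
    by apply: contraNneq (brXX_neq0 Hlie aP gP agP) => E0; rewrite Er E0 scale0r.
  split; apply: (lcZK LP r0); first by rewrite -Er; apply: PB => //; apply: PX.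
  by rewrite -(tau_XX aP gP agP Er); apply: PB => //; apply: PXN.
move=> v; have [x [y ->]] := cf_decomp D v.
apply: lcD => //; first by apply: lcD => //; apply: lcZ.
apply: lc_sum => // a aP; apply: lcZ => //.
have [/(Hpos a aP) [] //|na] := boolP (pos a).
by have := Hpos (- a) (PhiN aP) (posN aP na); rewrite opprK => -[].
Qed.

End Positive.

(** * Lifting root automorphisms *)

Section Isomorphism.
Variables (R : realType) (V : vectType R[i]) (br : V -> V -> V).
Hypothesis Hlie : lie_bracket br.
Variable D : chevdata br.
Local Notation E := 'rV[R]_(cd_d D).
Local Notation Phi := (cd_Phi D).
Local Notation T := (@cd_T _ _ _ D).
Local Notation X := (@cd_X _ _ _ D).
Local Notation Co := (@cd_Co _ _ _ D).
Local Notation cf := (@cd_cf _ _ _ D).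
Variable xs : E.
Hypothesis xs_reg : forall a, a \in Phi -> pr a xs != 0.
Local Notation Delta := (Delta xs).
Local Notation pos := (pos xs).
Variable S : 'M[R]_(cd_d D).
Hypothesis SS : S *m S = 1%:M.
Hypothesis SP : {in Phi, forall g, g *m S \in Phi}.
Variable c : E -> R.
Hypothesis c2 : forall a, a \in Delta -> c a * c a = 1.

(** A subspace stable under the Cartan subalgebra contains the weight components of its elements, by
    a separating element. It serves for ideals and for subalgebras containing a Borel subalgebra. *)
Lemma stable_root_vectors (P : V -> Prop) : lin_closed P ->
  (forall x y, P y -> P (br (T x) y)) -> forall v, P v ->
  forall a, a \in Phi -> cf a v != 0 -> P (X a).
Proof.
move=> [P0 PL] PT v Pv a aP ca.
have [x Hx] := separating (0 :: Phi); have [y [z Ev]] := cf_decomp D v.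
(* The index 0, which is not a root, stands for the component in the Cartan subalgebra. *)
pose F b := if b == 0 then T y + 'i *: T z else cf b v *: X b.
have Ev2 : v = \sum_(b <- 0 :: Phi) F b.
  rewrite big_cons {1}/F eqxx {1}Ev; congr (_ + _); apply: eq_big_seq => b bP.
  by rewrite /F (negbTE (Phi_neq0 bP)).
have := @eigensum_closed _ V (br (T x)) _ _ (0 :: Phi) F (fun b => (pr b x)%:C) P P0 PL (PT x).
rewrite -Ev2 => /(_ _ _ _ _ Pv a); rewrite inE aP orbT => H.
apply: (@lcZK _ _ P (cf a v) (X a)) => //; have := H _ _ _ _ isT.
rewrite /F (negbTE (Phi_neq0 aP)); apply.
- by move=> z1 u w; rewrite (brDr Hlie) (brZr Hlie).
- by rewrite /= Phi0 Phi_uniq.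
- by move=> b1 b2 b1P b2P /rC_inj; apply: Hx.
- move=> b; rewrite inE => /predU1P [->|bP].
    by rewrite eqxx (brDr Hlie) (brZr Hlie) !brTT pr0l scale0r scaler0 addr0.
  by rewrite (negbTE (Phi_neq0 bP)) (brZr Hlie) brTX // !scalerA mulrC.
Qed.

(* The graph of the lift of S, an antilinear subalgebra of V x V. *)
Inductive gr : V -> V -> Prop :=
| gr_T x : gr (T x) (T (x *m S^T))
| gr_e a : a \in Delta -> gr (X a) ((c a)%:C *: X (a *m S))
| gr_f a : a \in Delta -> gr (X (- a)) ((c a)%:C *: X (- (a *m S)))
| gr_lin z x x' y y' : gr x x' -> gr y y' -> gr (z *: x + y) (conjc z *: x' + y')
| gr_br x x' y y' : gr x x' -> gr y y' -> gr (br x y) (br x' y').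

Lemma gr0 : gr 0 0.
Proof. by have := gr_T 0; rewrite mul0mx T0. Qed.
Lemma grZ z x y : gr x y -> gr (z *: x) (conjc z *: y).
Proof. by move=> /(gr_lin z) /(_ gr0); rewrite !addr0. Qed.
Lemma grZr (r : R) x y : gr x y -> gr (r%:C *: x) (r%:C *: y).
Proof. by move=> /(grZ r%:C); rewrite conjc_real. Qed.

Lemma c_neq0 a : a \in Delta -> c a != 0.
Proof. by move=> /c2 ca; apply: contra_eq_neq ca => ->; rewrite mul0r eq_sym oner_eq0. Qed.

(** Brackets of root vectors with root sum are nonzero on both sides of the pair, so the scalar
    stays nonzero along the induction; this makes the second projection surjective in [gr_surj]. *)
Lemma gr_X g : g \in Phi -> exists2 r : R, r != 0 & gr (X g) (r%:C *: X (g *m S)).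
Proof.
suff H k : k \in Phi -> pos k -> (exists2 r : R, r != 0 & gr (X k) (r%:C *: X (k *m S))) /\
    exists2 r : R, r != 0 & gr (X (- k)) (r%:C *: X (- (k *m S))).
  move=> gP; have [/(H g gP) [] //|ng] := boolP (pos g).
  by have [_] := H _ (PhiN gP) (posN xs_reg gP ng); rewrite opprK mulNmx opprK.
move: k; apply: (pos_root_ind Hlie xs_reg (P := fun k =>
  (exists2 r : R, r != 0 & gr (X k) (r%:C *: X (k *m S))) /\
    exists2 r : R, r != 0 & gr (X (- k)) (r%:C *: X (- (k *m S))))).
  move=> a aD; have c0 := c_neq0 aD.
  by split; exists (c a) => //; [exact: gr_e | exact: gr_f].
move=> a k aD kP pk akP [[r1 r10 G1] [r2 r20 G2]].
have aP := Delta_Phi aD; have aSP := SP aP; have kSP := SP kP; have akSP := SP akP.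
have [n En] := brXX Hlie aP kP akP.
rewrite mulmxDl in akSP *; have [n' En'] := brXX Hlie aSP kSP akSP.
have n0 : n != 0.
  by apply: contraNneq (brXX_neq0 Hlie aP kP akP) => E0; rewrite En E0 scale0r.
have n'0 : n' != 0.
  by apply: contraNneq (brXX_neq0 Hlie aSP kSP akSP) => E0; rewrite En' E0 scale0r.
have c0 := c_neq0 aD.
split; [exists (n^-1 * c a * r1 * n') | exists (n^-1 * c a * r2 * n')];
  rewrite ?mulf_neq0 ?invr_eq0 //.
- have := grZr n^-1 (gr_br (gr_e aD) G1); rewrite En (brZl Hlie) (brZr Hlie) En' !scalerA.
  by rewrite -!rmorphM mulVf // rmorph1 scale1r !mulrA.
- have := grZr n^-1 (gr_br (gr_f aD) G2).
  rewrite (tau_XX aP kP akP En) (brZl Hlie) (brZr Hlie) (tau_XX aSP kSP akSP En') !scalerA.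
  by rewrite -!rmorphM mulVf // rmorph1 scale1r !mulrA.
Qed.

Lemma gr_total x : exists y, gr x y.
Proof.
have [p [q ->]] := cf_decomp D x.
have LP : lin_closed (fun x => exists y, gr x y).
  split; first by exists 0; apply: gr0.
  by move=> z u v [u' Hu] [v' Hv]; exists (conjc z *: u' + v'); apply: gr_lin.
have HT p' : exists y, gr (T p') y by exists (T (p' *m S^T)); apply: gr_T.
apply: (lcD LP); first by apply: (lcD LP) => //; apply: (lcZ _ LP).
apply: (lc_sum LP) => a aP; apply: (lcZ _ LP).
by have [r _ G] := gr_X aP; exists (r%:C *: X (a *m S)).
Qed.

Lemma gr_surj y : exists x, gr x y.
Proof.
have [p [q ->]] := cf_decomp D y.
have LP : lin_closed (fun y => exists x, gr x y).
  split; first by exists 0; apply: gr0.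
  move=> z u v [u' Hu] [v' Hv]; exists (conjc z *: u' + v').
  by have := gr_lin (conjc z) Hu Hv; rewrite conjcK.
have HT p' : exists x, gr x (T p').
  by exists (T (p' *m S^T)); rewrite -{2}(mulmx_trinvolK p' SS); apply: gr_T.
apply: (lcD LP); first by apply: (lcD LP) => //; apply: (lcZ _ LP).
apply: (lc_sum LP) => a aP; apply: (lcZ _ LP).
have [r r0 G] := gr_X (SP aP); exists (r^-1%:C *: X (a *m S)).
by have := grZr r^-1 G; rewrite (mulmx_involK _ SS) scalerA -rmorphM mulVf // scale1r.
Qed.

Lemma ker_lin : lin_closed (gr 0).
Proof.
split; first exact: gr0; move=> z x y Gx Gy.
by have := gr_lin (conjc z) Gx Gy; rewrite conjcK scaler0 addr0.
Qed.

Lemma ker_br z y : gr 0 y -> gr 0 (br z y).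
Proof.
by move=> Gy; have [w Gw] := gr_surj z; have := gr_br Gw Gy; rewrite (br0r Hlie).
Qed.

(* [hw] is the gr-submodule generated by the highest weight vector (X gam, X (gam S)). Its
   weight space of weight gam is a line, so it does not contain (0, X (gam S)). *)
Section HighestWeight.
Variable gam : E.
Hypothesis gamP : gam \in Phi.
Hypothesis gam1 : forall a, a \in Delta -> br (X a) (X gam) = 0.
Hypothesis gam2 : forall a, a \in Delta -> br (X (a *m S)) (X (gam *m S)) = 0.

Inductive wd : E -> V -> V -> Prop :=
| wd0 : wd gam (X gam) (X (gam *m S))
| wdS a mu x y : a \in Delta -> wd mu x y ->
    wd (mu - a) (br (X (- a)) x) (br ((c a)%:C *: X (- (a *m S))) y).

Inductive hw : V -> V -> Prop :=
| hw0 : hw 0 0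
| hwS z mu x y u v : wd mu x y -> hw u v -> hw (z *: x + u) (conjc z *: y + v).

Lemma wd_hw mu x y : wd mu x y -> hw x y.
Proof.
by move=> W; have := hwS 1 W hw0; rewrite (rmorph1 (@conjc R)) !scale1r !addr0.
Qed.

Lemma hw_lin z x x' y y' : hw x x' -> hw y y' -> hw (z *: x + y) (conjc z *: x' + y').
Proof.
move=> Hx Hy; elim: Hx => [|t mu u u' w w' W _ IH]; first by rewrite !scaler0 !add0r.
by have := hwS (z * t) W IH; rewrite (rmorphM (@conjc R)) !scalerDr -!addrA !scalerA.
Qed.
Lemma hwD x x' y y' : hw x x' -> hw y y' -> hw (x + y) (x' + y').
Proof. by move=> /(hw_lin 1) H /H; rewrite (rmorph1 (@conjc R)) !scale1r. Qed.
Lemma hwZr (r : R) x y : hw x y -> hw (r%:C *: x) (r%:C *: y).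
Proof. by move=> /(hw_lin r%:C) /(_ hw0); rewrite !addr0 conjc_real. Qed.

Lemma wd_wt mu x y : wd mu x y -> wt mu x /\ wt (mu *m S) y.
Proof.
elim=> [|a {}mu {}x {}y aD W [w1 w2]]; first by split; apply: wt_X => //; apply: SP.
have aP := Delta_Phi aD.
split; first by rewrite addrC; apply: (wt_br Hlie) => //; apply: wt_X; apply: PhiN.
rewrite mulmxBl addrC; apply: (wt_br Hlie) => //; apply: (wtZ Hlie); apply: wt_X.
by apply: PhiN; apply: SP.
Qed.

Definition pres u u' := forall x x', hw x x' -> hw (br u x) (br u' x').

Lemma pres_of_wd u u' : (forall mu x x', wd mu x x' -> hw (br u x) (br u' x')) -> pres u u'.
Proof.
move=> H x x'; elim=> [|z mu y y' v v' W _ IH]; first by rewrite !(br0r Hlie); apply: hw0.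
by rewrite !(brDr Hlie) !(brZr Hlie); apply: hw_lin => //; apply: H W.
Qed.

Lemma pres_T x : pres (T x) (T (x *m S^T)).
Proof.
apply: pres_of_wd => mu y y' W; have [w1 w2] := wd_wt W.
by rewrite w1 w2 pr_mx (mulmx_trinvolK _ SS); apply: hwZr; apply: wd_hw W.
Qed.
Lemma pres_f a : a \in Delta -> pres (X (- a)) ((c a)%:C *: X (- (a *m S))).
Proof. by move=> aD; apply: pres_of_wd => mu y y' W; apply: wd_hw (wdS aD W). Qed.
(** Move the raising pair past the lowering pairs of a word until it kills the highest weight pair.
    The commutators vanish for distinct simple roots; for equal ones c a * c a = 1 makes the result
    the pair of coroots on both sides. *)
Lemma pres_e a : a \in Delta -> pres (X a) ((c a)%:C *: X (a *m S)).
Proof.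
move=> aD; apply: pres_of_wd => mu x y; elim=> [|b {}mu {}x {}y bD W IH].
  by rewrite (brZl Hlie) gam1 // gam2 // scaler0; apply: hw0.
rewrite (br_der Hlie) [X in hw _ X](br_der Hlie); apply: hwD; last exact: pres_f.
have aP := Delta_Phi aD; have bP := Delta_Phi bD.
rewrite [X in hw _ (br X _)](brZl Hlie) [X in hw _ (br (_ *: X) _)](brZr Hlie).
have [<-|ab] := eqVneq a b.
  rewrite scalerA -rmorphM c2 // scale1r !brXN //; last exact: SP.
  rewrite (CoS Hlie SS SP aP) !(brNl Hlie).
  by have := hwZr (-1) (pres_T (Co a) (wd_hw W)); rewrite rmorphN rmorph1 !scaleN1r.
have abN : a - b \notin Phi by apply: (Delta_subN xs_reg).
have E1 : br (X a) (X (- b)) = 0.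
  by apply: (brXX0 Hlie) => //; [exact: PhiN | rewrite subr_eq0].
have E2 : br (X (a *m S)) (X (- (b *m S))) = 0.
  apply: (brXX0 Hlie); rewrite ?PhiN ?SP // -mulmxBl.
    by apply: contraNneq ab => /(congr1 (mulmx^~ S)); rewrite (mulmx_involK _ SS) mul0mx => /eqP; rewrite subr_eq0.
  by apply: contraNN abN => /SP; rewrite (mulmx_involK _ SS).
by rewrite E1 E2 !scaler0 !(br0l Hlie); apply: hw0.
Qed.

Lemma gr_pres u u' : gr u u' -> pres u u'.
Proof.
elim=> [x|a aD|a aD|z x x' y y' _ Px _ Py|x x' y y' _ Px _ Py].
- exact: pres_T.
- exact: pres_e.
- exact: pres_f.
- by move=> w w' W; rewrite !(brDl Hlie) !(brZl Hlie); apply: hw_lin; [exact: Px | exact: Py].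
- move=> w w' W; have Eq (p q r : V) : br (br p q) r = br p (br q r) - br q (br p r).
    by rewrite (br_der Hlie p q r) addrK.
  rewrite !Eq addrC [X in hw _ X]addrC.
  have := hw_lin (-1) (Py _ _ (Px _ _ W)) (Px _ _ (Py _ _ W)).
  by rewrite rmorphN rmorph1 !scaleN1r.
Qed.

Lemma wd_height mu x y : wd mu x y -> [/\ mu = gam, x = X gam & y = X (gam *m S)] \/ pr mu xs < pr gam xs.
Proof.
case=> [|a {}mu {}x {}y aD W]; [by left | right].
have le : pr mu xs <= pr gam xs.
  elim: W => {mu x y} [|b mu x y bD _ IH]; first exact: lexx.
  by rewrite prDl prNl; apply: le_trans IH; rewrite gerBl; apply: ltW; apply: Delta_pos bD.
by rewrite prDl prNl; apply: lt_le_trans le; rewrite gtrBl; apply: Delta_pos aD.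
Qed.

(** Every nonempty word lowers the weight strictly, so only the generating pair contributes to the
    top coefficients. *)
Lemma hw_cf x y : hw x y -> cf (gam *m S) y = conjc (cf gam x).
Proof.
elim=> [|z mu u u' w w' W _ IH]; first by rewrite !cf0 rmorph0.
rewrite !cfD !cfZ IH rmorphD rmorphM; congr (_ * _ + _).
have [[_ -> ->]|lt] := wd_height W; first by rewrite !cf_X ?SP // !eqxx rmorph_nat.
have [w1 w2] := wd_wt W; have ne : gam != mu by apply: contraTneq lt => ->; rewrite ltxx.
rewrite (wt_cf0 Hlie gamP w1 ne) (wt_cf0 Hlie (SP gamP) w2) ?rmorph0 //.
by apply: contraNneq ne => /(congr1 (mulmx^~ S)); rewrite !(mulmx_involK _ SS) => ->.
Qed.

(** The second components over 0 form an ideal, so (0, coroot of gam S) would lie in the graph too.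
    Acting on the generating pair it yields (0, 2 X (gam S)) in the submodule, against [hw_cf]. *)
Lemma highest_notin_ker : ~ gr 0 (X (gam *m S)).
Proof.
move=> G; have GS := SP gamP.
have G2 : gr 0 (T (Co (gam *m S))).
  by have := ker_br (- X (- (gam *m S))) G; rewrite (brNl Hlie) (brC Hlie) opprK brXN //
     => /(lcN ker_lin); rewrite opprK.
have := hw_cf (gr_pres G2 (wd_hw wd0)); rewrite (br0l Hlie) cf0 rmorph0 brTX // cfZ prCo2 // cf_X //.
by rewrite eqxx mulr1 => /eqP; rewrite rC_eq0 pnatr_eq0.
Qed.

End HighestWeight.

Lemma ker_root_opp g : g \in Phi -> gr 0 (X g) -> gr 0 (X (- g)).
Proof.
move=> gP G; have := ker_br (X (- g)) (ker_br (X (- g)) G).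
rewrite (brC Hlie (X (- g)) (X g)) brXN // opprK (brC Hlie) brTX ?PhiN // prNl prCo2 //.
rewrite -scaleNr -rmorphN opprK; apply: (lcZK ker_lin).
by rewrite rC_eq0 pnatr_eq0.
Qed.

(** A nonzero ideal contains a root vector, found either directly or by bracketing a Cartan element
    with a root vector. Among the [g] with X (g S) in the ideal take the highest one: it is positive
    and no simple root can be added to it, so it gives a highest weight pair. Height is measured on
    [g] and not on g S, since [S] does not preserve positivity. *)
Lemma ker_eq0 y : gr 0 y -> y = 0.
Proof.
move=> G; apply: contrapT => /eqP y0.
have [a0 a0P Ga0] : exists2 a, a \in Phi & gr 0 (X a).
  have [H|/existsNP [a /not_implyP [aP /eqP ca]]] := pselect (forall a, a \in Phi -> cf a y = 0).
    have [p [q Ey]] := cf_all0 H.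
    have [H2|/existsNP [a /not_implyP [aP nz]]] :=
        pselect (forall a, a \in Phi -> pr a p = 0 /\ pr a q = 0).
      have p0 : p = 0 by apply: Phi_nondeg => a /H2 [].
      have q0 : q = 0 by apply: Phi_nondeg => a /H2 [].
      by case/negP: y0; rewrite Ey p0 q0 T0 scaler0 addr0.
    exists a => //; have := ker_br (X a) G.
    rewrite (brC Hlie) Ey (brDl Hlie) (brZl Hlie) !brTX // scalerA -scalerDl -scaleNr.
    apply: (lcZK ker_lin); rewrite oppr_eq0 eq_complex /=; apply/negP => /andP [].
    by rewrite !mul0r !mul1r subr0 !addr0 !add0r => /eqP E1 /eqP E2; apply: nz.
  by exists a => //; apply: stable_root_vectors ca => //; [exact: ker_lin | move=> ? ?; exact: ker_br].
pose K := [seq g <- Phi | `[< gr 0 (X (g *m S)) >]].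
have KP g : g \in K -> g \in Phi /\ gr 0 (X (g *m S)) by rewrite mem_filter => /andP [/asboolP].
have a1K : a0 *m S \in K by rewrite mem_filter SP // (mulmx_involK _ SS); apply/andP; split=> //; apply/asboolP.
have [gam gK gmax] : exists2 g, g \in K & forall k, k \in K -> pr k xs <= pr g xs.
  elim: (K) (a0 *m S) a1K => // b s IH k _.
  case: s IH => [|b2 s] IH; first by exists b; rewrite ?mem_head // => l; rewrite inE => /eqP ->.
  have [g gs gm] := IH b2 (mem_head _ _).
  have [le|lt] := lerP (pr b xs) (pr g xs).
    exists g; first by rewrite inE gs orbT.
    by move=> l; rewrite inE => /predU1P [->|/gm].
  exists b; first exact: mem_head.
  by move=> l; rewrite inE => /predU1P [->//|/gm Hl]; apply: le_trans Hl (ltW lt).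
have [gP gG] := KP _ gK; have gSP := SP gP.
have pg : pos gam.
  apply/negPn/negP => /(posN xs_reg gP) png; have : - gam \in K.
    rewrite mem_filter PhiN // andbT mulNmx; apply/asboolP; exact: ker_root_opp.
  move=> /gmax; rewrite leNgt => /negP; apply; apply: (@lt_trans _ _ 0) (png).
  by move: png; rewrite /pos prNl oppr_gt0.
have top a : a \in Delta -> a + gam \notin Phi.
  move=> aD; apply/negP => agP; have aP := Delta_Phi aD.
  have agSP : a *m S + gam *m S \in Phi by rewrite -mulmxDl SP.
  have := gmax (a + gam); rewrite prDl gerDr leNgt -/(pos a) (Delta_pos aD) => H.
  suff /H : a + gam \in K by [].
  rewrite mem_filter agP andbT; apply/asboolP; rewrite mulmxDl.
  have [r Er] := brXX Hlie (SP aP) gSP agSP.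
  have r0 : r%:C != 0.
    by apply: contraNneq (brXX_neq0 Hlie (SP aP) gSP agSP) => E0; rewrite Er E0 scale0r.
  by apply: (lcZK ker_lin r0); rewrite -Er; apply: ker_br.
have n0 a : a \in Delta -> a + gam != 0.
  move=> aD; have : 0 < pr (a + gam) xs by rewrite prDl addr_gt0 // -/(pos a) (Delta_pos aD).
  by apply: contraTneq => ->; rewrite pr0l ltxx.
apply: (highest_notin_ker gP _ _ gG) => a aD; have aP := Delta_Phi aD.
  by apply: (brXX0 Hlie) => //; [exact: n0 | exact: top].
apply: (brXX0 Hlie) => //; first exact: SP.
  by rewrite -mulmxDl; apply: contraNneq (n0 a aD) => /(congr1 (mulmx^~ S)); rewrite (mulmx_involK _ SS) mul0mx => ->.
by rewrite -mulmxDl; apply: contraNN (top a aD) => /SP; rewrite (mulmx_involK _ SS).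
Qed.

Lemma gr_fun x y z : gr x y -> gr x z -> y = z.
Proof.
move=> Gy Gz; have := gr_lin (-1) Gz Gy.
rewrite scaleN1r addNr rmorphN rmorph1 scaleN1r => /ker_eq0 /eqP.
by rewrite addrC subr_eq0 => /eqP.
Qed.

Theorem root_automorphism_lift : exists sigma : V -> V,
  [/\ antilinear sigma, forall u v, sigma (br u v) = br (sigma u) (sigma v),
      forall x, sigma (T x) = T (x *m S^T),
      forall a, a \in Delta -> sigma (X a) = (c a)%:C *: X (a *m S) /\
        sigma (X (- a)) = (c a)%:C *: X (- (a *m S))
    & forall g, g \in Phi -> exists r : R, sigma (X g) = r%:C *: X (g *m S)].
Proof.
have [sg Hsg] := choice gr_total; exists sg; split.
- by move=> z x y; apply: gr_fun (Hsg _) _; apply: gr_lin.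
- by move=> x y; apply: gr_fun (Hsg _) _; apply: gr_br.
- by move=> x; apply: gr_fun (Hsg _) _; apply: gr_T.
- by move=> a aD; split; apply: gr_fun (Hsg _) _; [exact: gr_e | exact: gr_f].
- by move=> g /gr_X [r _ G]; exists r; apply: gr_fun (Hsg _) _.
Qed.

End Isomorphism.

(** * Exponentials and Borel subalgebras *)

Section BigNat.
Variable V : zmodType.

Lemma sum_stop (F : nat -> V) a b : (a <= b)%N -> (forall k, (a <= k)%N -> F k = 0) ->
  \sum_(0 <= k < b) F k = \sum_(0 <= k < a) F k.
Proof.
move=> ab H; rewrite (big_cat_nat (n := a)) //= [X in _ + X]big_nat_cond [X in _ + X]big1 ?addr0 //.
by move=> k /andP [/andP [/H]].
Qed.

(** The Cauchy product of two finite series: both indices stay below K, so K + K diagonals catch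
    every term. *)
Lemma sum_antidiagonals (a : nat -> nat -> V) K :
  (forall i j, (K <= i)%N -> a i j = 0) -> (forall i j, (K <= j)%N -> a i j = 0) ->
  \sum_(0 <= m < K + K) \sum_(0 <= i < m.+1) a i (m - i)%N =
  \sum_(0 <= i < K) \sum_(0 <= j < K) a i j.
Proof.
move=> H1 H2; transitivity (\sum_(0 <= i < K + K) \sum_(0 <= j < K + K - i) a i j).
  transitivity (\sum_(0 <= m < K + K) \sum_(0 <= i < K + K | (i < m.+1)%N) a i (m - i)%N).
    rewrite big_nat_cond [RHS]big_nat_cond; apply: eq_bigr => m /andP [/andP [_ mK] _].
    by rewrite (big_nat_widen _ _ (K + K)).
  rewrite (exchange_big_dep_nat xpredT) //=; apply: eq_bigr => i _.
  transitivity (\sum_(i <= m < K + K) a i (m - i)%N).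
    by rewrite [RHS](big_nat_widenl _ 0) //; apply: eq_bigl => m; rewrite ltnS.
  by rewrite -{1}(add0n i) big_addn; apply: eq_bigr => j _; rewrite addnK.
rewrite (@sum_stop _ K) ?leq_addr // => [|k kK]; last by rewrite big1 // => j _; apply: H1.
rewrite big_nat_cond [RHS]big_nat_cond; apply: eq_bigr => i /andP [/andP [_ iK] _].
by apply: sum_stop => [|k]; [lia | apply: H2].
Qed.

End BigNat.

Section Exp.
Variables (R : realType) (V : vectType R[i]) (br : V -> V -> V).
Hypothesis Hlie : lie_bracket br.
Variables (n : V) (K : nat).
Hypothesis nilp : forall v, adn br K n v = 0.

Definition dp k v := (k`!%:R : R[i])^-1 *: adn br k n v.
Definition expad v := \sum_(0 <= k < K) dp k v.

Lemma dp_ge k v : (K <= k)%N -> dp k v = 0.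
Proof. by move=> Kk; rewrite /dp (adn_ge Hlie Kk (nilp v)) scaler0. Qed.

Lemma dp_lin k a u v : dp k (a *: u + v) = a *: dp k u + dp k v.
Proof. by rewrite /dp (adn_lin Hlie) scalerDr !scalerA mulrC. Qed.

Lemma dpS k v : k.+1%:R *: dp k.+1 v = br n (dp k v).
Proof.
rewrite /dp adnS (brZr Hlie) scalerA factS natrM invfM mulrA divff ?mul1r //.
by rewrite pnatr_eq0.
Qed.

Lemma dp_br m u v : dp m (br u v) = \sum_(0 <= i < m.+1) br (dp i u) (dp (m - i) v).
Proof.
elim: m => [|m IH]; first by rewrite big_nat1 /dp !fact0 invr1 !scale1r.
have m0 : (m.+1%:R : R[i]) != 0 by rewrite pnatr_eq0.
apply: (scalerI m0); rewrite dpS IH (br_sumr Hlie) scaler_sumr.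
transitivity (\sum_(0 <= i < m.+1) (i.+1%:R *: br (dp i.+1 u) (dp (m - i) v)) +
   \sum_(0 <= i < m.+1) ((m - i).+1%:R *: br (dp i u) (dp (m - i).+1 v))).
  rewrite -big_split; apply: eq_bigr => i _ /=.
  by rewrite (br_der Hlie) -(dpS i u) -(dpS (m - i) v) (brZl Hlie) (brZr Hlie (m - i).+1%:R).
have -> : \sum_(0 <= i < m.+1) i.+1%:R *: br (dp i.+1 u) (dp (m - i) v) =
    \sum_(0 <= i < m.+2) i%:R *: br (dp i u) (dp (m.+1 - i) v).
  by rewrite [RHS]big_nat_recl // scale0r add0r; apply: eq_bigr => i _; rewrite subSS.
have -> : \sum_(0 <= i < m.+1) (m - i).+1%:R *: br (dp i u) (dp (m - i).+1 v) =
    \sum_(0 <= i < m.+2) (m.+1 - i)%:R *: br (dp i u) (dp (m.+1 - i) v).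
  rewrite [RHS]big_nat_recr //= subnn scale0r addr0 big_nat_cond [RHS]big_nat_cond.
  by apply: eq_bigr => i /andP [/andP [_ im] _]; rewrite subSn.
rewrite -big_split big_nat_cond [RHS]big_nat_cond; apply: eq_bigr => i /andP [/andP [_ im] _] /=.
by rewrite -scalerDl -natrD subnKC.
Qed.

Lemma expad_lin a u v : expad (a *: u + v) = a *: expad u + expad v.
Proof. by rewrite /expad scaler_sumr -big_split; apply: eq_bigr => k _; rewrite dp_lin. Qed.

Lemma expad_trunc L v : (forall k, (L <= k)%N -> adn br k n v = 0) ->
  expad v = \sum_(0 <= k < L) dp k v.
Proof.
move=> H; transitivity (\sum_(0 <= k < K + L) dp k v).
  by rewrite /expad; symmetry; apply: sum_stop => [|k]; [exact: leq_addr | exact: dp_ge].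
by apply: sum_stop => [|k Lk]; [exact: leq_addl | rewrite /dp H // scaler0].
Qed.

Lemma expad_fix v : br n v = 0 -> expad v = v.
Proof.
move=> nv; rewrite (@expad_trunc 1); first by rewrite big_nat1 /dp fact0 invr1 scale1r.
by move=> k /(adn_ge Hlie); apply.
Qed.

Lemma expad_br u v : expad (br u v) = br (expad u) (expad v).
Proof.
rewrite (@expad_trunc (K + K)); last by move=> k Kk; apply: (adn_ge Hlie) (nilp _); lia.
under eq_bigr do rewrite dp_br.
rewrite (sum_antidiagonals (a := fun i j => br (dp i u) (dp j v))).
- rewrite /expad (br_suml Hlie); apply: eq_bigr => i _; by rewrite (br_sumr Hlie).
- by move=> i j Ki; rewrite dp_ge // (br0l Hlie).
- by move=> i j Kj; rewrite [X in br _ X]dp_ge // (br0r Hlie).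
Qed.

Lemma expad0 : expad 0 = 0.
Proof. by apply: expad_fix; rewrite (br0r Hlie). Qed.
Lemma expadD u v : expad (u + v) = expad u + expad v.
Proof. by have := expad_lin 1 u v; rewrite !scale1r. Qed.
Lemma expad_adn k v : adn br k n (expad v) = expad (adn br k n v).
Proof.
elim: k v => [|k IH] v //; rewrite !adnS IH expad_br; congr br.
by rewrite expad_fix // (brxx Hlie).
Qed.

(** The exponential fixes the kernel of ad n and commutes with ad n, so the power of ad n killing
    [v] can be lowered one step at a time. Surjectivity uses the same descent on v - expad v. *)
Lemma expad_eq0 v : expad v = 0 -> v = 0.
Proof.
move=> Ev; have := nilp v; elim: K => [|k IH] //= Hk; apply: IH.
by rewrite -(expad_fix Hk) -expad_adn Ev (adn0 Hlie).
Qed.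

Lemma expad_surj v : exists u, expad u = v.
Proof.
have := nilp v; elim: {1}K v => [|k IH] v /= Hk; first by exists 0; rewrite expad0 Hk.
have [|u Eu] := IH (v - expad v).
  by rewrite (adnDr Hlie) -scaleN1r (adnZ Hlie) scaleN1r expad_adn expad_fix // subrr.
by exists (u + v); rewrite expadD Eu subrK.
Qed.

Lemma expad3 v : br n (br n (br n v)) = 0 ->
  expad v = v + br n v + 2%:R^-1 *: br n (br n v).
Proof.
move=> H; rewrite (@expad_trunc 3); last by move=> k /(adn_ge Hlie); apply.
rewrite !big_nat_recr //= big_nil add0r /dp /= !invr1 !scale1r.
by [].
Qed.

End Exp.

(** * The standard Borel subalgebra and its images under automorphisms *)

Section Borel.
Variables (R : realType) (V : vectType R[i]) (br : V -> V -> V).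
Hypothesis Hlie : lie_bracket br.
Variable D : chevdata br.
Local Notation E := 'rV[R]_(cd_d D).
Local Notation Phi := (cd_Phi D).
Local Notation T := (@cd_T _ _ _ D).
Local Notation X := (@cd_X _ _ _ D).
Local Notation Co := (@cd_Co _ _ _ D).
Local Notation cf := (@cd_cf _ _ _ D).
Variable xs : E.
Hypothesis xs_reg : forall a, a \in Phi -> pr a xs != 0.
Local Notation pos := (pos xs).
Local Notation rk := (rk xs).

Definition bstd v := forall g, g \in Phi -> cf g v != 0 -> pos g.

Lemma bstd_lin : lin_closed bstd.
Proof.
split=> [g gP|z u v Bu Bv g gP]; first by rewrite cf0 eqxx.
rewrite cf_lin; have [u0|un] := eqVneq (cf g u) 0; last by move=> _; apply: Bu.
by rewrite u0 mulr0 add0r; apply: Bv.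
Qed.
Lemma bstd_T x : bstd (T x).
Proof. by move=> g gP; rewrite cf_T eqxx. Qed.
Lemma bstd_X a : a \in Phi -> pos a -> bstd (X a).
Proof.
move=> aP pa g gP; rewrite cf_X //; case: (eqVneq g a) => [-> //|_].
by rewrite eqxx.
Qed.
Lemma bstd_ind (P : V -> Prop) : lin_closed P -> (forall x, P (T x)) ->
  (forall a, a \in Phi -> pos a -> P (X a)) -> forall v, bstd v -> P v.
Proof.
move=> LP PT PX v Bv; have [x [y ->]] := cf_decomp D v.
apply: lcD => //; first by apply: lcD => //; apply: lcZ.
apply: lc_sum => // a aP; have [->|ca] := eqVneq (cf a v) 0; first by rewrite scale0r; case: LP.
by apply: lcZ => //; apply: PX => //; apply: Bv ca.
Qed.

(** Filtration of the nilradical by rank: bracketing two elements of level k raises the level,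
    because a sum of positive roots has a larger value at [xs] than each summand. *)
Definition lvl k v := v = \sum_(g <- Phi | pos g && (k <= rk g)%N) cf g v *: X g.

Lemma lvl_lin k : lin_closed (lvl k).
Proof.
split=> [|z u v Lu Lv]; first by rewrite /lvl big1 // => g _; rewrite cf0 scale0r.
rewrite /lvl {1}Lu {1}Lv scaler_sumr -big_split; apply: eq_bigr => g _ /=.
by rewrite cf_lin scalerDl scalerA.
Qed.
Lemma lvl_X k a : a \in Phi -> pos a -> (k <= rk a)%N -> lvl k (X a).
Proof.
move=> aP pa ka; rewrite /lvl big_mkcond (bigD1_seq a) ?Phi_uniq //= pa ka cf_X // eqxx scale1r.
rewrite big1_seq ?addr0 // => g /andP [ga gP]; case: ifP => // _.
by rewrite cf_X // (negbTE ga) scale0r.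
Qed.
Lemma lvl_ind k (P : V -> Prop) : lin_closed P ->
  (forall a, a \in Phi -> pos a -> (k <= rk a)%N -> P (X a)) -> forall v, lvl k v -> P v.
Proof.
move=> LP PX v ->; rewrite big_mkcond; apply: lc_sum => // a aP.
case: ifP => [/andP [pa ka]|_]; last by case: LP.
by apply: lcZ => //; apply: PX.
Qed.

Lemma lin_br_r u P : lin_closed P -> lin_closed (fun v => P (br u v)).
Proof.
by move=> [P0 PL]; split=> [|z x y Px Py]; rewrite ?(br0r Hlie) // (brDr Hlie) (brZr Hlie); apply: PL.
Qed.
Lemma lin_br_l v P : lin_closed P -> lin_closed (fun u => P (br u v)).
Proof.
by move=> [P0 PL]; split=> [|z x y Px Py]; rewrite ?(br0l Hlie) // (brDl Hlie) (brZl Hlie); apply: PL.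
Qed.

Lemma lvl_brXX k a b : a \in Phi -> b \in Phi -> pos a -> pos b -> (k <= (rk b).+1)%N -> lvl k (br (X a) (X b)).
Proof.
move=> aP bP pa pb kb; have pab : 0 < pr (a + b) xs by rewrite prDl addr_gt0.
have [abP|abN] := boolP (a + b \in Phi).
  have [r ->] := brXX Hlie aP bP abP; apply: (lcZ _ (lvl_lin k)); apply: lvl_X => //.
  by apply: leq_trans kb _; apply: rk_lt => //; rewrite prDl ltrDr.
rewrite (brXX0 Hlie) //; first by case: (lvl_lin k).
by apply: contraTneq pab => ->; rewrite pr0l ltxx.
Qed.

Lemma bstd_br0 u v : bstd u -> bstd v -> lvl 0 (br u v).
Proof.
move=> Bu Bv; move: u Bu; apply: bstd_ind => [|x|a aP pa].
- exact: (lin_br_l v (lvl_lin 0)).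
- move: v Bv; apply: bstd_ind => [|y|b bP pb]; first exact: (lin_br_r (T x) (lvl_lin 0)).
    by rewrite brTT; case: (lvl_lin 0).
  by rewrite brTX //; apply: (lcZ _ (lvl_lin 0)); apply: lvl_X.
- move: v Bv; apply: bstd_ind => [|y|b bP pb]; first exact: (lin_br_r (X a) (lvl_lin 0)).
    rewrite (brC Hlie) brTX // -scaleNr; apply: (lcZ _ (lvl_lin 0)); exact: lvl_X.
  exact: lvl_brXX.
Qed.

Lemma lvl_br k u v : lvl k u -> lvl k v -> lvl k.+1 (br u v).
Proof.
move=> Lu Lv; move: u Lu; apply: lvl_ind => [|a aP pa ka]; first exact: (lin_br_l v (lvl_lin k.+1)).
move: v Lv; apply: lvl_ind => [|b bP pb kb]; first exact: (lin_br_r (X a) (lvl_lin k.+1)).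
exact: lvl_brXX.
Qed.

Lemma lvl_bstd k v : lvl k v -> bstd v.
Proof. by apply: (lvl_ind bstd_lin) => a aP pa _; apply: bstd_X. Qed.

Lemma lvl_max v : lvl (size Phi).+1 v -> v = 0.
Proof.
move=> ->; rewrite big1 // => g /andP [_]; rewrite ltnNge count_size.
by [].
Qed.

Variable psi : V -> V.
Hypothesis psiL : forall a u v, psi (a *: u + v) = a *: psi u + psi v.
Hypothesis psiB : forall u v, psi (br u v) = br (psi u) (psi v).
Hypothesis psiI : forall v, psi v = 0 -> v = 0.
Hypothesis psiS : forall v, exists u, psi u = v.

Let psi0 : psi 0 = 0.
Proof. by apply: (@addrI _ (psi 0)); have := psiL 1 0 0; rewrite !scale1r !addr0 => <-. Qed.
Let psiZ a v : psi (a *: v) = a *: psi v.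
Proof. by have := psiL a v 0; rewrite psi0 !addr0. Qed.

Lemma lin_image P : lin_closed P -> lin_closed (fun v => exists2 u, P u & v = psi u).
Proof.
move=> [P0 PL]; split; first by exists 0.
by move=> z _ _ [u Pu ->] [v Pv ->]; exists (z *: u + v); [exact: PL | rewrite psiL].
Qed.

(** For maximality, a larger subalgebra contains the image of a vector with a negative root [g] in
    its support, hence the image of [X g] itself by weight decomposition. With X (- g) and the
    coroot this is a copy of sl2, which no solvable subalgebra contains. *)
Lemma borel_image : exists2 b : {vspace V}, borel br b &
  forall v, v \in b <-> exists2 u, bstd u & v = psi u.
Proof.
have [b bP] := vspace_of_pred (lin_image bstd_lin); exists b => //; split.
- apply: brs_sub => _ _ /bP [u Bu ->] /bP [v Bv ->]; apply/bP.
  by exists (br u v); [exact: lvl_bstd (bstd_br0 Bu Bv) | rewrite psiB].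
(* The first derived subalgebra has level 0, each further one gains a level, and level
   [(size Phi).+1] is zero. *)
- exists (size Phi).+2.
  have H k v : v \in derived br b k.+1 -> exists2 u, lvl k u & v = psi u.
    elim: k v => [|k IH]; apply: brs_ind => //; try exact: (lin_image (lvl_lin _)).
      move=> _ _ /bP [u Bu ->] /bP [v Bv ->].
      by exists (br u v); [exact: bstd_br0 | rewrite psiB].
    move=> _ _ /IH [u Bu ->] /IH [v Bv ->].
    by exists (br u v); [exact: lvl_br | rewrite psiB].
  apply/eqP; rewrite -subv0; apply/subvP => v /H [u /lvl_max -> ->].
  by rewrite psi0 mem0v.
move=> b' sb' [N sN] bb'; apply/eqP; rewrite eqEsubv bb' andbT; apply/subvP => v vb'.
have [u Eu] := psiS v; apply/bP; exists u => // g gP cg; apply/negPn/negP => ng.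
have b'B x y : x \in b' -> y \in b' -> br x y \in b'.
  by move=> xb yb; apply: (subvP sb'); apply: (mem_brs Hlie).
have Tb' x : psi (T x) \in b' by apply: (subvP bb'); apply/bP; exists (T x) => //; exact: bstd_T.
have LQ : lin_closed (fun w => psi w \in b').
  by split=> [|z x y xb yb]; rewrite ?psi0 ?mem0v // psiL memvD // memvZ.
have QT x w : psi w \in b' -> psi (br (T x) w) \in b' by rewrite psiB; apply: b'B.
have Xg : psi (X g) \in b' by apply: (stable_root_vectors Hlie LQ QT (v := u)) => //; rewrite Eu.
have Xng : psi (X (- g)) \in b'.
  apply: (subvP bb'); apply/bP; exists (X (- g)) => //; apply: bstd_X; first exact: PhiN.
  exact: (posN xs_reg).
have Hn n : [/\ psi (X g) \in derived br b' n, psi (X (- g)) \in derived br b' n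
    & psi (T (Co g)) \in derived br b' n].
  elim: n => [|n [H1 H2 H3]]; first by split.
  have two : (2%:R : R[i]) != 0 by rewrite pnatr_eq0.
  split.
  - have := mem_brs Hlie H3 H1; rewrite -psiB brTX // prCo2 // rmorph_nat psiZ.
    by move=> /(memvZ 2%:R^-1); rewrite scalerA mulVf // scale1r.
  - have := mem_brs Hlie H3 H2; rewrite -psiB brTX ?PhiN // prNl prCo2 // rmorphN rmorph_nat psiZ.
    by move=> /(memvZ (- 2%:R)^-1); rewrite scalerA mulVf ?oppr_eq0 // scale1r.
  - have := mem_brs Hlie H1 H2; rewrite -psiB brXN // -scaleN1r psiZ scaleN1r.
    by rewrite memvN.
have [] := Hn N; rewrite sN memv0 => /eqP /psiI /eqP.
by rewrite (negbTE (X_neq0 gP)).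
Qed.

End Borel.

(** * The quasi-split lift *)

Lemma solve_injective (F : fieldType) (I : eqType) (L : seq I) (G : I -> I -> F) (t : I -> F) :
  uniq L ->
  (forall u, (forall b, b \in L -> \sum_(a <- L) u a * G a b = 0) -> forall a, a \in L -> u a = 0) ->
  exists u, forall b, b \in L -> \sum_(a <- L) u a * G a b = t b.
Proof.
case: L => [|i0 L0]; first by move=> _ _; exists t.
set L := i0 :: L0 => uL Ginj; pose N := size L.
pose A : 'M[F]_N := \matrix_(i, j) G (nth i0 L i) (nth i0 L j).
have sumE (v : 'rV[F]_N) (u : I -> F) (j : 'I_N) : (forall i : 'I_N, u (nth i0 L i) = v 0 i) ->
    \sum_(a <- L) u a * G a (nth i0 L j) = (v *m A) 0 j.
  move=> uv; rewrite (big_nth i0) big_mkord mxE; apply: eq_bigr => i _.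
  by rewrite uv mxE.
pose fn (v : 'rV[F]_N) a := \sum_(i < N | nth i0 L i == a) v 0 i.
have fnE v (i : 'I_N) : fn v (nth i0 L i) = v 0 i.
  by rewrite /fn (big_pred1 i) // => j /=; rewrite nth_uniq.
have ordL b : b \in L -> exists j : 'I_N, b = nth i0 L j.
  by move=> bL; have jb : (index b L < N)%N by [rewrite index_mem]; exists (Ordinal jb); rewrite /= nth_index.
have Au : A \in unitmx.
  rewrite -row_free_unit; apply: inj_row_free => v v0; apply/rowP => i; rewrite mxE -fnE.
  apply: Ginj; last exact: mem_nth.
  by move=> b /ordL [j ->]; rewrite (sumE v) ?v0 ?mxE.
exists (fn ((\row_j t (nth i0 L j)) *m invmx A)) => b /ordL [j ->].
rewrite (sumE _ _ j (fnE _)) mulmxKV // mxE //.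
Qed.

Section Antilinear.
Variables (R : realType) (V : vectType R[i]) (f : V -> V).
Hypothesis fA : antilinear f.

Lemma al0 : f 0 = 0.
Proof.
apply: (@addrI _ (f 0)); have := fA 1 0 0.
by rewrite (rmorph1 (@conjc R)) !scale1r !addr0 => <-.
Qed.
Lemma alD x y : f (x + y) = f x + f y.
Proof. by have := fA 1 x y; rewrite (rmorph1 (@conjc R)) !scale1r. Qed.
Lemma alZ a x : f (a *: x) = conjc a *: f x.
Proof. by have := fA a x 0; rewrite al0 !addr0. Qed.
Lemma alZr (r : R) x : f (r%:C *: x) = r%:C *: f x.
Proof. by rewrite alZ conjc_real. Qed.
Lemma alN x : f (- x) = - f x.
Proof. by rewrite -scaleN1r alZ rmorphN rmorph1 scaleN1r. Qed.
Lemma al_sum I r (P : pred I) (F : I -> V) :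
  f (\sum_(i <- r | P i) F i) = \sum_(i <- r | P i) f (F i).
Proof. by apply: (big_morph f alD al0). Qed.
Lemma al_adn br n u v : (forall x y, f (br x y) = br (f x) (f y)) ->
  f (adn br n u v) = adn br n (f u) (f v).
Proof. by move=> fH; elim: n => //= n IH; rewrite fH IH. Qed.

End Antilinear.

(** The scalar is the product of (i + 1)(m - i) over i < n. Only its sign is used, to control the
    sign of sigma^2. *)
Lemma sl2_down_up (R : realType) (V : vectType R[i]) (br : V -> V -> V) (e f k v : V) (m n : nat) :
  lie_bracket br -> br e f = k -> br k e = 2%:R *: e -> br f v = 0 -> br k v = - m%:R *: v ->
  (n <= m)%N -> exists2 p : R, 0 < p & adn br n f (adn br n e v) = p%:C *: v.
Proof.
move=> Hlie ef ke fv kv; elim: n => [|n IH] nm; first by exists 1; rewrite ?ltr01 // scale1r.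
have [p p0 Ep] := IH (ltnW nm).
exists (n.+1%:R * (m%:R - n%:R) * p); first by rewrite !mulr_gt0 ?ltr0n // subr_gt0 ltr_nat.
rewrite adnSr (sl2_lower Hlie ef ke n fv kv) (adnZ Hlie) Ep scalerA; congr (_ *: _).
by rewrite !rmorphM rmorphB !rmorph_nat.
Qed.

(** * Positive systems adapted to the involution *)

Section PositiveSystem.
Variables (R : realType) (V : vectType R[i]) (br : V -> V -> V).
Hypothesis Hlie : lie_bracket br.
Variable D : chevdata br.
Local Notation E := 'rV[R]_(cd_d D).
Local Notation Phi := (cd_Phi D).
Local Notation T := (@cd_T _ _ _ D).
Variable S : 'M[R]_(cd_d D).
Hypothesis SS : S *m S = 1%:M.
Hypothesis SP : {in Phi, forall g, g *m S \in Phi}.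

(** An imaginary root vanishes at every vector fixed by the transpose of [S], and genericity of [x0]
    makes the converse true. A small regular perturbation of [x0], rescaled, gives [xs]. *)
Lemma adapted_positive_system : exists x0 xs : E,
  [/\ x0 *m S^T = x0, forall a, a \in Phi -> (pr a x0 == 0) = (a *m S == - a),
      forall a, a \in Phi -> pr a xs != 0
    & forall a, a \in Phi -> 0 < pr a x0 -> 0 < pr a xs].
Proof.
pose L := [seq a <- Phi | a *m S != - a].
have LP a : List.In a L -> a \in Phi /\ a *m S != - a.
  by move=> /mem_InP; rewrite mem_filter => /andP [].
have Q0 : (0 : E) *m S^T = 0 by exact: mul0mx.
have QL (r : R) (y z : E) : y *m S^T = y -> z *m S^T = z -> (r *: y + z) *m S^T = r *: y + z.
  by move=> Ey Ez; rewrite mulmxDl -scalemxAl Ey Ez.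
have [||x0 x0S Hx0] := @generic_vector R E (fun x => x *m S^T = x) Q0 QL _ L (@pr R (cd_d D)).
- by move=> a r y z _ _ _; rewrite prDr prZr.
(* Symmetrizing u = a + aS gives a fixed vector at which [a] takes the value pr u u, positive
   because [a] is not imaginary. *)
- move=> a /LP [aP aS]; exists ((a + a *m S) + (a + a *m S) *m S^T).
    by move: (_ + a *m S) => u; rewrite mulmxDl (mulmx_trinvolK _ SS) addrC.
  rewrite prDr -pr_mx -prDl gt_eqF // pr_gt0 //.
  by apply: contraNneq aS => /eqP; rewrite addrC addr_eq0.
have [||x1 _ Hx1] := @generic_vector R E (fun _ => True) I (fun _ _ _ _ _ => I) _ Phi (@pr R (cd_d D)).
- by move=> a r y z _ _ _; rewrite prDr prZr.
- by move=> a /mem_InP aP; exists a => //; rewrite gt_eqF // pr_gt0 // Phi_neq0.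
(* Large enough for [x0] to decide the sign of a root in M x0 + x1 whenever the root is nonzero at
   [x0]; for the other roots the quotient is 0 by convention. *)
pose M := \sum_(a <- Phi) `|pr a x1 / pr a x0| + 1.
have MP a : a \in Phi -> `|pr a x1 / pr a x0| < M.
  move=> aP; rewrite /M (bigD1_seq a) ?Phi_uniq //= -addrA ltrDl ltr_wpDl ?ltr01 // sumr_ge0 //.
have key a : a \in Phi -> 0 < pr a x0 -> 0 < pr a (M *: x0 + x1).
  move=> aP a0; have := MP a aP; rewrite normrM normfV (gtr0_norm a0) ltr_pdivrMr //.
  by rewrite ltr_norml => /andP [H _]; rewrite prDr prZr; lra.
exists x0, (M *: x0 + x1); split=> //.
- move=> a aP; apply/eqP/eqP => [H|aS].
    by apply: contrapT => /eqP aS; have /Hx0 : List.In a L by [apply/mem_InP; rewrite mem_filter aS]; rewrite H eqxx.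
  have : pr (a *m S) x0 = pr a x0 by rewrite pr_mx x0S.
  by rewrite aS prNl; lra.
move=> a aP; have [a0|a0|a0] := ltrgtP (pr a x0) 0.
- have := key (- a) (PhiN aP); rewrite !prNl !oppr_gt0 => /(_ a0) /lt_eqF ->; by [].
- by rewrite gt_eqF // key.
- by rewrite prDr prZr a0 mulr0 add0r; apply/Hx1/mem_InP.
Qed.

End PositiveSystem.

(** * The principal sl2 of the imaginary Levi subalgebra *)

Section Principal.
Variables (R : realType) (V : vectType R[i]) (br : V -> V -> V).
Hypothesis Hlie : lie_bracket br.
Variable D : chevdata br.
Local Notation E := 'rV[R]_(cd_d D).
Local Notation Phi := (cd_Phi D).
Local Notation T := (@cd_T _ _ _ D).
Local Notation X := (@cd_X _ _ _ D).
Local Notation Co := (@cd_Co _ _ _ D).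
Local Notation cf := (@cd_cf _ _ _ D).
Local Notation tau := (@cd_tau _ _ _ D).
Variable S : 'M[R]_(cd_d D).
Hypothesis SS : S *m S = 1%:M.
Hypothesis SP : {in Phi, forall g, g *m S \in Phi}.
Variables x0 xs : E.
Hypothesis x0S : x0 *m S^T = x0.
Hypothesis x0P : forall a, a \in Phi -> (pr a x0 == 0) = (a *m S == - a).
Hypothesis xs_reg : forall a, a \in Phi -> pr a xs != 0.
Hypothesis x0xs : forall a, a \in Phi -> 0 < pr a x0 -> 0 < pr a xs.
Local Notation Delta := (Delta xs).
Local Notation pos := (pos xs).
(* Imaginary roots; they are the roots of the Levi subalgebra centralizing T x0. *)
Local Notation im a := (a *m S == - a).

Lemma pr_S a : pr (a *m S) x0 = pr a x0.
Proof. by rewrite pr_mx x0S. Qed.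

Lemma pos_x0 a : a \in Phi -> pos a -> 0 <= pr a x0.
Proof.
move=> aP pa; rewrite leNgt; apply/negP => lt; have := x0xs (PhiN aP).
by rewrite prNl oppr_gt0 => /(_ lt); rewrite -/(pos _) pos_negF.
Qed.
Lemma posS_nonim a : a \in Phi -> pos a -> ~~ im a -> 0 < pr a x0.
Proof. by move=> aP pa; rewrite -x0P // lt_def => ->; rewrite pos_x0. Qed.

(** The linear system has the Cartan matrix of the imaginary simple roots, injective because [B] is
    definite and simple roots are independent. Nonnegativity of the solution comes from
    [obtuse_ge0]; its strictness is what makes the two principal nilpotents regular in the Levi
    subalgebra. *)
Lemma principal_coroot : exists y : E -> R,
  (forall a, a \in Delta -> im a -> 0 < y a) /\
  (forall a, a \in Delta -> im a -> pr a (\sum_(b <- Delta | im b) y b *: Co b) = 2%:R).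
Proof.
pose L := [seq a <- Delta | im a].
have LP a : a \in L -> a \in Delta /\ im a by rewrite mem_filter => /andP [].
have uL : uniq L by rewrite filter_uniq // Delta_uniq.
have LPhi a : a \in L -> a \in Phi by move=> /LP [/Delta_Phi].
have [|u Hu] := @solve_injective R _ L (fun a b => pr b (Co a)) (fun _ => 2%:R) uL.
  move=> u Hu.
  pose v := \sum_(a <- L) u a *: Co a.
  have vE : v = \sum_(a <- L) (u a * qf a) *: tv a.
    by apply: eq_big_seq => a aL; rewrite -scalerA -(Co_tv (LPhi a aL)).
  have v0 : v = 0.
    apply: B_eq0; rewrite {2}vE B_sumr big1_seq // => a /andP [_ aL].
    rewrite BZr (B_tv Hlie) ?LPhi // /v pr_sumr.
    by under eq_bigr do rewrite prZr; rewrite Hu // mulr0.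
  pose w a := if im a then u a * qf a else 0.
  have w0 : \sum_(a <- Delta) w a *: a = 0.
    apply: pr_eq => x; rewrite pr0l; transitivity (B x v); last by rewrite v0 B0r.
    rewrite vE B_sumr pr_suml /L [RHS]big_filter [RHS]big_mkcond /=.
    apply: eq_big_seq => a aD; rewrite /w; case: (im a); last by rewrite scale0r pr0l.
    by rewrite BZr (B_tv Hlie) ?(Delta_Phi aD) // prZl.
  move=> a aL; have [aD aim] := LP a aL.
  have := Delta_free Hlie xs_reg w0 aD; rewrite /w aim => /eqP; rewrite mulf_eq0.
  by rewrite (gt_eqF (qf_gt0 (LPhi a aL))) orbF => /eqP.
have Hp a : a \in Delta -> im a -> pr a (\sum_(b <- Delta | im b) u b *: Co b) = 2%:R.
  move=> aD aim; have aL : a \in L by rewrite mem_filter aim.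
  rewrite -(Hu a aL) /L [RHS]big_filter pr_sumr.
  by apply: eq_bigr => b _; rewrite prZr.
exists u; split=> // a aD aim.
pose w a := if im a then u a * qf a else 0.
have vE : \sum_(b <- Delta | im b) u b *: Co b = \sum_(b <- Delta) w b *: tv b.
  rewrite big_mkcond; apply: eq_big_seq => b bD; rewrite /w; case: (im b); last by rewrite scale0r.
  by rewrite -scalerA -Co_tv // (Delta_Phi bD).
have wge b : b \in Delta -> 0 <= w b.
  apply: (obtuse_ge0 Hlie xs_reg); rewrite -vE B_sumr big_seq_cond; apply: sumr_ge0 => k /andP [kD wk].
  rewrite BZr (B_tv Hlie) ?(Delta_Phi kD) // mulr_ge0 ?oppr_ge0 ?(ltW wk) //.
  move: wk; rewrite /w; case: (boolP (im k)) => [kim _|_]; last by rewrite ltxx.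
  by rewrite Hp.
have uge b : b \in Delta -> im b -> 0 <= u b.
  by move=> bD bim; have := wge b bD; rewrite /w bim pmulr_lge0 // qf_gt0 // (Delta_Phi bD).
(* Were the coefficient at [a] zero, only obtuse terms would remain, and the value 2 of [a] would be
   at most 0. *)
rewrite lt_def uge // andbT; apply/negP => /eqP u0.
have := Hp a aD aim; rewrite pr_sumr => H; have : \sum_(i <- Delta | im i) pr a (u i *: Co i) <= 0.
  rewrite big_seq_cond; apply: sumr_le0 => b /andP [bD bim]; rewrite prZr.
  have [<-|ab] := eqVneq a b; first by rewrite u0 mul0r.
  by rewrite mulr_ge0_le0 ?uge //; apply: (Delta_obtuse Hlie xs_reg).
by rewrite H lern0.
Qed.

(* (e, T h0, f) is a principal sl2 triple of that Levi subalgebra; sigma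
   exchanges e and f as soon as sigma (X b) = - X (- b) for the imaginary simple roots b. *)
Variable y : E -> R.
Hypothesis y_gt0 : forall a, a \in Delta -> im a -> 0 < y a.
Let h0 := \sum_(b <- Delta | im b) y b *: Co b.
Hypothesis h0P : forall a, a \in Delta -> im a -> pr a h0 = 2%:R.

(** The square roots share [y b] equally between [e] and [f], so that [e, f] = T h0 and a sign -1 on
    each imaginary simple root exchanges the two. The minus sign in [f] compensates [X_a, X_{-a}] =
    - T (Co a). *)
Definition prin_e : V := \sum_(b <- Delta | im b) (Num.sqrt (y b))%:C *: X b.
Definition prin_f : V := - \sum_(b <- Delta | im b) (Num.sqrt (y b))%:C *: X (- b).
Let e := prin_e.
Let f := prin_f.

Lemma h0S : h0 *m S^T = - h0.
Proof.
rewrite /h0 mulmx_suml -sumrN [LHS]big_seq_cond [RHS]big_seq_cond; apply: eq_bigr => a /andP [aD /eqP aim].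
have aP := Delta_Phi aD.
by rewrite -scalemxAl -(CoS Hlie SS SP aP) aim (CoN Hlie aP) scalerN.
Qed.

Lemma br_T_e x r : (forall a, a \in Delta -> im a -> pr a x = r) -> br (T x) e = r%:C *: e.
Proof.
move=> H; rewrite /e /prin_e (br_sumr Hlie) scaler_sumr [LHS]big_seq_cond [RHS]big_seq_cond.
apply: eq_bigr => a /andP [aD aim]; rewrite (brZr Hlie) brTX ?(Delta_Phi aD) // H //.
by rewrite !scalerA mulrC.
Qed.
Lemma br_T_f x r : (forall a, a \in Delta -> im a -> pr a x = r) -> br (T x) f = - (r%:C *: f).
Proof.
move=> H; rewrite /f /prin_f (brNr Hlie) (br_sumr Hlie) scalerN opprK scaler_sumr -sumrN [LHS]big_seq_cond [RHS]big_seq_cond.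
apply: eq_bigr => a /andP [aD aim]; rewrite (brZr Hlie) brTX ?PhiN ?(Delta_Phi aD) // prNl H //.
by rewrite !scalerA rmorphN mulrN scaleNr opprK mulrC.
Qed.

Lemma prin_ke : br (T h0) e = 2%:R *: e.
Proof. by rewrite (br_T_e h0P) rmorph_nat. Qed.
Lemma prin_kf : br (T h0) f = - (2%:R *: f).
Proof. by rewrite (br_T_f h0P) rmorph_nat. Qed.
Lemma x0_im a : a \in Delta -> im a -> pr a x0 = 0.
Proof. by move=> aD aim; apply/eqP; rewrite x0P // (Delta_Phi aD). Qed.
Lemma br_x0_e : br (T x0) e = 0.
Proof. by rewrite (br_T_e x0_im) scale0r. Qed.
Lemma br_x0_f : br (T x0) f = 0.
Proof. by rewrite (br_T_f x0_im) scale0r oppr0. Qed.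

Lemma prin_ef : br e f = T h0.
Proof.
rewrite /e /f /prin_e /prin_f (brNr Hlie) (br_suml Hlie) /h0 T_sum -sumrN [LHS]big_seq_cond [RHS]big_seq_cond.
apply: eq_bigr => a /andP [aD aim]; have aP := Delta_Phi aD.
rewrite (br_sumr Hlie) big_mkcond (bigD1_seq a) ?Delta_uniq //= aim big1_seq ?addr0.
  rewrite (brZl Hlie) (brZr Hlie) brXN // !scalerN opprK scalerA -rmorphM /= -expr2 sqr_sqrtr.
    by rewrite TZ.
  by rewrite ltW // y_gt0.
move=> b /andP [ba bD]; case: ifP => // bim; rewrite (brZl Hlie) (brZr Hlie) (brXX0 Hlie) ?scaler0 //.
- by apply: PhiN; apply: (Delta_Phi bD).
- by rewrite subr_eq0 eq_sym.
- exact: (Delta_subN xs_reg).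
Qed.

Lemma prin_f_lowest a : a \in Delta -> ~~ im a -> br f (X a) = 0.
Proof.
move=> aD aim; rewrite /f /prin_f (brNl Hlie) (br_suml Hlie) big1_seq ?oppr0 //.
move=> b /andP [bim bD]; rewrite (brZl Hlie) (brXX0 Hlie) ?scaler0 //.
- by apply: PhiN; apply: (Delta_Phi bD).
- exact: (Delta_Phi aD).
- by rewrite addrC subr_eq0; apply: contraNneq aim => ->.
- by rewrite addrC; apply: (Delta_subN xs_reg).
Qed.

Lemma adn_eigen u v x (s t : R[i]) n : br (T x) u = t *: u -> br (T x) v = s *: v ->
  br (T x) (adn br n u v) = (s + n%:R * t) *: adn br n u v.
Proof.
move=> Eu Ev; elim: n => [|n IH] /=; first by rewrite mul0r addr0.
rewrite (br_der Hlie) Eu IH (brZl Hlie) (brZr Hlie) -scalerDl; congr (_ *: _).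
by rewrite -[n.+1]add1n natrD; ring.
Qed.

Variable om : E -> E.
Hypothesis omP : forall a b, a \in Delta -> b \in Delta -> pr a (om b) = (a == b)%:R.

Lemma sum_delta (F : E -> R) b : b \in Delta -> \sum_(a <- Delta) F a * (a == b)%:R = F b.
Proof.
move=> bD; rewrite (bigD1_seq b) ?Delta_uniq //= eqxx mulr1 big1 ?addr0 // => a /negbTE ->.
by rewrite mulr0.
Qed.

Lemma coef_comb (F : E -> R) b : b \in Delta -> pr (\sum_(a <- Delta) F a *: a) (om b) = F b.
Proof.
move=> bD; rewrite pr_suml -[RHS](sum_delta F bD); apply: eq_big_seq => a aD.
by rewrite prZl omP.
Qed.

Lemma coef_nat g b : g \in Phi -> pos g -> b \in Delta -> exists n : nat, pr g (om b) = n%:R.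
Proof.
move=> gP pg bD; have [n En] := pos_comb gP pg; exists (n b).
rewrite {1}En -(coef_comb (fun a => (n a)%:R) bD).
by congr pr; apply: eq_bigr => a _; rewrite scaler_nat.
Qed.

Lemma coef_ge0 g b : g \in Phi -> pos g -> b \in Delta -> 0 <= pr g (om b).
Proof. by move=> gP pg bD; have [n ->] := coef_nat gP pg bD. Qed.

Lemma coef_exp g : g \in Phi -> g = \sum_(b <- Delta) pr g (om b) *: b.
Proof.
have H k : k \in Phi -> pos k -> k = \sum_(b <- Delta) pr k (om b) *: b.
  move=> kP pk; have [n En] := pos_comb kP pk.
  have En' : k = \sum_(a <- Delta) (n a)%:R *: a.
    by rewrite {1}En; apply: eq_bigr => a _; rewrite scaler_nat.
  by rewrite {1}En'; apply: eq_big_seq => b bD; rewrite En' coef_comb.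
move=> gP; have [/(H g gP) //|ng] := boolP (pos g).
apply: oppr_inj; rewrite {1}(H (- g) (PhiN gP) (posN xs_reg gP ng)) -sumrN.
by apply: eq_bigr => b _; rewrite prNl scaleNr.
Qed.

Lemma coef_ext g k : g \in Phi -> k \in Phi ->
  (forall b, b \in Delta -> pr g (om b) = pr k (om b)) -> g = k.
Proof.
move=> gP kP H; rewrite (coef_exp gP) (coef_exp kP).
by apply: eq_big_seq => b bD; rewrite H.
Qed.

Lemma mulmx_comb (F : E -> R) : (\sum_(b <- Delta) F b *: b) *m S =
  \sum_(b <- Delta | ~~ im b) F b *: (b *m S) - \sum_(b <- Delta | im b) F b *: b.
Proof.
rewrite mulmx_suml (bigID (fun b => im b)) /= addrC; congr (_ + _).
  by apply: eq_bigr => b _; rewrite scalemxAl.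
by rewrite -sumrN; apply: eq_bigr => b /eqP bim; rewrite -scalemxAl bim scalerN.
Qed.

Lemma im_comb_coef (F : E -> R) k : k \in Delta ->
  pr (\sum_(b <- Delta | im b) F b *: b) (om k) = if im k then F k else 0.
Proof.
move=> kD; rewrite big_mkcond -(coef_comb (fun b => if im b then F b else 0) kD); congr pr.
by apply: eq_bigr => b _; case: (im b); rewrite ?scale0r.
Qed.

Lemma pos_mulS a : a \in Delta -> ~~ im a -> a *m S \in Phi /\ pos (a *m S).
Proof.
move=> aD aim; have aP := Delta_Phi aD; split; first exact: SP.
by apply: x0xs; rewrite ?SP // pr_S; apply: posS_nonim => //; apply: Delta_pos.
Qed.

(* [a -> a'] is the diagram involution: on Delta modulo the span of the imaginary
   simple roots, S is a nonnegative integral matrix of square 1. *)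
Lemma Delta_partner a : a \in Delta -> ~~ im a -> exists a',
  [/\ a' \in Delta, ~~ im a',
      forall b, b \in Delta -> ~~ im b -> pr (a *m S) (om b) = (b == a')%:R,
      forall b, b \in Delta -> ~~ im b -> pr (a' *m S) (om b) = (b == a)%:R
    & forall b, b \in Delta -> im b -> pr (a *m S) (om b) = pr (a' *m S) (om b)].
Proof.
pose m (p q : E) := pr (p *m S) (om q).
have mge0 p q : p \in Delta -> ~~ im p -> q \in Delta -> 0 <= m p q.
  by move=> pD pn qD; have [pP pp] := pos_mulS pD pn; apply: coef_ge0.
have msq p q : p \in Delta -> ~~ im p -> q \in Delta -> ~~ im q ->
    \sum_(b <- Delta | ~~ im b) m p b * m b q = (p == q)%:R.
  move=> pD pn qD qn; rewrite -omP // -{2}(mulmx_involK p SS) {1}(coef_exp (SP (Delta_Phi pD))).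
  rewrite mulmx_comb prDl prNl im_comb_coef // (negbTE qn) subr0 pr_suml.
  by apply: eq_bigr => b _; rewrite prZl.
have mex p : p \in Delta -> ~~ im p -> exists2 b, b \in Delta & ~~ im b /\ m p b != 0.
  move=> pD pn; apply: contrapT => H.
  have := posS_nonim (Delta_Phi pD) (Delta_pos pD) pn; rewrite -pr_S.
  rewrite (coef_exp (SP (Delta_Phi pD))) pr_suml big1_seq ?ltxx // => b bD; rewrite prZl.
  have [bim|bn] := boolP (im b); first by rewrite x0_im // mulr0.
  have -> : pr (p *m S) (om b) = 0; last by rewrite mul0r.
  by apply/eqP/negPn/negP => nz; apply: H; exists b.
move=> aD an; have [a' a'D [a'n ma']] := mex a aD an.
have mle k : k \in Delta -> ~~ im k -> m a a' * m a' k <= (a == k)%:R.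
  move=> kD kn; rewrite -msq // big_mkcond (bigD1_seq a') ?Delta_uniq //= a'n lerDl big_seq_cond.
  apply: sumr_ge0 => b /andP [bD _]; case: ifP => // bn.
  by rewrite mulr_ge0 ?mge0.
have maa' : 0 < m a a' by rewrite lt_def ma' mge0.
have m0 k : k \in Delta -> ~~ im k -> k != a -> m a' k = 0.
  move=> kD kn ka; have := mle k kD kn; rewrite eq_sym (negbTE ka) pmulr_rle0 // => le0.
  by apply/eqP; rewrite eq_le le0 mge0.
have [b bD [bn mb]] := mex a' a'D a'n.
have ba : b = a by apply/eqP; apply: contraNT mb => ba; rewrite m0.
rewrite ba in mb; clear b bD bn ba.
have ma'a : m a' a = 1.
  (* Integrality enters here: two nonzero natural numbers whose product is at most 1 are both 1. *)
  have [p Ep] := coef_nat (pos_mulS a'D a'n).1 (pos_mulS a'D a'n).2 aD.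
  have [q Eq] := coef_nat (pos_mulS aD an).1 (pos_mulS aD an).2 a'D.
  have := mle a aD an; rewrite /m in mb maa' *; rewrite Ep Eq eqxx in mb maa' *.
  rewrite -natrM ler_nat; rewrite pnatr_eq0 in mb; rewrite ltr0n in maa' => pq.
  by have -> : p = 1%N by nia.
have Ea' : a' *m S = a + \sum_(b <- Delta | im b) m a' b *: b.
  rewrite {1}(coef_exp (SP (Delta_Phi a'D))) (bigID (fun b => im b)) /= addrC; congr (_ + _).
  rewrite big_mkcond (bigD1_seq a) ?Delta_uniq //= an -/(m a' a) ma'a scale1r big1_seq ?addr0 //.
  by move=> b /andP [ba bD]; case: ifP => // bn; rewrite -/(m a' b) m0 // scale0r.
(* Applying [S] negates the imaginary part and moving it across restores its sign: aS and a'S have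
   the same imaginary coefficients. *)
have Ea : a *m S = a' + \sum_(b <- Delta | im b) m a' b *: b.
  have := congr1 (mulmx^~ S) Ea'; rewrite /= (mulmx_involK _ SS) mulmxDl.
  have -> : (\sum_(b <- Delta | im b) m a' b *: b) *m S = - \sum_(b <- Delta | im b) m a' b *: b.
    by rewrite mulmx_suml -sumrN; apply: eq_bigr => b /eqP bim; rewrite -scalemxAl bim scalerN.
  by move=> /eqP; rewrite eq_sym subr_eq => /eqP.
exists a'; split=> // b bD bn.
- by rewrite Ea prDl omP // im_comb_coef // (negbTE bn) addr0 eq_sym.
- by rewrite Ea' prDl omP // im_comb_coef // (negbTE bn) addr0 eq_sym.
- rewrite {1}Ea prDl omP // im_comb_coef // bn.
  by have -> : (a' == b) = false by [apply/negbTE; apply: contraNneq a'n => ->]; rewrite add0r.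
Qed.

(** Pairing with it gives the imaginary height, the sum of the coefficients on imaginary simple
    roots. It is a sum of coweights, not a half sum of roots. *)
Let rho := \sum_(b <- Delta | im b) om b.

Lemma pr_rho g : pr g rho = \sum_(b <- Delta | im b) pr g (om b).
Proof. exact: pr_sumr. Qed.

Lemma pr_rho_Delta a : a \in Delta -> pr a rho = (im a)%:R.
Proof.
move=> aD; rewrite pr_rho big_mkcond; case: (boolP (im a)) => aim.
  rewrite (bigD1_seq a) ?Delta_uniq //= aim omP // eqxx big1_seq ?addr0 //.
  by move=> b /andP [ba bD]; case: ifP => // _; rewrite omP // eq_sym (negbTE ba).
rewrite big1_seq // => b /andP [_ bD]; case: ifP => // bim.
by rewrite omP //; have -> : (a == b) = false by [apply/negbTE; apply: contraNneq aim => ->].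
Qed.

(** [e] is an eigenvector of T x whenever all imaginary simple roots take the same value at [x].
    Comparing eigenvalues at a coweight of a root that is not imaginary, at [rho] and at [x0] gives
    the three claims. *)
Lemma string_support a n g : a \in Delta -> ~~ im a -> g \in Phi ->
  cf g (adn br n e (X a)) != 0 ->
  [/\ forall b, b \in Delta -> ~~ im b -> pr g (om b) = (b == a)%:R,
      pr g rho = n%:R & pr g x0 = pr a x0].
Proof.
move=> aD an gP cg; have aP := Delta_Phi aD.
have main x r : (forall b, b \in Delta -> im b -> pr b x = r) -> pr g x = pr a x + n%:R * r.
  move=> H; apply: rC_inj.
  rewrite -(cf_eigen Hlie gP (adn_eigen n (br_T_e H) (brTX x aP)) cg).
  by rewrite rmorphD rmorphM rmorph_nat.
split=> [b bD bn||].
- rewrite (main _ 0) ?mulr0 ?addr0 ?omP // 1?eq_sym // => k kD kim; rewrite omP //.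
  by have -> : (k == b) = false by [apply/negbTE; apply: contraTneq kim => ->].
- by rewrite (main _ 1) ?pr_rho_Delta ?(negbTE an) ?add0r ?mulr1 // => k kD kim; rewrite pr_rho_Delta // kim.
- by rewrite (main _ 0) ?mulr0 ?addr0 // => k kD kim; apply: x0_im.
Qed.

(** Here [g] is [a] plus an imaginary part, so gS is aS minus that part. As gS is still a positive
    root, its coefficient at [b] is nonnegative, and that is the bound. *)
Lemma string_bound a n g b : a \in Delta -> ~~ im a -> g \in Phi ->
  cf g (adn br n e (X a)) != 0 -> b \in Delta -> im b -> pr g (om b) <= pr (a *m S) (om b).
Proof.
move=> aD an gP cg bD bim; have [c1 c2 c3] := string_support aD an gP cg.
have gSP := SP gP; have pgS : pos (g *m S).
  by apply: x0xs => //; rewrite pr_S c3 posS_nonim ?(Delta_Phi aD) ?(Delta_pos aD).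
have := coef_ge0 gSP pgS bD; rewrite {1}(coef_exp gP) mulmx_comb prDl prNl im_comb_coef // bim subr_ge0.
rewrite big_mkcond (bigD1_seq a) ?Delta_uniq //= an (c1 a aD an) eqxx scale1r big1_seq ?addr0 //.
by move=> k /andP [ka kD]; case: ifP => // kn; rewrite c1 // (negbTE ka) scale0r.
Qed.

Lemma string_br_x0 a n : a \in Delta -> ~~ im a ->
  br (T x0) (adn br n e (X a)) = (pr a x0)%:C *: adn br n e (X a).
Proof.
move=> aD an; have E0 : br (T x0) e = 0 *: e by rewrite scale0r br_x0_e.
by rewrite (adn_eigen n E0 (brTX x0 (Delta_Phi aD))) mulr0 addr0.
Qed.

Lemma string_cf0 a (v : V) : a \in Delta -> ~~ im a -> br (T x0) v = (pr a x0)%:C *: v ->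
  (forall g, g \in Phi -> cf g v = 0) -> v = 0.
Proof.
move=> aD an Ev H; have [p [q Epq]] := cf_all0 H.
move: Ev; rewrite {1}Epq (brDr Hlie) (brZr Hlie) !brTT scaler0 addr0 => /esym/eqP.
rewrite scaler_eq0 rC_eq0 (gt_eqF (posS_nonim (Delta_Phi aD) (Delta_pos aD) an)).
by move=> /eqP.
Qed.

Lemma e_nilp : exists K, forall v, adn br K e v = 0.
Proof. exact: (ad_nilp Hlie prin_ke). Qed.

(** [X a] is a lowest weight vector of weight - m for the principal sl2, so e^m X_a is nonzero. A
    root in its support has imaginary height [m], and summing [string_bound] bounds this by the
    height of aS. *)
Lemma string_weight a : a \in Delta -> ~~ im a -> exists m : nat,
  [/\ - pr a h0 = m%:R, adn br m e (X a) != 0 & m%:R <= pr (a *m S) rho].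
Proof.
move=> aD an; have aP := Delta_Phi aD; have [K HK] := e_nilp.
have Ek : br (T h0) (X a) = - (- pr a h0)%:C *: X a by rewrite rmorphN opprK brTX.
have [m [Em nz _]] := sl2_lowest Hlie prin_ef prin_ke (X_neq0 aP) (HK _) (prin_f_lowest aD an) Ek.
exists m; split; [by apply: rC_inj; rewrite Em rmorph_nat | exact: nz |].
have [g gP cg] : exists2 g, g \in Phi & cf g (adn br m e (X a)) != 0.
  apply: contrapT => H; case/negP: (nz m (leqnn m)); apply/eqP.
  apply: (string_cf0 aD an (string_br_x0 m aD an)) => g gP; apply/eqP/negPn/negP => cg.
  by apply: H; exists g.
have [_ <- _] := string_support aD an gP cg; rewrite !pr_rho big_seq_cond [leRHS]big_seq_cond.
by apply: ler_sum => b /andP [bD bim]; apply: string_bound cg bD bim.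
Qed.

(** Keeps track of reality along the principal string, so that the factor at its end is real and has
    a sign. *)
Definition real_nil v := exists r : E -> R, v = \sum_(g <- Phi | 0 < pr g x0) (r g)%:C *: X g.

Lemma real_nil_cf g v : g \in Phi -> real_nil v -> exists r : R, cf g v = r%:C.
Proof.
move=> gP [r ->]; rewrite cf_sum big_mkcond (bigD1_seq g) ?Phi_uniq //= big1_seq ?addr0.
  by case: ifP => _; [exists (r g); rewrite cfZ cf_X // eqxx mulr1 | exists 0].
by move=> k /andP [kg kP]; case: ifP => // _; rewrite cfZ cf_X // eq_sym (negbTE kg) mulr0.
Qed.

Lemma real_nilD u v : real_nil u -> real_nil v -> real_nil (u + v).
Proof.
move=> [r ->] [t ->]; exists (fun g => r g + t g); rewrite -big_split.
by apply: eq_bigr => g _; rewrite rmorphD scalerDl.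
Qed.
Lemma real_nilZ (r : R) v : real_nil v -> real_nil (r%:C *: v).
Proof.
move=> [t ->]; exists (fun g => r * t g); rewrite scaler_sumr.
by apply: eq_bigr => g _; rewrite rmorphM scalerA.
Qed.
Lemma real_nil0 : real_nil 0.
Proof. by exists (fun _ => 0); rewrite big1 // => g _; rewrite scale0r. Qed.
Lemma real_nilX g : g \in Phi -> 0 < pr g x0 -> real_nil (X g).
Proof.
move=> gP g0; exists (fun k => (k == g)%:R); rewrite big_mkcond (bigD1_seq g) ?Phi_uniq //= g0 eqxx scale1r.
by rewrite big1_seq ?addr0 // => k /andP [/negbTE -> _]; rewrite scale0r if_same.
Qed.
Lemma real_nil_sum (I : eqType) (s : seq I) (P : pred I) (F : I -> V) :
  (forall i, i \in s -> P i -> real_nil (F i)) -> real_nil (\sum_(i <- s | P i) F i).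
Proof.
move=> H; rewrite big_seq_cond; elim/big_ind: _ => [||i /andP [is_ Pi]]; last exact: H.
  exact: real_nil0.
exact: real_nilD.
Qed.
Lemma real_nil_e v : real_nil v -> real_nil (br e v).
Proof.
move=> [r ->]; rewrite (br_sumr Hlie); apply: real_nil_sum => g gP g0.
rewrite (brZr Hlie); apply: real_nilZ; rewrite /e /prin_e (br_suml Hlie).
apply: real_nil_sum => b bD bim; rewrite (brZl Hlie); apply: real_nilZ.
have bP := Delta_Phi bD; have bg0 : 0 < pr (b + g) x0 by rewrite prDl x0_im // add0r.
have [bgP|bgN] := boolP (b + g \in Phi).
  by have [n ->] := brXX Hlie bP gP bgP; apply: real_nilZ; apply: real_nilX.
rewrite (brXX0 Hlie) //; first exact: real_nil0.
by apply: contraTneq bg0 => ->; rewrite pr0l ltxx.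
Qed.

(** Let [m] and [m'] be the string lengths from [a] and [a'], and [r] the common imaginary height of
    aS and a'S. Evaluating aS at [h0], which [S] negates, gives m = - m' + 2r; as both are at most
    r, both equal r. The last vector of the string from [a'] then attains every bound of
    [string_bound], which leaves aS as its only weight. *)
Lemma string_end a : a \in Delta -> ~~ im a -> exists a' (N : nat) (k : R),
  [/\ a' \in Delta /\ ~~ im a', k != 0, adn br N e (X a') = k%:C *: X (a *m S),
      N%:R = - pr a h0 /\ N%:R = - pr a' h0
    & forall b, b \in Delta -> ~~ im b ->
        pr (a *m S) (om b) = (b == a')%:R /\ pr (a' *m S) (om b) = (b == a)%:R].
Proof.
move=> aD an; have [a' [a'D a'n c1 c2 c3]] := Delta_partner aD an.
have aSP := SP (Delta_Phi aD).
have [m [Em _ mle]] := string_weight aD an; have [m' [Em' nz' mle']] := string_weight a'D a'n.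
have Er : pr (a *m S) rho = pr (a' *m S) rho.
  by rewrite !pr_rho big_seq_cond [RHS]big_seq_cond; apply: eq_bigr => b /andP [bD bim]; apply: c3.
have Eh : pr (a *m S) h0 = pr a' h0 + 2%:R * pr (a *m S) rho.
  rewrite {1}(coef_exp aSP) pr_suml (bigID (fun b => im b)) /= addrC; congr (_ + _).
    rewrite big_mkcond (bigD1_seq a') ?Delta_uniq //= a'n c1 // eqxx scale1r big1_seq ?addr0 //.
    by move=> b /andP [ba bD]; case: ifP => // bn; rewrite c1 // (negbTE ba) scale0r pr0l.
  rewrite pr_rho mulr_sumr big_seq_cond [RHS]big_seq_cond; apply: eq_bigr => b /andP [bD bim].
  by rewrite prZl h0P // mulrC.
have Eh2 : pr (a *m S) h0 = - pr a h0 by rewrite pr_mx h0S prNr.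
have mr : m%:R = pr (a *m S) rho by lra.
have mr' : m'%:R = pr (a' *m S) rho by lra.
pose v := adn br m' e (X a').
have vsupp g : g \in Phi -> g != a *m S -> cf g v = 0.
  move=> gP ga; apply/eqP/negPn/negP => cg; case/negP: ga; apply/eqP.
  have [d1 d2 d3] := string_support a'D a'n gP cg.
  apply: (coef_ext gP aSP) => b bD; have [bim|bn] := boolP (im b); last by rewrite d1 // c1.
  have Hle k : k \in Delta -> im k -> pr g (om k) <= pr (a *m S) (om k).
    by move=> kD kim; rewrite c3 //; apply: string_bound cg kD kim.
  (* Nonnegative differences with sum zero: each coefficient of [g] agrees with that of aS. *)
  have : \sum_(k <- Delta | im k) (pr (a *m S) (om k) - pr g (om k)) = 0.
    by rewrite sumrB -!pr_rho d2 Er mr' subrr.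
  move/eqP; rewrite big_seq_cond psumr_eq0 => [|k /andP [kD kim]]; last by rewrite subr_ge0 Hle.
  by move/allP => /(_ b bD); rewrite bD bim /= subr_eq0 => /eqP.
have vr : real_nil v.
  rewrite /v; elim: (m') => [|n IH]; last exact: real_nil_e.
  by apply: real_nilX; rewrite ?(Delta_Phi a'D) // posS_nonim ?(Delta_Phi a'D) ?(Delta_pos a'D).
have [k Ek] := real_nil_cf aSP vr.
have x0aa' : pr (a *m S) x0 = pr a' x0.
  rewrite (coef_exp aSP) pr_suml (bigD1_seq a') ?Delta_uniq //= c1 // eqxx scale1r.
  rewrite big1_seq ?addr0 // => b /andP [ba bD]; rewrite prZl.
  by have [bim|bn] := boolP (im b); [rewrite x0_im // mulr0 | rewrite c1 // (negbTE ba) mul0r].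
have vE : v = k%:C *: X (a *m S).
  apply/eqP; rewrite -subr_eq0; apply/eqP; apply: (string_cf0 a'D a'n).
    rewrite (brDr Hlie) (brNr Hlie) (brZr Hlie) string_br_x0 // brTX // x0aa' scalerBr !scalerA.
    by rewrite mulrC.
  move=> g gP; rewrite cfD cfN cfZ cf_X //; have [->|ga] := eqVneq g (a *m S).
    by rewrite Ek mulr1 subrr.
  by rewrite vsupp // mulr0 subrr.
exists a', m', k; split=> //.
- by apply: contraNneq nz' => k0; rewrite -/v vE k0 scale0r.
- by split; lra.
- by move=> b bD bn; rewrite c1 // c2.
Qed.

(* For a simple and not imaginary, the sign c a is read off e^N X_a' = k X_{aS}. As sigma
   exchanges e and f, and f^N e^N is a positive scalar on the lowest weight vector X_a, this
   makes sigma^2 X_a a positive multiple of X_a, hence X_a. *)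
Lemma adapted_involution : exists sg : V -> V,
  [/\ antilinear sg, forall u v, sg (br u v) = br (sg u) (sg v),
      forall x, sg (T x) = T (x *m S^T), forall v, sg (sg v) = v
    & forall v, sg (tau v) = tau (sg v)] /\
  [/\ forall g, g \in Phi -> exists r : R, sg (X g) = r%:C *: X (g *m S),
      sg e = f & sg f = e].
Proof.
have /choice [F HF] (a : E) : exists p : E * nat * R, a \in Delta -> ~~ im a ->
  [/\ p.1.1 \in Delta /\ ~~ im p.1.1, p.2 != 0,
      adn br p.1.2 e (X p.1.1) = p.2%:C *: X (a *m S),
      p.1.2%:R = - pr a h0 /\ p.1.2%:R = - pr p.1.1 h0
    & forall b, b \in Delta -> ~~ im b ->
        pr (a *m S) (om b) = (b == p.1.1)%:R /\ pr (p.1.1 *m S) (om b) = (b == a)%:R].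
  have [aD|aD] := boolP (a \in Delta); last by exists (0, 0%N, 0).
  have [aim|an] := boolP (im a); first by exists (0, 0%N, 0).
  by have [a' [N [k H]]] := string_end aD an; exists (a', N, k).
pose c a := if im a then -1 else Num.sg (F a).2.
have c2 a : a \in Delta -> c a * c a = 1.
  move=> aD; rewrite /c; case: (boolP (im a)) => an; first by rewrite mulrNN mulr1.
  by have [_ k0 _ _ _] := HF a aD an; rewrite -expr2 sqr_sg k0.
have [sg [sA sH sT sD sX]] := root_automorphism_lift Hlie xs_reg SS SP c2.
exists sg.
have tA := @tau_antilin _ _ _ D; have tH := @tau_br _ _ _ D.
(* Both sides are complex linear in [v], so the generators suffice; there it holds because [X a] and
   [X (- a)] carry the same real sign. *)
have st v : sg (tau v) = tau (sg v).
  move: v; apply: (generation Hlie xs_reg).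
  - split; first by rewrite (al0 tA) (al0 sA) (al0 tA).
    by move=> z u v Eu Ev; rewrite tA sA Eu Ev sA tA.
  - by move=> u v Eu Ev; rewrite tH sH Eu Ev sH tH.
  - by move=> x; rewrite tau_T (alN sA) sT tau_T.
  - by move=> a aD; have [E1 E2] := sD a aD; rewrite tau_X ?(Delta_Phi aD) // E1 E2 (alZr tA) tau_X // SP // (Delta_Phi aD).
  - move=> a aD; have aP := Delta_Phi aD; have [E1 E2] := sD a aD.
    by rewrite tau_X ?PhiN // opprK E1 E2 (alZr tA) tau_X ?PhiN ?SP // opprK.
(* Commuting with [tau] gives the same factor on [g] and [- g]; the bracket of the two vectors is a
   coroot, on which sigma has no factor, so its square is 1. *)
have sX2 g : g \in Phi -> exists2 r : R, r * r = 1 & sg (X g) = r%:C *: X (g *m S).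
  move=> gP; have [r Er] := sX g gP; exists r => //; have gSP := SP gP.
  have ErN : sg (X (- g)) = r%:C *: X (- (g *m S)).
    by rewrite -tau_X // st Er (alZr tA) tau_X.
  have := sH (X g) (X (- g)); rewrite brXN // Er ErN (brZl Hlie) (brZr Hlie) brXN // (alN sA) sT.
  rewrite -(CoS Hlie SS SP gP) scalerA -rmorphM => /eqP; rewrite eqr_oppLR scalerN opprK => /eqP E1.
  have T0n : T (Co (g *m S)) != 0.
    apply/negP => /eqP E0; have := brTX (Co (g *m S)) gSP; rewrite E0 (br0l Hlie) prCo2 //.
    by move/esym/eqP; rewrite scaler_eq0 (negbTE (X_neq0 gSP)) rC_eq0 pnatr_eq0.
  apply: rC_inj; apply/eqP; rewrite -subr_eq0; move/eqP: E1; rewrite eq_sym -subr_eq0 -{2}[T _]scale1r -scalerBl.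
  by rewrite scaler_eq0 (negbTE T0n) orbF.
have se : sg e = f.
  rewrite /e /f /prin_e /prin_f (al_sum sA) -sumrN big_seq_cond [RHS]big_seq_cond.
  apply: eq_bigr => b /andP [bD /eqP bim].
  by rewrite [LHS](alZr sA) (sD b bD).1 /c bim eqxx rmorphN scaleN1r scalerN.
have sf : sg f = e.
  rewrite /e /f /prin_e /prin_f (alN sA) (al_sum sA) -sumrN big_seq_cond [RHS]big_seq_cond.
  apply: eq_bigr => b /andP [bD /eqP bim].
  by rewrite [X in - X](alZr sA) (sD b bD).2 /c bim eqxx rmorphN scaleN1r scalerN !opprK.
split; last by split.
have ssX a : a \in Delta -> sg (sg (X a)) = X a.
  move=> aD; have aP := Delta_Phi aD; have aSP := SP aP; have [aim|an] := boolP (im a).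
    rewrite (sD a aD).1 (alZr sA) (eqP aim) (sD a aD).2 (eqP aim) opprK /c aim.
    by rewrite scalerA -rmorphM mulrNN mulr1 scale1r.
  have [[a'D a'n] k0 Ek [Na Na'] cab] := HF a aD an; set a' := (F a).1.1 in a'D a'n Ek Na' cab.
  have [_ k'0 Ek' [Na1 _] ca'] := HF a' a'D a'n.
  have Ea : (F a').1.1 = a.
    have := (ca' a aD an).1; rewrite (cab a aD an).2 eqxx => /esym/eqP.
    by rewrite pnatr_eq1 eqb1 => /eqP ->.
  have EN : (F a').1.2 = (F a).1.2 by apply/eqP; rewrite -(eqr_nat R) Na1 -Na'.
  rewrite Ea EN in Ek'; set N := (F a).1.2 in Ek Ek' Na; set k := (F a).2 in k0 Ek; set k' := (F a').2 in k'0 Ek'.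
  have kV : k%:C != 0 by rewrite rC_eq0.
  have k'V : k'%:C != 0 by rewrite rC_eq0.
  have ca_ : c a = Num.sg k by rewrite /c (negbTE an).
  have ca'_ : c a' = Num.sg k' by rewrite /c (negbTE a'n).
  have EX : X (a *m S) = k^-1%:C *: adn br N e (X a').
    by rewrite Ek scalerA -rmorphM mulVf // rmorph1 scale1r.
  have EX' : X (a' *m S) = k'^-1%:C *: adn br N e (X a).
    by rewrite Ek' scalerA -rmorphM mulVf // rmorph1 scale1r.
  have Ekr : br (T h0) (X a) = - N%:R *: X a.
    by rewrite brTX // -[pr a h0]opprK -Na rmorphN rmorph_nat.
  have [p p0 Ep] := sl2_down_up Hlie prin_ef prin_ke (prin_f_lowest aD an) Ekr (leqnn N).
  have Es : sg (sg (X a)) = (c a * k^-1 * c a' * k'^-1 * p)%:C *: X a.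
    rewrite (sD a aD).1 (alZr sA) EX (alZr sA) (al_adn _ _ _ sH) se (sD a' a'D).1 EX'.
    by rewrite !(adnZ Hlie) Ep !scalerA -!rmorphM !mulrA.
  (* A second evaluation of sigma^2 on [X a] gives the factor c a * r, of square 1. By the first
     evaluation it is positive, since [c a] and [c a'] are the signs of [k] and [k']; hence it is
     1. *)
  have [r r2 Er] := sX2 _ aSP.
  have Es2 : sg (sg (X a)) = (c a * r)%:C *: X a.
    by rewrite (sD a aD).1 (alZr sA) Er (mulmx_involK _ SS) scalerA -rmorphM.
  have crp : c a * r = c a * k^-1 * c a' * k'^-1 * p.
    apply: rC_inj; apply/eqP; rewrite -subr_eq0; move/eqP: Es2; rewrite Es eq_sym -subr_eq0 -scalerBl.
    by rewrite scaler_eq0 (negbTE (X_neq0 aP)) orbF.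
  have cr0 : 0 < c a * r.
    rewrite crp mulr_gt0 // ca_ ca'_ -mulrA mulr_gt0 //.
      by rewrite -sgr_gt0 sgrM sgrV sgr_id -expr2 sqr_sg k0 ltr01.
    by rewrite -sgr_gt0 sgrM sgrV sgr_id -expr2 sqr_sg k'0 ltr01.
  have cr1 : (c a * r) ^+ 2 = 1 by rewrite expr2 mulrACA c2 // r2 mulr1.
  rewrite Es2; have -> : c a * r = 1; last by rewrite scale1r.
  by move/eqP: cr1; rewrite -[X in _ == X](expr1n _ 2) eqrXn2 ?ltW ?ltr01 // => /eqP.
split=> //.
apply: (generation Hlie xs_reg) => //.
- split; first by rewrite !(al0 sA).
  by move=> z u v Eu Ev; rewrite !sA conjcK Eu Ev.
- by move=> u v Eu Ev; rewrite !sH Eu Ev.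
- by move=> x; rewrite !sT (mulmx_trinvolK _ SS).
- by move=> a aD; rewrite -(tau_X (Delta_Phi aD)) !st ssX.
Qed.

(** Since [x0] is positive on the simple roots that are not imaginary and zero at [g], only
    imaginary simple roots occur in [g]; its value at [h0] is then twice its height. *)
Lemma im_h0 g : g \in Phi -> pos g -> im g -> 0 < pr g h0.
Proof.
move=> gP pg gim; have x0g : pr g x0 = 0 by apply/eqP; rewrite x0P.
have c0 b : b \in Delta -> ~~ im b -> pr g (om b) = 0.
  move=> bD bn; move: x0g; rewrite {1}(coef_exp gP) pr_suml => /eqP.
  rewrite big_seq psumr_eq0 => [|k kD].
    move=> /allP /(_ b bD); rewrite bD prZl mulf_eq0 => /orP [/eqP //|].
    by rewrite (gt_eqF (posS_nonim (Delta_Phi bD) (Delta_pos bD) bn)).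
  by rewrite prZl mulr_ge0 ?coef_ge0 ?pos_x0 ?(Delta_Phi kD) ?(Delta_pos kD).
have Eh : pr g h0 = 2%:R * pr g rho.
  rewrite {1}(coef_exp gP) pr_suml pr_rho mulr_sumr [RHS]big_mkcond /=; apply: eq_big_seq => b bD.
  case: (boolP (im b)) => bn; first by rewrite prZl h0P // mulrC.
  by rewrite c0 // scale0r pr0l.
rewrite Eh pmulr_rgt0 ?ltr0n // lt_def pr_rho big_seq_cond sumr_ge0 ?andbT; last first.
  by move=> b /andP [bD _]; apply: coef_ge0.
apply/negP; rewrite psumr_eq0 => [/allP H|b /andP [bD _]]; last exact: coef_ge0.
case/negP: (Phi_neq0 gP); rewrite (coef_exp gP) big1_seq // => b /andP [_ bD].
have [bim|bn] := boolP (im b); last by rewrite c0 // scale0r.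
by have := H b bD; rewrite bD bim => /eqP ->; rewrite scale0r.
Qed.

(* psi is the Cayley transform of the principal sl2: it moves T h0 to the sigma-fixed e + f. *)
Lemma cayley : exists psi : V -> V,
  [/\ forall a u v, psi (a *: u + v) = a *: psi u + psi v,
      forall u v, psi (br u v) = br (psi u) (psi v),
      forall v, psi v = 0 -> v = 0 & forall v, exists u, psi u = v] /\
  psi (T x0) = T x0 /\ psi (T h0) = e + f.
Proof.
have [K1 H1] : exists K, forall v, adn br K (- 2%:R^-1 *: e) v = 0.
  by apply: (ad_nilp Hlie (x := h0)); rewrite (brZr Hlie) prin_ke !scalerA mulrC.
have [K2 H2] : exists K, forall v, adn br K f v = 0.
  by apply: (ad_nilp Hlie (x := - h0)); rewrite TN (brNl Hlie) prin_kf opprK.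
(* The factor - 1/2 sends h0 to h0 + e. Then exp (ad f) sends h0 to h0 + 2f and e to e - h0 - f,
   which add up to e + f. *)
exists (fun v => expad br f K2 (expad br (- 2%:R^-1 *: e) K1 v)).
split; first split.
- by move=> a u v; rewrite !(expad_lin Hlie).
- by move=> u v; rewrite (expad_br Hlie H1) (expad_br Hlie H2).
- by move=> v /(expad_eq0 Hlie H2) /(expad_eq0 Hlie H1).
- move=> v; have [u <-] := expad_surj Hlie H2 v; have [w <-] := expad_surj Hlie H1 u.
  by exists w.
have he : br e (T h0) = - (2%:R *: e) by rewrite (brC Hlie) prin_ke.
have hf : br f (T h0) = 2%:R *: f by rewrite (brC Hlie) prin_kf opprK.
have fe : br f e = - T h0 by rewrite (brC Hlie) prin_ef.
have two : (2%:R : R[i]) != 0 by rewrite pnatr_eq0.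
split.
  rewrite (expad_fix Hlie H1) ?(expad_fix Hlie H2) //.
    by rewrite (brC Hlie) br_x0_f oppr0.
  by rewrite (brZl Hlie) (brC Hlie) br_x0_e oppr0 scaler0.
have n1 : br (- 2%:R^-1 *: e) (T h0) = e.
  by rewrite (brZl Hlie) he scalerN scaleNr opprK scalerA mulVf // scale1r.
have n2 : br (- 2%:R^-1 *: e) e = 0 by rewrite (brZl Hlie) (brxx Hlie) scaler0.
rewrite (expad3 Hlie H1) n1 n2 ?(br0r Hlie) // scaler0 addr0 (expadD Hlie).
have m2 : br f (2%:R *: f) = 0 by rewrite (brZr Hlie) (brxx Hlie) scaler0.
rewrite (expad3 Hlie H2 (v := T h0)) hf m2 ?(br0r Hlie) // scaler0 addr0.
rewrite (expad3 Hlie H2 (v := e)) fe (brNr Hlie) hf ?(brNr Hlie) ?m2 ?oppr0 //.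
have -> : 2%:R^-1 *: - (2%:R *: f) = - f by rewrite [LHS]scalerN scalerA mulVf // scale1r.
rewrite scaler_nat mulr2n; move: (T h0) e f => p q r.
by rewrite addrC -!addrA; congr (_ + _); rewrite (addrCA (- r)) !addKr.
Qed.

(** A root is positive when its value at [x0] is positive, or when that value is 0 and its value at
    [h0] is positive. The standard Borel subalgebra is thus described by eigenvalues of T x0 and T
    h0, and sigma fixes the images of both under the Cayley transform. *)
Lemma quasisplit_involution : exists sg : V -> V,
  [/\ [/\ antilinear sg, forall u v, sg (br u v) = br (sg u) (sg v),
      forall x, sg (T x) = T (x *m S^T), forall v, sg (sg v) = v
    & forall v, sg (tau v) = tau (sg v)],
    forall g, g \in Phi -> exists r : R, sg (X g) = r%:C *: X (g *m S)
  & exists2 b : {vspace V}, borel br b & forall v, v \in b -> sg v \in b].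
Proof.
have [sg [[sA sH sT ss st] [sX se sf]]] := adapted_involution; exists sg; split=> //.
have [psi [[pL pB pI pS] [px0 ph0]]] := cayley.
have [b bB bP] := borel_image Hlie xs_reg pL pB pI pS; exists b => //.
have p0 : psi 0 = 0.
  by apply: (@addrI _ (psi 0)); have := pL 1 0 0; rewrite !scale1r !addr0 => <-.
have pZ a v : psi (a *: v) = a *: psi v by have := pL a v 0; rewrite p0 !addr0.
have pinj u v : psi u = psi v -> u = v.
  move=> E0; apply/eqP; rewrite -subr_eq0; apply/eqP/pI.
  by rewrite addrC -scaleN1r pL E0 scaleN1r addNr.
(* Transported through [psi], sigma keeps eigenvalues of T x: the antilinear map would conjugate
   them, but they are real. *)
have fixed x r u w : sg (psi (T x)) = psi (T x) -> br (T x) u = r%:C *: u ->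
    sg (psi u) = psi w -> br (T x) w = r%:C *: w.
  move=> sx Eu Ew; apply: pinj; rewrite pB -Ew -{1}sx -sH -pB Eu pZ (alZr sA).
  by rewrite pZ Ew.
have sx0 : sg (psi (T x0)) = psi (T x0) by rewrite px0 sT x0S.
have sh0 : sg (psi (T h0)) = psi (T h0) by rewrite ph0 (alD sA) se sf addrC.
have im_neq0 g : g \in Phi -> pr g x0 = 0 -> pr g h0 != 0.
  move=> gP /eqP; rewrite x0P // => gim; have [pg|ng] := boolP (pos g).
    by rewrite gt_eqF // im_h0.
  have := im_h0 (PhiN gP) (posN xs_reg gP ng); rewrite mulNmx eqr_opp gim => /(_ isT).
  by rewrite prNl oppr_gt0 => /lt_eqF ->.
move=> _ /bP [u Bu ->]; apply/bP.
suff [w Bw Ew] : exists2 w, bstd xs w & sg (psi u) = psi w by exists w.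
move: u Bu; apply: (bstd_ind (xs := xs)).
- split; first by exists 0; [case: (bstd_lin xs) | rewrite p0 (al0 sA)].
  move=> z u v [u' Bu Eu] [v' Bv Ev]; exists (conjc z *: u' + v').
    by case: (bstd_lin xs) => _; apply.
  by rewrite pL sA Eu Ev pL.
- move=> x; have [w /esym Ew] := pS (sg (psi (T x))); exists w => // g gP cg.
  have E0 z : br (T z) (T x) = (0 : R)%:C *: T x by rewrite brTT scale0r.
  have e1 := rC_inj (cf_eigen Hlie gP (fixed _ _ _ _ sx0 (E0 x0) Ew) cg).
  have e2 := rC_inj (cf_eigen Hlie gP (fixed _ _ _ _ sh0 (E0 h0) Ew) cg).
  by have := im_neq0 g gP (esym e1); rewrite -e2 eqxx.
- move=> a aP pa; have [w /esym Ew] := pS (sg (psi (X a))); exists w => // g gP cg.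
  have e1 := rC_inj (cf_eigen Hlie gP (fixed _ _ _ _ sx0 (brTX x0 aP) Ew) cg).
  have e2 := rC_inj (cf_eigen Hlie gP (fixed _ _ _ _ sh0 (brTX h0 aP) Ew) cg).
  have := pos_x0 aP pa; rewrite le_eqVlt => /predU1P [x0a|x0a].
    have aim : im a by rewrite -x0P // -x0a.
    have gim : im g by rewrite -x0P // -e1 -x0a.
    apply/negPn/negP => /(posN xs_reg gP) png; have := im_h0 (PhiN gP) png.
    rewrite mulNmx eqr_opp gim => /(_ isT); rewrite prNl -e2 oppr_gt0.
    by apply/negP; rewrite -leNgt ltW // im_h0.
  by apply: x0xs => //; rewrite -e1.
Qed.

End Principal.

Theorem quasisplit_lift (R : realType) (V : vectType R[i]) (br : V -> V -> V)
    (Hlie : lie_bracket br) (D : chevdata br) (S : 'M[R]_(cd_d D)) :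
  S *m S = 1%:M -> {in cd_Phi D, forall g, g *m S \in cd_Phi D} ->
  exists sg : V -> V,
  [/\ [/\ antilinear sg, forall u v, sg (br u v) = br (sg u) (sg v),
      forall x : 'rV_(cd_d D), sg (cd_T x) = cd_T (x *m S^T), forall v, sg (sg v) = v
    & forall v, sg (cd_tau D v) = cd_tau D (sg v)],
    forall g : 'rV_(cd_d D), g \in cd_Phi D -> exists r : R, sg (cd_X g) = r%:C *: cd_X (g *m S)
  & exists2 b : {vspace V}, borel br b & forall v, v \in b -> sg v \in b].
Proof.
move=> SS SP; have [x0 [xs [x0S x0P xs_reg x0xs]]] := adapted_positive_system SS.
have [y [y0 h0P]] := principal_coroot Hlie S xs_reg.
have [om omP] := coweights Hlie xs_reg.
exact: (quasisplit_involution Hlie SS SP x0S x0P xs_reg x0xs y0 h0P omP).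
Qed.

(** * Coordinates on the split real form *)

Lemma extract_free (F : fieldType) (V : vectType F) (s : seq V) :
  exists t : seq V, [/\ {subset t <= s}, free t & (<<t>> = <<s>>)%VS].
Proof.
elim: s => [|v s [t [ts ft Et]]]; first by exists [::]; split; rewrite ?nil_free.
have [vt|vt] := boolP (v \in <<t>>%VS).
  exists t; split=> // [u /ts us|]; first by rewrite inE us orbT.
  apply: subv_anti; rewrite {1}Et sub_span ?[X in _ && X]/=; last by move=> u us; rewrite inE us orbT.
  by rewrite span_cons subv_add -memvE vt Et subvv.
exists (v :: t); split; last by rewrite !span_cons Et.
- by move=> u; rewrite !inE => /predU1P [->|/ts ->]; rewrite ?eqxx ?orbT.
- by rewrite free_cons vt.
Qed.

Section Coordinates.
Variables (R : realType) (V : vectType R[i]) (br : V -> V -> V).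
Hypothesis Hlie : lie_bracket br.
Hypothesis Hss : semisimple br.
Variable h : {vspace V}.
Hypothesis Hh : cartan br h.
Variables X Hc : (V -> R[i]) -> V.
Hypothesis Hchev : chevalley br h X Hc.
Hypothesis HgR : real_form br (in_gR br h X).

Local Notation hR := (in_hR br h).
Local Notation gR := (in_gR br h X).
Local Notation root := (is_root br h).

Lemma root_X a : root a -> X a != 0 /\ rootsp br h a (X a).
Proof. by move=> /Hchev [[]]. Qed.

(** Roots are bare functions; their linearity on [h] comes from the nonzero eigenvector [X a]. *)
Lemma root_lin a z u v : root a -> u \in h -> v \in h -> a (z *: u + v) = z * a u + a v.
Proof.
move=> /root_X [X0 RX] uh vh; have := RX _ (memvD (memvZ z uh) vh).
rewrite (brDl Hlie) (brZl Hlie) !RX // scalerA -scalerDl => /eqP.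
by rewrite -subr_eq0 -scalerBl scaler_eq0 (negbTE X0) orbF subr_eq0 => /eqP.
Qed.

Lemma hR_h u : hR u -> u \in h. Proof. by case. Qed.

Lemma hR_lin (r : R) u v : hR u -> hR v -> hR (r%:C *: u + v).
Proof.
move=> [uh ur] [vh vr]; split; first by rewrite memvD // memvZ.
move=> a ra; have [x Ex] := ur a ra; have [y Ey] := vr a ra.
by exists (r * x + y); rewrite root_lin // Ex Ey rmorphD rmorphM.
Qed.
Lemma hR0 : hR 0.
Proof.
split; first exact: mem0v; move=> a ra; exists 0.
by have := root_lin 0 ra (mem0v h) (mem0v h); rewrite scale0r mul0r !add0r => ->;
   have := root_lin (-1) ra (mem0v h) (mem0v h); rewrite scaler0 addr0 mulN1r addNr.
Qed.
Lemma hRZ (r : R) u : hR u -> hR (r%:C *: u).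
Proof. by move=> Hu; rewrite -[_ *: _]addr0; apply: hR_lin => //; apply: hR0. Qed.

Lemma decomp v : exists H1 H2 (L : seq ((V -> R[i]) * R[i])),
  [/\ hR H1, hR H2, forall p, List.In p L -> root p.1
    & v = H1 + 'i *: H2 + \sum_(p <- L) p.2 *: X p.1].
Proof.
case: HgR => _ [_ /(_ v) [x [y [[H1 [s1 [h1 r1 ->]]] [H2 [s2 [h2 r2 ->]]] ->]]] _].
exists H1, H2, ([seq (p.1, p.2%:C) | p <- s1] ++ [seq (p.1, 'i * p.2%:C) | p <- s2]).
split=> //.
  move=> p Hp; case: (List.in_app_or _ _ _ Hp) => /List.in_map_iff [q [<-]]; first exact: r1.
  exact: r2.
rewrite big_cat !big_map /= scalerDr scaler_sumr addrACA; congr (_ + (_ + _)).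
by apply: eq_bigr => p _; rewrite scalerA.
Qed.

(** The root part [w] of [v] lies in [h]. A generic element of [h] acts nilpotently on [w], as [h]
    is nilpotent, but with nonzero eigenvalues on the root vectors composing it, so w = 0. *)
Lemma h_split v : v \in h -> exists H1 H2, [/\ hR H1, hR H2 & v = H1 + 'i *: H2].
Proof.
move=> vh; have [H1 [H2 [L [h1 h2 rL Ev]]]] := decomp v; exists H1, H2; split=> //.
pose w := \sum_(p <- L) p.2 *: X p.1.
have wh : w \in h.
  have -> : w = v - (H1 + 'i *: H2) by rewrite Ev addrC addKr.
  by rewrite memvB // memvD ?memvZ // hR_h.
have [H' Hh' Hn] : exists2 H', H' \in h & forall p, List.In p L -> p.1 H' != 0.
  have [P0 PL] := vspace_lin_closed h; apply: (generic_vector P0 PL).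
  - by move=> p z u u' /rL rp uh u'h; apply: root_lin.
  - by move=> p /rL [[H0 hH0 nz] _]; exists H0.
have w0 : w = 0.
  case: Hh => _ [n Hn0] _.
  apply: (@eigensum_nilp _ V (br H') _ _ L (fun p => p.2 *: X p.1) (fun p => p.1 H') n) => //.
  - by move=> z u u'; rewrite (brDr Hlie) (brZr Hlie).
  - by move=> p /rL /root_X [_ rp]; rewrite (brZr Hlie) rp // !scalerA mulrC.
  - apply/eqP; rewrite -/w -memv0 -Hn0; elim: (n) => [|k IH] //=.
    exact: (mem_brs Hlie).
by rewrite Ev -/w w0 addr0.
Qed.

(** [h, h] is an ideal of the whole algebra, because roots vanish on it and so root vectors kill it.
    It is solvable since [h] is nilpotent, hence zero by semisimplicity. *)
Lemma h_abelian u v : u \in h -> v \in h -> br u v = 0.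
Proof.
move=> uh vh; have [sh [n Hn] _] := Hh.
have hB x y : x \in h -> y \in h -> br x y \in h.
  by move=> xh yh; apply: (subvP sh); apply: (mem_brs Hlie).
suff A0 : brs br h h = 0%VS.
  by apply/eqP; rewrite -memv0 -A0; apply: (mem_brs Hlie).
apply: Hss.
- apply: brs_sub => a b _ bA; move: b bA; apply: brs_ind.
    split=> [|z x y xA yA]; first by rewrite (br0r Hlie) mem0v.
    by rewrite (brDr Hlie) (brZr Hlie) memvD // memvZ.
  move=> x y xh yh; have [H1 [H2 [L [h1 h2 rL ->]]]] := decomp a.
  have Ah w : w \in h -> br w (br x y) \in brs br h h by move=> wh; apply: (mem_brs Hlie) => //; apply: hB.
  rewrite !(brDl Hlie) (brZl Hlie) (br_suml Hlie) memvD ?memvD ?memvZ ?Ah ?hR_h //.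
  elim: L rL => [|p L IH] rL; first by rewrite big_nil mem0v.
  rewrite big_cons memvD ?IH // => [|q qL]; last by apply: rL; right.
  have [_ rp] := root_X (rL p (or_introl erefl)).
  rewrite (brZl Hlie) (brC Hlie) (_ : br (br x y) (X p.1) = 0) ?oppr0 ?scaler0 ?mem0v //.
  have := br_der Hlie x y (X p.1); rewrite !rp // ?hB // !(brZr Hlie) !rp // !scalerA mulrC.
  by move/eqP; rewrite -subr_eq addrN eq_sym => /eqP.
- exists n; apply/eqP; rewrite -subv0.
  have H k : (derived br (brs br h h) k <= lcs br h k.+1)%VS /\ (derived br (brs br h h) k <= h)%VS.
    elim: k => [|k [H1 H2]]; first by split=> //=; apply: brs_sub.
    split; apply: brs_sub => a b aD bD; last by apply: hB; apply: (subvP H2).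
    by apply: (mem_brs Hlie); [apply: (subvP H2) | apply: (subvP H1)].
  apply: subv_trans (H n).1 _ => /=; apply: brs_sub => a b ah.
  by rewrite Hn memv0 => /eqP ->; rewrite (br0r Hlie) mem0v.
Qed.

(** Such a [z] is central, and its line would be a solvable ideal. *)
Lemma h_center z : z \in h -> (forall a, root a -> a z = 0) -> z = 0.
Proof.
move=> zh az; have bz v : br v z = 0.
  have [H1 [H2 [L [h1 h2 rL ->]]]] := decomp v.
  have hz H : hR H -> br H z = 0 by move=> [hH _]; apply: h_abelian.
  rewrite !(brDl Hlie) (brZl Hlie) (hz H1) // (hz H2) // scaler0 !add0r (br_suml Hlie).
  elim: L rL => [|p L IH] rL; first by rewrite big_nil.
  rewrite big_cons IH ?addr0 => [|q qL]; last by apply: rL; right.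
  have rp := rL p (or_introl erefl); have [_ Xp] := root_X rp.
  by rewrite (brZl Hlie) (brC Hlie) Xp // az // scale0r oppr0 scaler0.
have : <[z]>%VS = 0%VS; last by move=> E0; apply/eqP; rewrite -memv0 -E0 memv_line.
apply: Hss; last exists 1%N.
  by apply: brs_sub => a b _ /vlineP [c ->]; rewrite (brZr Hlie) bz scaler0 mem0v.
apply/eqP; rewrite -subv0; apply: brs_sub => a b _ /vlineP [c ->].
by rewrite (brZr Hlie) bz scaler0 mem0v.
Qed.

Lemma hR_basis : exists t : seq V,
  [/\ forall v, v \in t -> hR v, free t & (<<t>> = h)%VS].
Proof.
have [s [sR sh]] : exists s : seq V, (forall v, v \in s -> hR v) /\
    forall v, v \in (vbasis h : seq V) -> v \in <<s>>%VS.
  have : forall v, v \in (vbasis h : seq V) -> v \in h by move=> v; apply: vbasis_mem.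
  elim: (vbasis h : seq V) => [|v s IH] Hv; first by exists [::].
  have [|s' [sR ss]] := IH; first by move=> u us; apply: Hv; rewrite inE us orbT.
  have [H1 [H2 [h1 h2 Ev]]] := h_split (Hv v (mem_head _ _)).
  exists [:: H1, H2 & s']; split.
    by move=> u; rewrite !inE => /or3P [/eqP ->|/eqP ->|/sR].
  move=> u; rewrite inE => /predU1P [->|/ss us].
    by rewrite Ev memvD ?memvZ ?memv_span // !inE eqxx ?orbT.
  by move: us; apply/subvP; apply: sub_span => w ws; rewrite !inE ws !orbT.
have [t [ts ft Et]] := extract_free s; exists t; split=> //; first by move=> v /ts /sR.
rewrite Et; apply: subv_anti; apply/andP; split.
  by apply/span_subvP => v /sR [].
by rewrite -(span_basis (vbasisP h)); apply/span_subvP.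
Qed.

Variable t : seq V.
Hypothesis tR : forall v, v \in t -> hR v.
Hypothesis tf : free t.
Hypothesis th : (<<t>> = h)%VS.
Local Notation d := (size t).
Local Notation E := 'rV[R]_d.

Definition hT (x : E) : V := \sum_(j < d) (x 0 j)%:C *: t`_j.
Definition fn (a : E) (v : V) : R[i] := \sum_(j < d) (a 0 j)%:C * coord (in_tuple t) j v.
(** Taking the real part loses nothing for functionals in the dual of h_R. Together with [fn] it
    picks one representative among the functions that agree on [h]. *)
Definition rv (l : V -> R[i]) : E := \row_j complex.Re (l t`_j).

Lemma t_hR (j : 'I_d) : hR t`_j. Proof. by apply: tR; apply: mem_nth. Qed.

Lemma hT_lin r x y : hT (r *: x + y) = r%:C *: hT x + hT y.
Proof.
rewrite /hT scaler_sumr -big_split; apply: eq_bigr => j _.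
by rewrite !mxE rmorphD rmorphM scalerDl scalerA.
Qed.

Lemma hT_hR x : hR (hT x).
Proof.
rewrite /hT; elim/big_ind: _ => [|u v hu hv|j _]; first exact: hR0.
  by rewrite -[u]scale1r; apply: hR_lin.
by apply: hRZ; apply: t_hR.
Qed.

Lemma coord_hT x j : coord (in_tuple t) j (hT x) = (x 0 j)%:C.
Proof.
rewrite /hT linear_sum /= (bigD1 j) //= big1 => [|k kj].
  by rewrite linearZ /= (coord_free _ _ (X := in_tuple t)) // eqxx mulr1 addr0.
by rewrite linearZ /= (coord_free _ _ (X := in_tuple t)) // (negbTE kj) mulr0.
Qed.

Lemma h_coord v : v \in h -> v = hT (\row_j complex.Re (coord (in_tuple t) j v)) +
  'i *: hT (\row_j complex.Im (coord (in_tuple t) j v)).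
Proof.
rewrite -th => vt; rewrite {1}(@coord_span _ _ _ (in_tuple t) v vt) /hT scaler_sumr -big_split; apply: eq_bigr => j _ /=.
rewrite !mxE scalerA -scalerDl; congr (_ *: _).
case: (coord _ _ _) => x y; apply/eqP; rewrite eq_complex /=.
by apply/andP; split; apply/eqP; ring.
Qed.

Lemma fn_hT a x : fn a (hT x) = (pr a x)%:C.
Proof.
rewrite /fn /pr mxE rmorph_sum; apply: eq_bigr => j _.
by rewrite coord_hT -rmorphM mxE.
Qed.

Lemma fn_lin a z u v : fn a (z *: u + v) = z * fn a u + fn a v.
Proof.
rewrite /fn mulr_sumr -big_split; apply: eq_bigr => j _.
by rewrite linearP /= mulrDr mulrCA.
Qed.

Lemma rv_fn a : rv (fn a) = a.
Proof.
apply/rowP => j; rewrite mxE.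
have -> : t`_j = hT (delta_mx 0 j).
  rewrite /hT (bigD1 j) //= mxE !eqxx scale1r big1 ?addr0 // => k kj.
  by rewrite mxE (negbTE kj) andbF scale0r.
rewrite fn_hT /pr mxE /= (bigD1 j) //= !mxE !eqxx mulr1 big1 ?addr0 // => k kj.
by rewrite !mxE (negbTE kj) andbF mulr0.
Qed.

Lemma dual_hT l x : hRdual br h l -> l (hT x) = (pr (rv l) x)%:C.
Proof.
move=> [lr ll].
have l0 : l 0 = 0.
  by have := ll (-1) 0 0 hR0 hR0; rewrite scaler0 addr0 rmorphN rmorph1 mulN1r addNr.
have -> : l (hT x) = \sum_(j < d) (x 0 j)%:C * l t`_j.
  rewrite /hT; suff H (s : seq 'I_d) : l (\sum_(j <- s) (x 0 j)%:C *: t`_j) =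
      \sum_(j <- s) (x 0 j)%:C * l t`_j by apply: H.
  elim: s => [|j s IH]; first by rewrite !big_nil.
  rewrite !big_cons ll ?IH //; first exact: t_hR.
  elim/big_ind: _ => [|u v hu hv|k _]; first exact: hR0.
    by rewrite -[u]scale1r; apply: hR_lin.
  by apply: hRZ; apply: t_hR.
rewrite /pr mxE rmorph_sum; apply: eq_bigr => j _; rewrite !mxE rmorphM mulrC; congr (_ * _).
by have [r ->] := lr _ (t_hR j).
Qed.

Lemma root_dual a : root a -> hRdual br h a.
Proof.
move=> ra; split=> [H [_ /(_ a ra)] //|r H K /hR_h hH /hR_h hK].
exact: root_lin.
Qed.

Lemma root_fn a u : root a -> u \in h -> a u = fn (rv a) u.
Proof.
move=> ra uh; rewrite (h_coord uh); set x := \row_j _; set y := \row_j _.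
have E1 : hT x + 'i *: hT y = 'i *: hT y + hT x by rewrite addrC.
rewrite E1 root_lin ?hR_h //; try exact: hT_hR.
by rewrite fn_lin !fn_hT !dual_hT //; apply: root_dual.
Qed.

Lemma root_ext a b : root a -> (forall u, u \in h -> a u = b u) -> root b.
Proof.
move=> [[H hH nz] [x x0 rx]] ab; split; first by exists H; rewrite -?ab.
by exists x => // u uh; rewrite -ab // rx.
Qed.

Lemma root_rv a : root a -> root (fn (rv a)).
Proof. by move=> ra; apply: (root_ext ra) => u uh; apply: root_fn. Qed.

Lemma X_rv a : root a -> X (fn (rv a)) = X a.
Proof.
move=> ra; have [_ [_ [_ H]]] := Hchev ra.
by have [] := H _ (root_rv ra) (fun u uh => root_fn ra uh).
Qed.

Local Notation Xe a := (X (fn a)).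

Definition spanned (Phi : seq E) v := exists x y (c : E -> R[i]),
  v = hT x + 'i *: hT y + \sum_(a <- Phi) c a *: Xe a.

Lemma hT0 : hT 0 = 0.
Proof. by rewrite /hT big1 // => j _; rewrite mxE scale0r. Qed.

Lemma hTZ r x : hT (r *: x) = r%:C *: hT x.
Proof. by have := hT_lin r x 0; rewrite hT0 !addr0. Qed.
Lemma hTD x y : hT (x + y) = hT x + hT y.
Proof. by have := hT_lin 1 x y; rewrite !scale1r. Qed.

Lemma hTZc (z : R[i]) x y : z *: (hT x + 'i *: hT y) =
  hT (complex.Re z *: x - complex.Im z *: y) + 'i *: hT (complex.Im z *: x + complex.Re z *: y).
Proof.
rewrite -scaleNr !hTD !hTZ !scalerDr !scalerA addrACA -!scalerDl.
congr (_ *: _ + _ *: _); case: z => p q; apply/eqP; rewrite eq_complex /=;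
  by apply/andP; split; apply/eqP; ring.
Qed.

Lemma spanned_lin Phi : lin_closed (spanned Phi).
Proof.
split.
  exists 0, 0, (fun _ => 0); rewrite hT0 scaler0 !add0r big1 // => a _; exact: scale0r.
move=> z u v [x1 [y1 [c1 ->]]] [x2 [y2 [c2 ->]]].
exists (complex.Re z *: x1 - complex.Im z *: y1 + x2), (complex.Im z *: x1 + complex.Re z *: y1 + y2).
exists (fun a => z * c1 a + c2 a).
rewrite scalerDr hTZc; move: (_ - _) (_ *: _ + _ *: _) => p q.
rewrite (hTD p) (hTD q) scalerDr addrACA; congr (_ + _); first by rewrite addrACA.
by rewrite scaler_sumr -big_split; apply: eq_bigr => a _; rewrite scalerDl scalerA.
Qed.

Lemma spanned_hR Phi H : hR H -> spanned Phi H.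
Proof.
move=> [hH _]; rewrite (h_coord hH); eexists _, _, (fun _ => 0).
by rewrite big1 ?addr0 // => a _; apply: scale0r.
Qed.

Lemma spanned_X (Phi : seq E) a : uniq Phi -> a \in Phi -> spanned Phi (Xe a).
Proof.
move=> uP aP; exists 0, 0, (fun b => (b == a)%:R); rewrite hT0 scaler0 !add0r.
rewrite (bigD1_seq a) //= eqxx scale1r big1 ?addr0 // => b /negbTE ->; exact: scale0r.
Qed.

Lemma spanned_sub (Phi Psi : seq E) v : uniq Psi -> {subset Phi <= Psi} -> spanned Phi v -> spanned Psi v.
Proof.
move=> uP sP [x [y [c ->]]]; have L := spanned_lin Psi.
apply: (lcD L); first by apply: (lcD L); rewrite ?(lcZ _ L) //; [|apply: (lcZ _ L)]; apply: spanned_hR; apply: hT_hR.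
by apply: (lc_sum L) => a /sP aP; apply: (lcZ _ L); apply: spanned_X.
Qed.

(** Collects the roots occurring in decompositions of a basis; that no root is missing is shown
    afterwards in [root_in_Phi]. *)
Lemma finite_roots : exists Phi : seq E,
  [/\ uniq Phi, forall a, a \in Phi -> root (fn a) & forall v, spanned Phi v].
Proof.
have H (s : seq V) : exists Phi : seq E,
    [/\ uniq Phi, forall a, a \in Phi -> root (fn a) & forall v, v \in s -> spanned Phi v].
  elim: s => [|v s [Phi [uP rP sP]]]; first by exists [::].
  have [H1 [H2 [L [h1 h2 rL Ev]]]] := decomp v.
  pose Psi := undup (Phi ++ [seq rv p.1 | p <- L]); exists Psi.
  have uPsi : uniq Psi by apply: undup_uniq.
  have LPsi p : List.In p L -> rv p.1 \in Psi.
    move=> pL; rewrite mem_undup mem_cat orbC.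
    have -> // : rv p.1 \in [seq rv p.1 | p <- L].
    elim: (L) pL => //= q l IH [->|/IH pl]; by rewrite inE ?eqxx ?pl ?orbT.
  split=> // [a|u].
    rewrite mem_undup mem_cat => /orP [/rP //|aL].
    have [p pL ->] : exists2 p, List.In p L & a = rv p.1.
      elim: (L) aL => //= q l IH; rewrite inE => /predU1P [->|/IH [p pl ->]]; first by exists q; [left|].
      by exists p; [right|].
    by apply: root_rv; apply: rL.
  rewrite inE => /predU1P [->|/sP]; last first.
    by apply: spanned_sub => // a aP; rewrite mem_undup mem_cat aP.
  rewrite Ev; have LS := spanned_lin Psi.
  apply: (lcD LS); first by apply: (lcD LS); [|apply: (lcZ _ LS)]; apply: spanned_hR.
  elim: (L) rL LPsi => [|p l IH] rL LPsi; first by rewrite big_nil; case: LS.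
  rewrite big_cons; apply: (lcD LS).
    rewrite -(X_rv (rL p (or_introl erefl))); apply: (lcZ _ LS); apply: spanned_X => //.
    by apply: LPsi; left.
  by apply: IH => q ql; [apply: rL; right | apply: LPsi; right].
have [Phi [uP rP sP]] := H (vbasis {:V}); exists Phi; split=> // v.
rewrite (coord_vbasis (memvf v)); elim/big_ind: _ => [|u w|i _].
- by case: (spanned_lin Phi).
- exact: (lcD (spanned_lin Phi)).
- by apply: (lcZ _ (spanned_lin Phi)); apply: sP; apply: mem_nth; rewrite size_tuple.
Qed.

Variable Phi : seq E.
Hypothesis uP : uniq Phi.
Hypothesis rP : forall a, a \in Phi -> root (fn a).
Hypothesis sP : forall v, spanned Phi v.

Lemma fn_neq0 a : root (fn a) -> a != 0.
Proof.
move=> [[H _ nz] _]; apply: contraNneq nz => ->.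
by rewrite /fn big1 // => j _; rewrite mxE mul0r.
Qed.

Lemma br_hT_X x a : root a -> br (hT x) (X a) = (pr (rv a) x)%:C *: X a.
Proof.
move=> ra; have [_ rX] := root_X ra; rewrite rX ?hR_h //; last exact: hT_hR.
by rewrite dual_hT //; apply: root_dual.
Qed.
Lemma br_hT_hT x y : br (hT x) (hT y) = 0.
Proof. by apply: h_abelian; apply: hR_h; apply: hT_hR. Qed.

(** Choose [z] where [a] differs from 0 and from every listed root. Then ad z - a(z) kills [X a] but
    has nonzero eigenvalues on all the components of a decomposition of [X a], which would have to
    be zero. *)
Lemma root_in_Phi a : root a -> rv a \in Phi.
Proof.
move=> ra; apply/negPn/negP => aN; have rva := root_rv ra.
have [z Hz] := separating [:: rv a, 0 & Phi].
have aval b : b \in 0 :: Phi -> pr b z != pr (rv a) z.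
  move=> bP; apply/eqP => /Hz E0; have := bP.
  rewrite E0 ?mem_head ?inE ?(negbTE aN) ?(negbTE (fn_neq0 rva)) //.
  by move: bP; rewrite inE => ->; rewrite orbT.
have [x [y [c Ea]]] := sP (X a).
pose U v := br (hT z) v - (pr (rv a) z)%:C *: v.
pose L : seq (V * R[i]) := (hT x + 'i *: hT y, - (pr (rv a) z)%:C) ::
  [seq (c b *: Xe b, (pr b z - pr (rv a) z)%:C) | b <- Phi].
have EL : X a = \sum_(p <- L) p.1 by rewrite big_cons big_map.
have [X0 _] := root_X ra; case/negP: X0; rewrite EL; apply/eqP.
apply: (@eigensum_nilp _ V U _ _ L (fun p => p.1) (fun p => p.2) 1).
- move=> w u v; rewrite /U (brDr Hlie) (brZr Hlie) scalerBr !scalerDr !scalerA opprD addrACA.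
  by rewrite (mulrC w).
- move=> p [<-|/List.in_map_iff [b [<- /mem_InP bP]]] /=.
    by rewrite /U (brDr Hlie) (brZr Hlie) !br_hT_hT scaler0 addr0 add0r scaleNr.
  rewrite /U (brZr Hlie) (br_hT_X z (rP bP)) rv_fn rmorphB scalerBl; congr (_ - _).
  by rewrite !scalerA mulrC.
- move=> p [<-|/List.in_map_iff [b [<- /mem_InP bP]]] /=.
    rewrite oppr_eq0 rC_eq0 eq_sym.
    by have := aval 0 (mem_head _ _); rewrite pr0l.
  by rewrite rC_eq0 subr_eq0 aval // inE bP orbT.
by rewrite -EL /= /U br_hT_X // subrr.
Qed.

Lemma coef_unique x y (c : E -> R[i]) :
  hT x + 'i *: hT y + \sum_(a <- Phi) c a *: Xe a = 0 -> forall a, a \in Phi -> c a = 0.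
Proof.
move=> E0 a aP; have [z Hz] := separating (0 :: Phi).
pose F b := if b == 0 then hT x + 'i *: hT y else c b *: Xe b.
have Phi0 b : b \in Phi -> (b == 0) = false by move=> /rP /fn_neq0 /negbTE.
have EF : \sum_(b <- 0 :: Phi) F b = 0.
  rewrite big_cons {1}/F eqxx -[RHS]E0; congr (_ + _); apply: eq_big_seq => b bP.
  by rewrite /F Phi0.
have := @eigensum_closed _ V (br (hT z)) _ _ (0 :: Phi) F (fun b => (pr b z)%:C) (fun v => v = 0).
move=> /(_ _ erefl _ _ _ _ _ EF a); rewrite inE aP orbT => H.
have [X0 _] := root_X (rP aP); apply/eqP.
have : F a == 0; last by rewrite /F Phi0 // scaler_eq0 (negbTE X0) orbF.
apply/eqP; apply: H => //.
- by move=> w u v; rewrite (brDr Hlie) (brZr Hlie).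
- by move=> w u v -> ->; rewrite scaler0 addr0.
- by move=> u ->; rewrite (br0r Hlie).
- by rewrite /= uP andbT; apply/negP => /Phi0; rewrite eqxx.
- by move=> b1 b2 b1P b2P /rC_inj; apply: Hz.
- move=> b; rewrite inE /F => /predU1P [->|bP].
    by rewrite eqxx (brDr Hlie) (brZr Hlie) !br_hT_hT pr0l scale0r scaler0 addr0.
  by rewrite Phi0 // (brZr Hlie) (br_hT_X z (rP bP)) rv_fn !scalerA mulrC.
Qed.

Lemma coefficients : exists cf : E -> V -> R[i],
  [/\ forall a z u v, cf a (z *: u + v) = z * cf a u + cf a v,
      forall a x, cf a (hT x) = 0,
      forall a b, a \in Phi -> b \in Phi -> cf a (Xe b) = (a == b)%:R
    & forall v, exists x y, v = hT x + 'i *: hT y + \sum_(a <- Phi) cf a v *: Xe a].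
Proof.
have /choice [F HF] (v : V) : exists p : E * E * (E -> R[i]),
    v = hT p.1.1 + 'i *: hT p.1.2 + \sum_(a <- Phi) p.2 a *: Xe a.
  by have [x [y [c Ev]]] := sP v; exists (x, y, c).
pose cf a v := if a \in Phi then (F v).2 a else 0.
have uniqc v x y (c : E -> R[i]) : v = hT x + 'i *: hT y + \sum_(a <- Phi) c a *: Xe a ->
    forall a, a \in Phi -> cf a v = c a.
  move=> Ev a aP; rewrite /cf aP; apply/eqP; rewrite -subr_eq0; apply/eqP.
  apply: (@coef_unique ((F v).1.1 - x) ((F v).1.2 - y) (fun b => (F v).2 b - c b)) => //.
  have hTB p q : hT (p - q) = hT p - hT q.
    by rewrite addrC -scaleN1r hT_lin rmorphN rmorph1 scaleN1r addrC.
  under eq_bigr do rewrite scalerBl.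
  rewrite !hTB sumrB scalerBr [X in X + _]addrACA -opprD addrACA -opprD -HF {1}Ev.
  by rewrite subrr.
have FE v : v = hT (F v).1.1 + 'i *: hT (F v).1.2 + \sum_(a <- Phi) cf a v *: Xe a.
  by rewrite {1}(HF v); congr (_ + _); apply: eq_big_seq => a aP; rewrite /cf aP.
exists cf; split.
- move=> a z u v; have [aP|aN] := boolP (a \in Phi); last by rewrite /cf (negbTE aN) mulr0 addr0.
  have [x [y Exy]] : exists x y, z *: (hT (F u).1.1 + 'i *: hT (F u).1.2) +
      (hT (F v).1.1 + 'i *: hT (F v).1.2) = hT x + 'i *: hT y.
    by rewrite hTZc addrACA -scalerDr -!hTD; eexists _, _.
  apply: (uniqc (z *: u + v) x y (fun a => z * cf a u + cf a v)) => //.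
  rewrite {1}(FE u) {1}(FE v) scalerDr addrACA Exy; congr (_ + _).
  by rewrite scaler_sumr -big_split; apply: eq_bigr => b _; rewrite scalerDl scalerA.
- move=> a x; have [aP|aN] := boolP (a \in Phi); last by rewrite /cf (negbTE aN).
  apply: (uniqc _ x 0 (fun _ => 0)) => //; rewrite hT0 scaler0 addr0 big1 ?addr0 // => b _.
  exact: scale0r.
- move=> a b aP bP; apply: (uniqc _ 0 0 (fun a => (a == b)%:R)) => //.
  rewrite hT0 scaler0 !add0r (bigD1_seq b) //= eqxx scale1r big1 ?addr0 // => k /negbTE ->.
  exact: scale0r.
- by move=> v; exists (F v).1.1, (F v).1.2.
Qed.

(** The imaginary part of the coordinates gives an element on which all roots vanish, hence 0. So
    the chosen complex basis of [h] is also a real basis of h_R. *)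
Lemma hR_hT H : hR H -> exists x, H = hT x.
Proof.
move=> [hH rH]; rewrite (h_coord hH); set x := \row_j _; set y := \row_j _.
have y0 : hT y = 0.
  apply: h_center; first by apply: hR_h; apply: hT_hR.
  move=> a ra; have [r] := rH a ra; rewrite (h_coord hH) -/x -/y addrC root_lin //;
    try by apply: hR_h; apply: hT_hR.
  rewrite !dual_hT //; try exact: root_dual.
  by move=> /eqP; rewrite eq_complex /= => /andP [_]; rewrite mul0r mul1r add0r addr0 => /eqP ->.
by exists x; rewrite y0 scaler0 addr0.
Qed.

Lemma hT_inj x y : hT x = hT y -> x = y.
Proof. by move=> E0; apply/rowP => j; apply: (@rC_inj R); rewrite -!coord_hT E0. Qed.

Lemma gR_X a : root a -> gR (X a).
Proof.
move=> ra; exists 0, [:: (a, 1)]; split; first exact: hR0.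
  by move=> p [<-|[]].
by rewrite big_cons big_nil scale1r addr0 add0r.
Qed.
Lemma gR_hR H : hR H -> gR H.
Proof. by move=> hH; exists H, [::]; split=> //; rewrite big_nil addr0. Qed.

Variable tau : V -> V.
Hypothesis Htau : inv_aut br gR tau.
Hypothesis HtauH : forall H, hR H -> tau H = - H.
Hypothesis HtauX : forall a, root a -> tau (X a) = X (negf a).

(** [tau] is assumed multiplicative on g_R only; antilinearity extends this to its
    complexification. *)
Lemma tau_hom u v : tau (br u v) = br (tau u) (tau v).
Proof.
case: Htau => tA _ tB _; case: HgR => [[_ _ _] [gB gD _]].
have [x [y [gx gy ->]]] := gD u; have [x' [y' [gx' gy' ->]]] := gD v.
rewrite !(brDl Hlie) !(brDr Hlie) !(brZl Hlie) !(brZr Hlie) !(alD tA) !(alZ tA).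
by rewrite !(brDl Hlie) !(brDr Hlie) !(brZl Hlie) !(brZr Hlie) !tB // !(alZ tA) !tB.
Qed.

(** X (negf a) is nonzero, as otherwise [Hc a] would vanish and could not act by 2 on [X a]. It is a
    weight vector because [tau] negates h_R, on which [a] is real. *)
Lemma root_negf a : root a -> root (negf a).
Proof.
move=> ra; case: Htau => tA _ _ _; have [X0 rX] := root_X ra.
have [[_ _ hHc] [[bX bH _] _]] := Hchev ra; split.
  by case: ra => -[H hH nz] _; exists H => //; rewrite /negf oppr_eq0.
exists (X (negf a)).
  apply/eqP => E0; move: bX; rewrite E0 (br0r Hlie) => /eqP; rewrite eq_sym oppr_eq0 => /eqP Hc0.
  move: bH; rewrite Hc0 (br0l Hlie) => /esym/eqP; rewrite scaler_eq0 (negbTE X0) pnatr_eq0.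
  by [].
have key H : hR H -> br H (X (negf a)) = - a H *: X (negf a).
  move=> hH; have [r Er] := hH.2 a ra.
  have EH : H = - tau H by rewrite HtauH // opprK.
  by rewrite -HtauX // {1}EH (brNl Hlie) -tau_hom rX ?hR_h // Er (alZr tA) scaleNr.
move=> H hH; have [H1 [H2 [h1 h2 ->]]] := h_split hH.
rewrite (brDl Hlie) (brZl Hlie) !key // scalerA -scalerDl; congr (_ *: _).
by rewrite /negf addrC [H1 + _]addrC root_lin ?hR_h // opprD mulrN.
Qed.

Lemma fnN a u : fn (- a) u = negf (fn a) u.
Proof. by rewrite /fn /negf -sumrN; apply: eq_bigr => j _; rewrite mxE rmorphN mulNr. Qed.

Lemma coordinate_lift (S : 'M[R]_d) : S *m S = 1%:M -> {in Phi, forall g, g *m S \in Phi} ->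
  exists sg : V -> V,
  [/\ [/\ antilinear sg, forall u v, sg (br u v) = br (sg u) (sg v),
      forall x, sg (hT x) = hT (x *m S^T), forall v, sg (sg v) = v
    & forall v, sg (tau v) = tau (sg v)],
    forall g, g \in Phi -> exists r : R, sg (Xe g) = r%:C *: Xe (g *m S)
  & exists2 b : {vspace V}, borel br b & forall v, v \in b -> sg v \in b].
Proof.
have [cf [cL cT cX cD]] := coefficients.
have /choice [Co CoE] (a : E) : exists x, a \in Phi -> hT x = Hc (fn a).
  have [aP|aN] := boolP (a \in Phi); last by exists 0.
  by have [[_ _ /hR_hT [x ->]] _] := Hchev (rP aP); exists x.
have Phi0' : 0 \notin Phi by apply/negP => /rP /fn_neq0; rewrite eqxx.
have PhiN' a : a \in Phi -> - a \in Phi.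
  move=> aP; have ra := root_negf (rP aP); have := root_in_Phi ra.
  have -> : rv (negf (fn a)) = - a; last by [].
  rewrite -[RHS]rv_fn; apply/rowP => j; rewrite !mxE fnN.
  by [].
have XN a : a \in Phi -> Xe (- a) = X (negf (fn a)).
  move=> aP; have ra := rP (PhiN' a aP); have [_ [_ [_ H]]] := Hchev ra.
  by have [] := H _ (root_negf (rP aP)) (fun u _ => fnN a u).
have brTX' x a : a \in Phi -> br (hT x) (Xe a) = (pr a x)%:C *: Xe a.
  by move=> aP; rewrite (br_hT_X x (rP aP)) rv_fn.
have nondeg x : (forall a, a \in Phi -> pr a x = 0) -> x = 0.
  move=> H; apply: hT_inj; rewrite hT0; apply: h_center; first by apply: hR_h; apply: hT_hR.
  by move=> a ra; rewrite dual_hT ?H ?root_in_Phi //; apply: root_dual.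
have brXN' a : a \in Phi -> br (Xe a) (Xe (- a)) = - hT (Co a).
  by move=> aP; have [_ [[H _ _] _]] := Hchev (rP aP); rewrite XN // H CoE.
have prCo2' a : a \in Phi -> pr a (Co a) = 2%:R.
  move=> aP; have [[X0 _ _] [[_ H _] _]] := Hchev (rP aP).
  move: H; rewrite -CoE // brTX' // => /eqP; rewrite -subr_eq0 -scalerBl scaler_eq0 (negbTE X0) orbF.
  by rewrite subr_eq0 -(rmorph_nat (real_complex R)) => /eqP /rC_inj.
have prCoZ' a b : a \in Phi -> b \in Phi -> exists z : int, pr b (Co a) = z%:~R.
  move=> aP bP; have [_ [_ [H _]]] := Hchev (rP aP); have [z Ez] := H _ (rP bP); exists z.
  by apply: rC_inj; rewrite -fn_hT CoE // Ez rmorph_int.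
have cS a u v : cf a (u + v) = cf a u + cf a v by have := cL a 1 u v; rewrite scale1r mul1r.
have c0 a : cf a 0 = 0 by apply: (@addrI _ (cf a 0)); rewrite -cS !addr0.
have cZ a z v : cf a (z *: v) = z * cf a v by have := cL a z v 0; rewrite c0 !addr0.
have gRcf c v : c \in Phi -> gR v -> exists r : R, cf c v = r%:C.
  move=> cP [H [l [/hR_hT [x ->] rl ->]]]; rewrite cS cT add0r.
  elim: l rl => [|p l IH] rl; first by exists 0; rewrite big_nil c0.
  have [|r Er] := IH; first by move=> q ql; apply: rl; right.
  have rp := rl p (or_introl erefl).
  exists (p.2 * (c == rv p.1)%:R + r); rewrite big_cons cS cZ Er -(X_rv rp) cX ?root_in_Phi //.
  by rewrite rmorphD rmorphM rmorph_nat.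
have creal a b c : a \in Phi -> b \in Phi -> c \in Phi ->
    exists r : R, cf c (br (Xe a) (Xe b)) = r%:C.
  move=> aP bP cP; apply: gRcf => //; case: HgR => _ [gB _ _].
  by apply: gB; apply: gR_X; apply: rP.
have tA : antilinear tau by case: Htau.
have tT x : tau (hT x) = - hT x by apply: HtauH; apply: hT_hR.
have tX a : a \in Phi -> tau (Xe a) = Xe (- a) by move=> aP; rewrite XN // HtauX //; apply: rP.
move=> SS SPhi; pose D := @ChevData R V br d Phi hT (fun a => Xe a) Co cf tau uP Phi0' PhiN' hT_lin
  brTX' br_hT_hT cL cT cX cD nondeg brXN' prCo2' prCoZ' creal tA tau_hom tT tX.
exact: (@quasisplit_lift R V br Hlie D S SS SPhi).
Qed.

(** * The matrix of the involution and its lift to the real form *)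

Variable s : (V -> R[i]) -> (V -> R[i]).
Hypothesis Hs : in_IPhi br h s.

Lemma fn_dual a : hRdual br h (fn a).
Proof.
split=> [H /hR_hT [x ->]|r H K _ _]; last exact: fn_lin.
by exists (pr a x); rewrite fn_hT.
Qed.

Lemma dual_fn l : hRdual br h l -> eqhR br h l (fn (rv l)).
Proof. by move=> dl H /hR_hT [x ->]; rewrite dual_hT // fn_hT. Qed.

Lemma rv_eqhR l m : eqhR br h l m -> rv l = rv m.
Proof. by move=> H; apply/rowP => j; rewrite !mxE H //; apply: t_hR. Qed.

Definition sE (a : E) : E := rv (s (fn a)).

Lemma s_dual l : hRdual br h l -> hRdual br h (s l).
Proof. by case: Hs => [[H _] _]; apply: H. Qed.

Lemma rv_s l : hRdual br h l -> rv (s l) = sE (rv l).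
Proof.
move=> dl; apply: rv_eqhR; case: Hs => [[_ H] _]; apply: H => //; first exact: fn_dual.
exact: dual_fn.
Qed.

Lemma sE_lin r a b : sE (r *: a + b) = r *: sE a + sE b.
Proof.
case: Hs => [[_ Hext] [Hlin _ _ _]].
have da := fn_dual a; have db := fn_dual b.
have dab : hRdual br h (fun v => r%:C * fn a v + fn b v).
  split=> [H hH|q H K _ _]; last by rewrite !fn_lin; ring.
  have [x ->] := hR_hT hH; exists (r * pr a x + pr b x).
  by rewrite !fn_hT rmorphD rmorphM.
have E1 : eqhR br h (fn (r *: a + b)) (fun v => r%:C * fn a v + fn b v).
  by move=> H /hR_hT [x ->]; rewrite !fn_hT prDl prZl rmorphD rmorphM.
rewrite /sE (rv_eqhR (Hext _ _ (fn_dual _) dab E1)) (rv_eqhR (Hlin r _ _ da db)).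
apply/rowP => j; rewrite !mxE.
have [x Ex] := (s_dual da).1 _ (t_hR j); have [y Ey] := (s_dual db).1 _ (t_hR j).
by rewrite Ex Ey /= mul0r subr0.
Qed.

Definition smx : 'M[R]_d := \matrix_(i < d) sE (delta_mx 0 i).

Lemma smxE a : a *m smx = sE a.
Proof.
have sE0 : sE 0 = 0.
  by have := sE_lin (-1) 0 0; rewrite scaler0 addr0 scaleN1r addNr.
rewrite mulmx_sum_row {2}(row_sum_delta a).
elim: (index_enum _) => [|j l IH]; first by rewrite !big_nil.
by rewrite !big_cons sE_lin IH rowK.
Qed.

Lemma sEK a : sE (sE a) = a.
Proof.
have da := fn_dual a; rewrite -(rv_s (s_dual da)); case: Hs => [_ [_ H _ _]].
by rewrite (rv_eqhR (H _ da)) rv_fn.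
Qed.

Lemma smx_inv : smx *m smx = 1%:M.
Proof.
apply/row_matrixP => i; rewrite row_mul row1 rowK smxE.
exact: sEK.
Qed.

Lemma smx_Phi : {in Phi, forall g, g *m smx \in Phi}.
Proof.
move=> g gP /=; rewrite smxE; case: Hs => [_ [_ _ _ [H _]]].
by have [b rb Eb] := H _ (rP gP); rewrite /sE (rv_eqhR Eb) root_in_Phi.
Qed.

Lemma quasisplit_exists : exists sigma : V -> V,
    [/\ inv_aut br gR sigma, maps_onto sigma hR, maps_onto sigma (twisted gR tau),
        rho_is br h sigma s & quasi_split br (twisted gR sigma)].
Proof.
have [sg [[sA sB sT ss st] sX [b bB bs]]] := coordinate_lift smx_inv smx_Phi.
case: (HgR) => [[g0 gD gZ] [gB gdec guniq]].
have gs x : gR x -> gR (sg x).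
  move=> [H [l [hH rl ->]]]; rewrite (alD sA) (al_sum sA); apply: (gD).
    by have [z ->] := hR_hT hH; rewrite sT; apply: gR_hR; apply: hT_hR.
  elim: l rl => [|p l IH] rl; first by rewrite big_nil.
  rewrite big_cons; apply: (gD); last by apply: IH => q ql; apply: rl; right.
  have rp := rl p (or_introl erefl); rewrite (alZr sA) -(X_rv rp); apply: (gZ).
  have pP := root_in_Phi rp; have [r ->] := sX _ pP; apply: (gZ); apply: gR_X; apply: rP.
  exact: smx_Phi.
have hs H : hR H -> hR (sg H) by move=> /hR_hT [x ->]; rewrite sT; apply: hT_hR.
have conji : conjc ('i : R[i]) = - 'i.
  by apply/eqP; rewrite eq_complex /= oppr0 !eqxx.
have sgi x y : sg (x + 'i *: y) = sg x + 'i *: - sg y.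
  by rewrite (alD sA) (alZ sA) conji scalerN scaleNr.
have gN x : gR x -> gR (- x).
  by move=> /(gZ (-1)); rewrite rmorphN rmorph1 scaleN1r.
(* Commuting with [tau] preserves both eigenspaces of [tau] in g_R; the antilinear sigma adds a sign
   on the imaginary part. *)
have gtw v : twisted gR tau v -> twisted gR tau (sg v).
  move=> [x [y [gx gy tx ty ->]]]; exists (sg x), (- sg y); split=> //.
  - exact: gs.
  - by apply: (gN); apply: (gs).
  - by rewrite -st tx.
  - by case: Htau => tA _ _ _; rewrite (alN tA) -st ty (alN sA).
exists sg; split.
- by split=> // x y _ _; apply: sB.
- by split=> // y hy; exists (sg y); rewrite ?ss //; apply: hs.
- by split=> // y hy; exists (sg y); rewrite ?ss //; apply: gtw.
- move=> l dl H /hR_hT [x ->]; rewrite sT !dual_hT //; last exact: s_dual.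
  by rewrite rv_s // -smxE pr_mx (mulmx_trinvolK _ smx_inv).
exists sg; split=> //.
  (* Since sigma (x + iy) = sigma x - i sigma y with both parts in g_R, uniqueness of the
     decomposition turns sigma v = v into the two conditions defining g_sigma. *)
  move=> v; split; last first.
    by move=> [x [y [gx gy sx sy ->]]]; rewrite sgi sx sy opprK.
  have [x [y [gx gy ->]]] := gdec v; rewrite sgi => /eqP; rewrite -subr_eq0 opprD addrACA -scalerBr => /eqP E0.
  have [||/eqP sx /eqP sy] := guniq _ _ _ _ E0.
  - by apply: (gD); [exact: gs | exact: gN].
  - by rewrite -opprD; apply: (gN); apply: (gD) => //; apply: (gs).
  exists x, y; split=> //; first by apply/eqP; rewrite -subr_eq0.
  by move: sy; rewrite subr_eq0 eqr_oppLR => /eqP.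
exists b => //; split=> // y yb; exists (sg y); first exact: bs.
exact: ss.
Qed.

End Coordinates.

Theorem theorem3p15 (R : realType) (V : vectType R[i]) (br : V -> V -> V)
  (Hlie : lie_bracket br) (Hss : semisimple br)
  (h : {vspace V}) (Hh : cartan br h)
  (X Hc : (V -> R[i]) -> V) (Hchev : chevalley br h X Hc)
  (HgR : real_form br (in_gR br h X))
  (tau : V -> V)
  (Htau : inv_aut br (in_gR br h X) tau)
  (HtauH : forall H, in_hR br h H -> tau H = - H)
  (HtauX : forall a, is_root br h a -> tau (X a) = X (negf a))
  (s : (V -> R[i]) -> (V -> R[i])) (Hs : in_IPhi br h s) :
  exists sigma : V -> V,
    [/\ inv_aut br (in_gR br h X) sigma,
        maps_onto sigma (in_hR br h),
        maps_onto sigma (twisted (in_gR br h X) tau),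
        rho_is br h sigma s
      & quasi_split br (twisted (in_gR br h X) sigma)].
Proof.
have [t [tR tf th]] := hR_basis Hlie Hh Hchev HgR.
have [Phi [uP rP sP]] := finite_roots Hlie Hchev HgR tR tf th.
exact: (quasisplit_exists Hlie Hss Hh Hchev HgR tR tf th uP rP sP Htau HtauH HtauX Hs).
Qed.
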